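(* There is a polynomial-time algorithm which, given any instance of the $k$-facility location problem with outliers ($k$FLO), outputs a set $F' \subseteq \mathcal{F}$ of opened facilities with $|F'| \le k+1$ together with an assignment of at least $m-t$ clients to facilities in $F'$, whose total cost $\sum_{i\in F'} f_i + \sum_{j \text{ served}} c(j,\sigma(j))$ is at most $11\cdot OPT$, where $OPT$ is the minimum cost of a feasible solution (one opening at most $k$ facilities and serving at least $m-t$ clients).
   Context: Facility location with outliers (FLO): an instance consists of a finite set $\mathcal{F}$ of facilities, a finite set $\mathcal{C}$ of $m$ clients, opening costs $f_i \ge 0$ for $i\in\mathcal{F}$, a metric $c$ on $\mathcal{F}\cup\mathcal{C}$ (nonnegative, symmetric, satisfying the triangle inequality), and an integer $t \ge 0$ (the number of allowed outliers). A feasible solution chooses a set $F'\subseteq\mathcal{F}$ of facilities to open and an assignment $\sigma$ mapping a subset of at least $m-t$ clients to facilities in $F'$ (the unassigned clients are outliers); its cost is $\sum_{i\in F'} f_i + \sum_{j \text{ assigned}} c(j,\sigma(j))$. The goal is to minimize cost. In the $k$-facility location problem with outliers ($k$FLO), an integer $k\ge 1$ is additionally given and feasible solutions must satisfy $|F'|\le k$. *)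

(* Defs.v *)
From HB Require Import structures.
From mathcomp Require Import all_boot all_order all_algebra.
Set Implicit Arguments. Unset Strict Implicit. Unset Printing Implicit Defensive.
Import Order.TTheory GRing.Theory Num.Theory.

Definition sym := 'I_3.
Definition blank : sym := @Ordinal 3 0 isT.
Definition sym_of_bool (b : bool) : sym :=
  if b then @Ordinal 3 2 isT else @Ordinal 3 1 isT.

(* States 'I_n.+1, start state ord0; delta returns None = halt;
   the boolean is the head move (true = right, false = left). *)
Record TM := { tm_n : nat;
  tm_delta : {ffun 'I_tm_n.+1 * sym -> option ('I_tm_n.+1 * sym * bool)} }.

(* configuration: state, left part (nearest cell first), head cell, right part *)
Definition config (M : TM) := ('I_(tm_n M).+1 * seq sym * sym * seq sym)%type.

Definition step (M : TM) (c : config M) : option (config M) :=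
  let: (q, L, a, R) := c in
  match tm_delta M (q, a) with
  | None => None
  | Some (q', b, true) =>
      Some (q', b :: L, head blank R, behead R)
  | Some (q', b, false) =>
      Some (q', behead L, head blank L, b :: R)
  end.

Fixpoint exec (M : TM) (n : nat) (c : config M) : option (config M) :=
  match @step M c with
  | None => Some c
  | Some c' => if n is n'.+1 then @exec M n' c' else None
  end.

Definition init (M : TM) (w : seq bool) : config M :=
  (ord0, [::], head blank (map sym_of_bool w), behead (map sym_of_bool w)).

Definition output (M : TM) (c : config M) : seq bool :=
  let: (_, _, a, R) := c in
  let s := a :: R in
  map (fun x : sym => x == @Ordinal 3 2 isT) (take (find (pred1 blank) s) s).

(* Binary, self-delimiting encodings. *)
Fixpoint bin_aux (fuel n : nat) : seq bool :=
  if fuel is f.+1 then (if n == 0%N then [::] else odd n :: bin_aux f n./2)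
  else [::].
Definition bin (n : nat) : seq bool := bin_aux n n.
Definition enc_nat (n : nat) : seq bool :=
  flatten [seq [:: b; b] | b <- bin n] ++ [:: false; true].
Definition enc_int (z : int) : seq bool :=
  match z with Posz n => [:: false] ++ enc_nat n | Negz n => [:: true] ++ enc_nat n end.
Definition enc_rat (r : rat) : seq bool := enc_int (numq r) ++ enc_int (denq r).

(* kFLO instances: facilities 'I_nf, clients 'I_nc (m = nc); the metric is
   given on the points 'I_(nf + nc) (facility i = lshift, client j = rshift). *)
Record inst := {
  nf : nat; nc : nat;
  fcost : {ffun 'I_nf -> rat};
  dist : {ffun 'I_(nf + nc) * 'I_(nf + nc) -> rat};
  outl : nat;
  kk : nat }.

Definition fac (I : inst) (i : 'I_(nf I)) : 'I_(nf I + nc I) := lshift (nc I) i.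
Definition cli (I : inst) (j : 'I_(nc I)) : 'I_(nf I + nc I) := rshift (nf I) j.

Definition valid_inst (I : inst) : Prop :=
  (1 <= kk I)%N /\
  (forall i, 0 <= fcost I i)%R /\
  (forall x y, 0 <= dist I (x, y))%R /\
  (forall x y, dist I (x, y) = dist I (y, x)) /\
  (forall x y z, dist I (x, z) <= dist I (x, y) + dist I (y, z))%R.

Definition enc_inst (I : inst) : seq bool :=
  enc_nat (nf I) ++ enc_nat (nc I) ++ enc_nat (outl I) ++ enc_nat (kk I) ++
  flatten [seq enc_rat (fcost I i) | i <- enum 'I_(nf I)] ++
  flatten [seq enc_rat (dist I p) | p <- enum [set: 'I_(nf I + nc I) * 'I_(nf I + nc I)]].

(* A solution: opened set F' and a partial assignment sigma
   (sigma j = None means j is an outlier). *)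
Record sol (I : inst) := { opened : {set 'I_(nf I)};
                           assign : {ffun 'I_(nc I) -> option 'I_(nf I)} }.

Definition feasible (I : inst) (K : nat) (S : sol I) : Prop :=
  (#|opened S| <= K)%N /\
  (forall j i, assign S j = Some i -> i \in opened S) /\
  (nc I - outl I <= #|[set j | assign S j != None]|)%N.

Definition cost (I : inst) (S : sol I) : rat :=
  (\sum_(i in opened S) fcost I i +
   \sum_(j < nc I) match assign S j with
                   | Some i => dist I (cli j, fac i) | None => 0 end)%R.

Definition enc_sol (I : inst) (S : sol I) : seq bool :=
  enc_nat #|opened S| ++
  flatten [seq enc_nat (nat_of_ord i) | i <- enum (opened S)] ++
  flatten [seq enc_nat (if assign S j is Some i then (nat_of_ord i).+1 else 0%N)
          | j <- enum 'I_(nc I)].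

(* Main.v *)
(* Jain-Vazirani with a Lagrangian term.  Charging lam extra per facility, let all clients raise a dual value at
   unit speed; a facility is recorded when the values it sees pay for it, which freezes the clients within
   reach, and the run stops once q = m - t clients are frozen.  A greedy maximal independent family of the
   recorded facilities costs at most 10 times the dual value up to lam times their number, except for the last
   recorded one, which is not fully paid by served clients.  Since some solution of value OPT opens only
   facilities no dearer than its dearest one, guessing the latter bounds that exceptional cost by OPT: 10 + 1 = 11.

   A binary search finds an integer lam such that the run for lam gives at least k facilities (not counting the
   last) and the run for lam + 1 at most k.  The dual values of the two runs differ by at most delta m m, so
   after multiplying the instance by a factor larger than every rounding error the two families can be merged:
   keep the facilities of the first run linked to the second, add s of the unlinked ones of the second run and
   fill up to k from the first.  At the first s for which more than q clients must be served, one extra facility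
   (the (k+1)-st) makes the intermediate service of exactly q clients possible.

   For the running time, functions computed by a small language of programs on binary trees, with a cost that
   bounds all intermediate sizes, are closed under the usual list and arithmetic operations; such programs
   compile to stack register machines, and these to one-tape Turing machines. *)

From HB Require Import structures.
Require Import Defs.
From mathcomp Require Import all_boot all_order all_algebra zify perm.
From Stdlib Require Import FunctionalExtensionality.
Set Implicit Arguments. Unset Strict Implicit. Unset Printing Implicit Defensive.

(** * Turing machines on infinite tapes *)

(** Times and multipliers are integers, so no rational breakpoints have to be computed. The price is
    twofold: a facility is paid for only up to [m], and the runs for [lam] and [lam.+1] have dual
    values that differ by an amount exponential in [m]. That amount has polynomially many bits, so
    scaling by a larger [N] is affordable; the total error stays below [N] and vanishes, all costs
    being multiples of [N]. The number of facilities need not be monotone in [lam]: the search uses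
    only that [many] holds at one end and fails at the other. The constant 10 is 3 + 7. Within a
    run, a frozen client of value [a] has a selected facility within [3 a]. A facility of the second
    run recorded at time [T] is replaced by one of the first at distance at most [7 T]: one [T] to a
    client that caused it, then three times the value of that client in the first run, at most
    [T + D]; divisibility by [N] turns [T + 3 (T + D)] into [7 T]. Opening costs carry the factor 10
    too, so the Lagrangian terms cancel when exactly [k] facilities are paid for. *)

Definition stream := nat -> sym.
Definition scons (a : sym) (s : stream) : stream := fun n => if n is m.+1 then s m else a.
Definition stail (s : stream) : stream := fun n => s n.+1.
Definition sapp (u : seq sym) (s : stream) : stream := foldr scons s u.
Notation "u +++ s" := (sapp u s) (at level 60, right associativity).
Definition blanks : stream := fun=> blank.

Lemma scons_eta s : scons (s 0) (stail s) = s.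
Proof. by apply: functional_extensionality; case. Qed.

Lemma scons_blanks : scons blank blanks = blanks.
Proof. exact: (scons_eta blanks). Qed.

Lemma sapp_cat u v s : (u ++ v) +++ s = u +++ (v +++ s).
Proof. exact: foldr_cat. Qed.

Lemma sapp_rcons u a s : rcons u a +++ s = u +++ scons a s.
Proof. by rewrite -cats1 sapp_cat. Qed.

Section Machine.
Variables (Q : finType) (dl : Q -> sym -> option (Q * sym * bool)).

Definition gconf := (Q * stream * stream)%type.

Definition gstep (c : gconf) : option gconf :=
  let: (q, L, s) := c in
  match dl q (s 0) with
  | None => None
  | Some (q', b, true) => Some (q', scons b L, stail s)
  | Some (q', b, false) => Some (q', stail L, scons (L 0) (scons b (stail s)))
  end.

Inductive reach : nat -> gconf -> gconf -> Prop :=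
| reach0 n c : reach n c c
| reachS n c d e : gstep c = Some d -> reach n d e -> reach n.+1 c e.

Lemma reach_le m n c d : m <= n -> reach m c d -> reach n c d.
Proof.
move=> + r; elim: r n => [k e n _|k e f g ef fg IH [//|n] lekn]; first exact: reach0.
exact: (reachS ef (IH _ lekn)).
Qed.

Lemma reach_trans m n c d e : reach m c d -> reach n d e -> reach (m + n) c e.
Proof.
elim=> [k f|k f g h fg gh IH] de; first exact: (reach_le (leq_addl k n) de).
exact: (reachS fg (IH de)).
Qed.

(** Serves to enter a phase of the simulation from a state that acts on the present cell exactly as
    the first state of that phase does. *)
Lemma reach_same_step n c c' e : c'.1.1 != e.1.1 -> gstep c = gstep c' ->
  reach n c' e -> reach n c e.
Proof.
move=> ne eqs r; case: r ne eqs => [k d|k d f g df fg]; first by rewrite eqxx.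
by move=> _ eqs; apply: (reachS _ fg); rewrite eqs.
Qed.

Variable q0 : Q.

Lemma card_prednK : #|Q| = #|Q|.-1.+1.
Proof. by rewrite prednK //; apply/card_gt0P; exists q0. Qed.

Let rk (q : Q) : 'I_(#|Q|.-1).+1 := cast_ord card_prednK (enum_rank q).
(** [TM] fixes [ord0] as start state, hence the transposition that moves the rank of [q0] there. *)
Definition st_enc (q : Q) := tperm (rk q0) ord0 (rk q).
Definition st_dec (x : 'I_(#|Q|.-1).+1) : Q :=
  enum_val (cast_ord (esym card_prednK) (tperm (rk q0) ord0 x)).

Lemma st_encK : cancel st_enc st_dec.
Proof. by move=> q; rewrite /st_dec /st_enc tpermK cast_ordK enum_rankK. Qed.

Lemma st_enc0 : st_enc q0 = ord0.
Proof. by rewrite /st_enc tpermL. Qed.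

Definition to_TM : TM :=
  {| tm_n := #|Q|.-1;
     tm_delta := [ffun p => omap (fun x : Q * sym * bool => (st_enc x.1.1, x.1.2, x.2))
                                 (dl (st_dec p.1) p.2)] |}.

Definition sim (c : config to_TM) (g : gconf) : Prop :=
  let: (q, L, a, R) := c in
  [/\ q = st_enc g.1.1, nth blank L = g.1.2 & nth blank (a :: R) = g.2].

Lemma sim_halt c g : sim c g -> gstep g = None -> step c = None.
Proof.
case: c => [[[q L] a] R]; case: g => [[p M] s] [/= -> _ <-] /=.
by rewrite ffunE /= st_encK; case: dl => [[[p' b] []]|].
Qed.

Lemma nth_behead L : nth blank (behead L) = stail (nth blank L).
Proof. by apply: functional_extensionality => n; rewrite nth_behead. Qed.

Lemma nth_cons a L : nth blank (a :: L) = scons a (nth blank L).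
Proof. by apply: functional_extensionality; case. Qed.

Lemma nth_head_behead R : nth blank (head blank R :: behead R) = nth blank R.
Proof. by case: R => [|x R] //=; apply: functional_extensionality; case=> [|[]]. Qed.

Lemma sim_step c g h : sim c g -> gstep g = Some h ->
  exists2 d, step c = Some d & sim d h.
Proof.
case: c => [[[q L] a] R]; case: g => [[p M] s] [/= -> eL eR].
rewrite ffunE /= st_encK -eR /=; case: dl => [[[p' b] [] ]|//] /= [<-].
  eexists; first by []; split=> //=; first by rewrite nth_cons eL.
  by rewrite nth_head_behead; apply: functional_extensionality.
eexists; first by []; split=> //=; first by rewrite nth_behead eL.
by rewrite nth_cons -eL nth0 nth_cons; congr scons.
Qed.

Lemma sim_reach n g h c : reach n g h -> gstep h = None -> sim c g ->
  exists2 d, exec n c = Some d & sim d h.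
Proof.
move=> r; elim: r c => [k f|k f f' f'' ff' _ IH] c hh cg.
  by exists c => //; case: k => [|k] /=; rewrite (sim_halt cg hh).
have [d cd sd] := sim_step cg ff'; have [e de se] := IH _ hh sd.
by exists e => //=; rewrite cd.
Qed.

Lemma sim_output c g (o : seq bool) s : sim c g ->
  g.2 = map sym_of_bool o +++ scons blank s -> output c = o.
Proof.
case: c => [[[q L] a] R] [_ _ eR] eg; rewrite -eR {eR} in eg.
rewrite /output; move: (a :: R) eg => {q L a R g} t.
elim: o t => [|b o IH] [|x t] /= e.
- by [].
- by have /= -> := congr1 (fun f => f 0) e.
- by have /= := congr1 (fun f => f 0) e; case: b {e}.
have et : nth blank t = map sym_of_bool o +++ scons blank s.
  by apply: functional_extensionality => n; have := congr1 (fun f => f n.+1) e.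
have /= -> := congr1 (fun f => f 0) e.
by case: b {e}; rewrite /= IH.
Qed.

Lemma sim_init w : sim (init to_TM w) (q0, blanks, map sym_of_bool w +++ blanks).
Proof.
split; first by rewrite st_enc0.
  by apply: functional_extensionality => n; rewrite nth_nil.
rewrite nth_head_behead; elim: w => [|b w IH] /=.
  by apply: functional_extensionality => n; rewrite nth_nil.
by rewrite nth_cons IH.
Qed.

End Machine.

(** * Register machines *)

(* Registers hold bit strings used as stacks. *)
Definition regs := nat -> seq bool.
Definition upd (r : regs) i s : regs := fun j => if j == i then s else r j.

Inductive instr (V : Type) :=
| IPush of nat & bool & V
| IPop of nat & V & V & V.

Definition imap V W (f : V -> W) (x : instr V) : instr W :=
  match x with
  | IPush i b v => IPush i b (f v)
  | IPop i vn v0 v1 => IPop i (f vn) (f v0) (f v1)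
  end.

Definition ireg V (x : instr V) := match x with IPush i _ _ => i | IPop i _ _ _ => i end.

Definition iexec V (x : instr V) (r : regs) : V * regs :=
  match x with
  | IPush i b v => (v, upd r i (b :: r i))
  | IPop i vn v0 v1 =>
    match r i with
    | [::] => (vn, r)
    | b :: s => (if b then v1 else v0, upd r i s)
    end
  end.

(** * Register machines on one tape *)

Section Flat.
Variables (V : finType) (code : V -> instr (option V)).

Inductive fsteps : nat -> option V * regs -> option V * regs -> Prop :=
| fsteps0 c : fsteps 0 c c
| fstepsS n v r c : fsteps n (iexec (code v) r) c -> fsteps n.+1 (Some v, r) c.

Lemma fsteps_trans m n c d e : fsteps m c d -> fsteps n d e -> fsteps (m + n) c e.
Proof. by elim=> [//|k v r f _ IH] de; apply/fstepsS/IH. Qed.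

Variable k : nat.
Hypothesis code_lt : forall v, ireg (code v) < k.

Notation K := 'I_k.+1.
Definition phase : finType := ((K + K) + K + ((sym * K) + (sym * K)))%type.
Notation Seek c := (inl (inl (inl c))).
Notation Ret c := (inl (inl (inr c))).
Notation GoEnd c := (inl (inr c)).
Notation ShR x c := (inr (inl (x, c))).
Notation ShL x c := (inr (inr (x, c))).

Definition ctr (n : nat) : K := inord n.
Definition pred_ctr (b : bool) (c : K) : K := if b then ctr c.-1 else c.
Definition seek_of (o : option V) : option V * phase :=
  (o, Seek (ctr (if o is Some v then ireg (code v) else 0))).

Definition next_of (x : instr (option V)) (a : sym) : option V :=
  match x with
  | IPush _ _ v => v
  | IPop _ vn v0 v1 => if a == sym_of_bool true then v1 else v0
  end.

(** Separators and the cells outside the registers are all blank, so the cell before the first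
    register is recognised only by having counted the separators on the way back. *)
Definition ret_delta (o : option V) (c : K) (a : sym) : option ((option V * phase) * sym * bool) :=
  if (a == blank) && (c == 0 :> nat) then Some (seek_of o, a, true)
  else Some ((o, Ret (pred_ctr (a == blank) c)), a, false).

(* [Seek c] skips [c] registers; [ShR x c] and [ShL x c] shift the tape by one cell, carrying [x],
   until [c] separators have been passed; [Ret c] goes back to the first cell, the first component
   of the state being then the next instruction. *)
Definition tm_step (q : option V * phase) (a : sym) : option ((option V * phase) * sym * bool) :=
  match q with
  | (o, Ret c) => ret_delta o c a
  | (Some v, Seek c) =>
    if 0 < c then Some ((Some v, Seek (pred_ctr (a == blank) c)), a, true)
    else match code v with
         | IPush i b _ => Some ((Some v, ShR a (ctr (k - i))), sym_of_bool b, true)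
         | IPop i vn _ _ => if a == blank then Some ((vn, Ret (ctr i)), a, false)
                            else Some ((Some v, GoEnd (ctr (k - i))), a, true)
         end
  | (Some v, GoEnd c) =>
    if (a == blank) && (c == 1 :> nat) then
      Some ((Some v, ShL blank (ctr (k - ireg (code v)).-1)), blank, false)
    else Some ((Some v, GoEnd (pred_ctr (a == blank) c)), a, true)
  | (Some v, ShR x c) =>
    if (x == blank) && (c == 1 :> nat) then
      Some ((next_of (code v) x, Ret (ctr k.-1)), x, false)
    else Some ((Some v, ShR a (pred_ctr (x == blank) c)), x, true)
  | (Some v, ShL x c) =>
    if (a == blank) && (c == 0 :> nat) then
      ret_delta (next_of (code v) x) (ctr (ireg (code v))) a
    else Some ((Some v, ShL a (pred_ctr (a == blank) c)), x, false)
  | (None, _) => None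
  end.

Notation treach := (reach tm_step).

Lemma ctrK n : n <= k -> ctr n = n :> nat.
Proof. by move=> lenk; rewrite inordK. Qed.

Lemma pred_ctrE b n : n <= k -> pred_ctr b (ctr n) = ctr (n - b).
Proof. by case: b => lenk; rewrite ?subn0 //= ctrK // subn1. Qed.

(* The configuration whose head is on the last cell of [v], or on the cell before it if [v] is empty. *)
Definition at_last (q : option V * phase) (v : seq sym) (L s : stream) : gconf _ :=
  (q, stail (rev v +++ L), scons ((rev v +++ L) 0) s).

Lemma at_last_rcons q v z L s : at_last q (rcons v z) L s = (q, rev v +++ L, scons z s).
Proof. by rewrite /at_last rev_rcons /=. Qed.

Lemma tm_step_ret o c a : tm_step (o, Ret c) a = ret_delta o c a.
Proof. by case: o. Qed.
Arguments tm_step : simpl never.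

Lemma ret_reach o v n s : count_mem blank v = n -> n <= k ->
  treach (size v).+1 (at_last (o, Ret (ctr n)) v blanks s) (seek_of o, blanks, v +++ s).
Proof.
elim/last_ind: v n s => [|v z IH] n s.
  move=> <- _; apply: (reachS _ (reach0 _ _ _)).
  rewrite /= tm_step_ret /ret_delta ctrK //.
  by congr (Some (_, _, _)); exact: scons_blanks.
rewrite -cats1 count_cat /= addn0 cats1 at_last_rcons size_rcons => en lenk.
apply: (@reachS _ _ _ _ (at_last (o, Ret (ctr (n - (z == blank)))) v blanks (scons z s))).
  rewrite /= tm_step_ret /ret_delta ctrK //.
  have -> : (z == blank) && (n == 0) = false.
    by move: en; case: (z == blank) => //= <-; rewrite addn1.
  by rewrite pred_ctrE.
rewrite sapp_rcons; apply: IH; first by rewrite -en addnK.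
exact: leq_trans (leq_subr _ _) lenk.
Qed.

Lemma seek_reach v u n L s : count_mem blank u = n -> last blank u = blank -> n <= k ->
  treach (size u) ((Some v, Seek (ctr n)), L, u +++ s) ((Some v, Seek (ctr 0)), rev u +++ L, s).
Proof.
elim: u n L => [|a u IH] n L.
  by move=> <- _ _; apply: reach0.
move=> en lu lenk; apply: (@reachS _ _ _ _ ((Some v, Seek (ctr (n - (a == blank)))), scons a L, u +++ s)).
  rewrite /= /tm_step ctrK // lt0n.
  have -> : n != 0.
    rewrite -en /=; case: (a =P blank) => // na; rewrite add0n -lt0n -has_count has_pred1.
    case: u lu na {IH en} => [/= -> //|b u /= lu _].
    by rewrite -{1}lu mem_last.
  by rewrite pred_ctrE.
rewrite rev_cons sapp_rcons; apply: IH.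
- by rewrite -en /= addKn.
- by case: u lu {en} => [|b u].
exact: leq_trans (leq_subr _ _) lenk.
Qed.

Lemma goend_reach v u n L s : count_mem blank u = n -> n < k ->
  treach (size u).+1 ((Some v, GoEnd (ctr n.+1)), L, u +++ scons blank s)
    (at_last (Some v, ShL blank (ctr (k - ireg (code v)).-1)) (rev (rev u)) L (scons blank s)).
Proof.
elim: u n L => [|a u IH] n L.
  move=> <- ltk; apply: (reachS _ (reach0 _ _ _)).
  by rewrite /= /tm_step ctrK.
move=> en lenk; apply: (@reachS _ _ _ _ ((Some v, GoEnd (ctr (n - (a == blank)).+1)), scons a L, u +++ scons blank s)).
  rewrite /= /tm_step ctrK //.
  have -> : (a == blank) && (n.+1 == 1) = false.
    by move: en => /=; case: (a == blank) => //= <-.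
  have <- : n.+1 - (a == blank) = (n - (a == blank)).+1.
    by move: en => /=; case: (a == blank) => /= <-; rewrite ?subn0 ?add1n ?subn1.
  by rewrite pred_ctrE.
have -> : at_last (Some v, ShL blank (ctr (k - ireg (code v)).-1)) (rev (rev (a :: u))) L (scons blank s)
  = at_last (Some v, ShL blank (ctr (k - ireg (code v)).-1)) (rev (rev u)) (scons a L) (scons blank s).
  by rewrite /at_last !revK rev_cons sapp_rcons.
apply: IH; first by rewrite -en /= addKn.
by apply: leq_ltn_trans (leq_subr _ _) lenk.
Qed.

(** The blank [L 0] is where the shift ends; the symbol carried at that moment is the old first
    cell, which in [step_reach] is the popped bit. *)
Lemma shl_reach v x u n L s : L 0 = blank -> count_mem blank u = n -> n <= k ->
  treach (size u) (at_last (Some v, ShL x (ctr n)) u L s)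
     (at_last (Some v, ShL (head blank (rcons u x)) (ctr 0)) [::] L (behead (rcons u x) +++ s)).
Proof.
move=> L0; elim/last_ind: u x n s => [|u z IH] x n s.
  by move=> <- _; apply: reach0.
rewrite -cats1 count_cat /= addn0 cats1 at_last_rcons size_rcons => en lenk.
apply: (@reachS _ _ _ _ (at_last (Some v, ShL z (ctr (n - (z == blank)))) u L (scons x s))).
  rewrite /= /tm_step ctrK //.
  have -> : (z == blank) && (n == 0) = false.
    by move: en; case: (z == blank) => //= <-; rewrite addn1.
  by rewrite pred_ctrE.
have -> : head blank (rcons (rcons u z) x) = head blank (rcons u z) by case: (u).
have -> : behead (rcons (rcons u z) x) +++ s = behead (rcons u z) +++ scons x s.
  by case: (u) => [//|y w] /=; rewrite !sapp_rcons.
apply: IH; first by rewrite -en addnK.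
exact: leq_trans (leq_subr _ _) lenk.
Qed.

Lemma shr_reach v x u n L s : count_mem blank (belast x u) = n -> last x u = blank -> n < k ->
  treach (size u).+1 ((Some v, ShR x (ctr n.+1)), L, u +++ scons blank s)
    (at_last (next_of (code v) blank, Ret (ctr k.-1)) (belast x u) L (scons blank s)).
Proof.
elim: u x n L => [|a u IH] x n L.
  move=> <- /= -> ltk; apply: (reachS _ (reach0 _ _ _)).
  by rewrite /= /tm_step ctrK.
move=> /= en lu lenk; apply: (@reachS _ _ _ _ ((Some v, ShR a (ctr (n - (x == blank)).+1)), scons x L, u +++ scons blank s)).
  rewrite /= /tm_step ctrK //.
  have -> : (x == blank) && (n.+1 == 1) = false.
    by move: en => /=; case: (x == blank) => //= <-.
  have <- : n.+1 - (x == blank) = (n - (x == blank)).+1.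
    by move: en => /=; case: (x == blank) => /= <-; rewrite ?subn0 ?add1n ?subn1.
  by rewrite pred_ctrE.
have -> : at_last (next_of (code v) blank, Ret (ctr k.-1)) (x :: belast a u) L (scons blank s)
  = at_last (next_of (code v) blank, Ret (ctr k.-1)) (belast a u) (scons x L) (scons blank s).
  by rewrite /at_last rev_cons sapp_rcons.
apply: IH => //; first by rewrite -en /= addKn.
by apply: leq_ltn_trans (leq_subr _ _) lenk.
Qed.

Definition tape_of (r : regs) (l : seq nat) : seq sym :=
  flatten [seq rcons (map sym_of_bool (r i)) blank | i <- l].
Definition home (o : option V) (r : regs) : gconf _ :=
  (seek_of o, blanks, tape_of r (iota 0 k) +++ blanks).

Lemma count_tape_of r l : count_mem blank (tape_of r l) = size l.
Proof.
elim: l => [//|i l IH]; rewrite /tape_of /= count_cat -/(tape_of r l) IH -cats1 count_cat.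
by rewrite (_ : count_mem blank (map _ _) = 0) //; elim: (r i) => [//|[] w].
Qed.

Lemma last_tape_of r l : last blank (tape_of r l) = blank.
Proof.
elim: l => [//|i l IH]; rewrite /tape_of /= last_cat last_rcons -/(tape_of r l).
by case: (tape_of r l) IH.
Qed.

Lemma tape_of_upd r i w l : i \notin l -> tape_of (upd r i w) l = tape_of r l.
Proof.
move=> il; congr flatten; apply/eq_in_map => j jl; rewrite /upd.
by case: eqP => // eji; rewrite -eji jl in il.
Qed.

Lemma at_last_app q A w L s : at_last q w (rev A +++ L) s = at_last q (A ++ w) L s.
Proof. by rewrite /at_last rev_cat sapp_cat. Qed.

Lemma tape_of_split r i : i < k -> tape_of r (iota 0 k) =
  tape_of r (iota 0 i) ++ rcons (map sym_of_bool (r i)) blank ++ tape_of r (iota i.+1 (k - i.+1)).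
Proof.
move=> lik; have -> : iota 0 k = iota 0 i ++ i :: iota i.+1 (k - i.+1).
  by rewrite [in LHS](_ : k = i + (1 + (k - i.+1))) ?iotaD ?add0n ?addn1 //; lia.
by rewrite /tape_of map_cat flatten_cat.
Qed.

(** A push seeks the register, shifts to the right and returns; a pop seeks, goes to the end, shifts
    back and returns. Four sweeps bound both. *)
Lemma step_reach v r :
  treach (4 * size (tape_of r (iota 0 k)) + 8) (home (Some v) r)
    (home (iexec (code v) r).1 (iexec (code v) r).2).
Proof.
have lik := code_lt v; set i := ireg (code v) in lik.
set A := tape_of r (iota 0 i); set B := tape_of r (iota i.+1 (k - i.+1)).
have split_r w : tape_of (upd r i w) (iota 0 k) = A ++ rcons (map sym_of_bool w) blank ++ B.
  by rewrite (tape_of_split _ lik) {2}/upd eqxx !tape_of_upd ?mem_iota //; lia.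
have cA : count_mem blank A = i by rewrite count_tape_of size_iota.
have cB : count_mem blank B = k - i.+1 by rewrite count_tape_of size_iota.
have A0 : (rev A +++ blanks) 0 = blank.
  rewrite -[RHS](last_tape_of r (iota 0 i)) -/A.
  by case/lastP: A {cA split_r} => // u z; rewrite rev_rcons last_rcons.
have lB : last blank B = blank by exact: last_tape_of.
have csob w : count_mem blank (map sym_of_bool w) = 0 by elim: w => [//|[] w].
have nsob b : (sym_of_bool b == blank) = false by case: b.
have seekA T : treach (size A) (seek_of (Some v), blanks, (A ++ T) +++ blanks)
    ((Some v, Seek (ctr 0)), rev A +++ blanks, T +++ blanks).
  by rewrite sapp_cat; apply: seek_reach; rewrite ?last_tape_of // ltnW.
have eU : tape_of r (iota 0 k) = A ++ rcons (map sym_of_bool (r i)) blank ++ B.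
  by rewrite (tape_of_split _ lik).
rewrite /home eU; set T := _ ++ B in eU *; rewrite size_cat.
have cT : count_mem blank T = k - i by rewrite count_cat -cats1 count_cat csob cB /=; lia.
case ec: (code v) => [j b w|j vn v0 v1] /=; have ej : j = i by rewrite /i ec.
  all: rewrite {}ej in ec *.
- rewrite split_r.
  have [a [T' [eT lT]]] : exists a T', T = a :: T' /\ last a T' = blank.
    have : last blank T = blank by rewrite last_cat last_rcons lB.
    by case: (T) cT => [/=|a T' _ /=]; [lia | exists a, T'].
  have eb : rcons (belast a T') blank = T by rewrite eT -lT -lastI.
  have cb : count_mem blank (belast a T') = k - i.+1.
    by move: cT; rewrite -eb -cats1 count_cat /=; lia.
  rewrite (_ : 4 * _ + 8 = size A + (1 + ((size T').+1 + (size (A ++ sym_of_bool b :: belast a T')).+1 +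
     (2 * size A + size T + size T + 6)))); last by rewrite size_cat /= size_belast eT /=; lia.
  apply: reach_trans (seekA T) _.
  apply: reach_trans (_ : treach 1 _ ((Some v, ShR a (ctr (k - i.+1).+1)),
     scons (sym_of_bool b) (rev A +++ blanks), T' +++ scons blank blanks)) _.
    apply: reachS (reach0 _ _ _); rewrite eT /= /tm_step ctrK // ec /= scons_blanks.
    by rewrite (_ : (k - i.+1).+1 = k - i) //; lia.
  apply: (reach_le (leq_addr _ _)).
  apply: reach_trans (shr_reach _ _ _ cb lT _) _; first lia.
  have -> : scons (sym_of_bool b) (rev A +++ blanks) = rev (rcons A (sym_of_bool b)) +++ blanks.
    by rewrite rev_rcons.
  rewrite at_last_app cat_rcons.
  have -> : (A ++ rcons (map sym_of_bool (b :: r i)) blank ++ B) +++ blanks =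
      (A ++ sym_of_bool b :: belast a T') +++ scons blank blanks.
    have -> : rcons (map sym_of_bool (b :: r i)) blank ++ B = sym_of_bool b :: T by [].
    by rewrite -sapp_rcons rcons_cat -eb.
  rewrite ec /=; apply: ret_reach; last lia.
  by rewrite count_cat /= cA cb nsob; lia.
case er: (r i) => [|b w] /=.
  rewrite eU; have eT : T = blank :: B by rewrite /T er.
  rewrite (_ : 4 * _ + 8 = size A + (1 + ((size A).+1 + (2 * size A + 4 * size T + 6)))); last lia.
  apply: reach_trans (seekA T) _.
  apply: reach_trans (_ : treach 1 _ (at_last (vn, Ret (ctr i)) A blanks (scons blank (B +++ blanks)))) _.
    by apply: reachS (reach0 _ _ _); rewrite eT /= /tm_step ctrK // ec.
  apply: (reach_le (leq_addr _ _)).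
  by rewrite eT sapp_cat; apply: ret_reach => //; exact: ltnW.
rewrite split_r.
set T' := rcons (map sym_of_bool w) blank ++ B.
have eT : T = sym_of_bool b :: T' by rewrite /T er.
have [u eu] : exists u, T' = rcons u blank.
  have : last blank T' = blank by rewrite last_cat last_rcons lB.
  case/lastP: T' eT => [eT|u z _]; last by rewrite last_rcons => ->; exists u.
  by move: cT; rewrite eT /= nsob; lia.
have cu : count_mem blank u = k - i.+1.
  by move: cT; rewrite eT eu /= -cats1 count_cat /= nsob; lia.
have cbu : count_mem blank (sym_of_bool b :: u) = (k - i).-1.
  by rewrite /= cu nsob; lia.
rewrite (_ : 4 * _ + 8 = size A + (1 + ((size u).+1 + ((size u).+1 + ((size A).+1 +
   (2 * size A + 2 * size T + 8)))))); last by rewrite eT eu /= size_rcons; lia.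
apply: reach_trans (seekA T) _.
apply: reach_trans (_ : treach 1 _ ((Some v, GoEnd (ctr (k - i.+1).+1)),
     scons (sym_of_bool b) (rev A +++ blanks), u +++ scons blank blanks)) _.
  apply: reachS (reach0 _ _ _); rewrite eT eu /= /tm_step ctrK // ec /= scons_blanks.
  rewrite sapp_rcons scons_blanks; rewrite (_ : (k - i.+1).+1 = k - i); last lia.
  by rewrite nsob.
apply: reach_trans (goend_reach _ _ _ cu _) _; first lia.
rewrite revK -/i (at_last_app _ [:: sym_of_bool b]) /=.
apply: reach_trans (shl_reach _ _ _ A0 cbu _) _; first lia.
apply: (reach_le (leq_addr _ _)) => /=.
have -> : (A ++ T') +++ blanks = A +++ (rcons u blank +++ scons blank blanks).
  by rewrite sapp_cat eu scons_blanks.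
(* At the blank before the register, [ShL] acts as [Ret] would: the carried symbol is now the popped
   bit and determines the next instruction. *)
apply: (@reach_same_step _ _ _ _ (at_last (if b then v1 else v0, Ret (ctr i)) A blanks
   (rcons u blank +++ scons blank blanks))).
- by apply/eqP => -[].
- rewrite -{2}(cats0 A) -at_last_app /at_last /= A0 tm_step_ret /tm_step !ctrK // eqxx /= ec -/i.
  by case: (b).
by apply: ret_reach => //; exact: ltnW.
Qed.

Definition regs_size (r : regs) : nat := \sum_(i < k) (size (r i)).+1.

Lemma size_tape_of r : size (tape_of r (iota 0 k)) = regs_size r.
Proof.
rewrite size_flatten /shape -map_comp sumnE big_map /regs_size -(big_mkord xpredT (fun i => (size (r i)).+1)).
by rewrite /index_iota subn0; apply: eq_bigr => i _; rewrite /= size_rcons size_map.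
Qed.

Lemma regs_size_upd r i w : i < k -> regs_size (upd r i w) + size (r i) = regs_size r + size w.
Proof.
move=> lik; rewrite /regs_size (bigD1 (Ordinal lik)) //= [in RHS](bigD1 (Ordinal lik)) //= /upd eqxx.
rewrite (eq_bigr (fun j : 'I_k => (size (r j)).+1)); first by lia.
by move=> j /eqP ne; case: eqP => // e; case: ne; apply: val_inj.
Qed.

Lemma regs_size_iexec v r : regs_size (iexec (code v) r).2 <= (regs_size r).+1.
Proof.
have := code_lt v; case: (code v) => [i b w|i vn v0 v1] /= lik.
  by have := regs_size_upd r (b :: r i) lik; rewrite /=; lia.
by case er: (r i) => [|b w] /=; [lia | have := regs_size_upd r w lik; rewrite er /=; lia].
Qed.

(** The registers grow by at most one cell per instruction, so [S + n] bounds the tape length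
    throughout. *)
Lemma fsteps_reach n c d S : fsteps n c d -> regs_size c.2 <= S ->
  treach (n * (4 * (S + n) + 8)) (home c.1 c.2) (home d.1 d.2).
Proof.
move=> st; elim: st S => {n c d} [c S _|n v r c st IH S leS]; first exact: reach0.
rewrite mulSn; apply: reach_trans.
  by apply: reach_le (step_reach v r); move: leS => /=; rewrite size_tape_of; lia.
apply: reach_le (IH S.+1 _); last exact: leq_trans (regs_size_iexec v r) _.
by rewrite leq_mul2l; lia.
Qed.

End Flat.

(** * Structured commands *)

Inductive cmd :=
| Skip
| Push of nat & bool
| Seq of cmd & cmd
| Case of nat & cmd & cmd & cmd
| While of nat & cmd & cmd.

(* [Case] and [While] pop a bit and branch on it; [While] stops when the register is empty. *)
Inductive run : cmd -> regs -> nat -> regs -> Prop :=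
| run_skip r : run Skip r 0 r
| run_push i b r : run (Push i b) r 1 (upd r i (b :: r i))
| run_seq c d r m s n t : run c r m s -> run d s n t -> run (Seq c d) r (m + n) t
| run_case_nil i cn c0 c1 r n s : r i = [::] -> run cn r n s -> run (Case i cn c0 c1) r n.+1 s
| run_case i cn c0 c1 r b w n s : r i = b :: w ->
    run (if b then c1 else c0) (upd r i w) n s -> run (Case i cn c0 c1) r n.+1 s
| run_while_nil i c0 c1 r : r i = [::] -> run (While i c0 c1) r 1 r
| run_while i c0 c1 r b w m s n t : r i = b :: w ->
    run (if b then c1 else c0) (upd r i w) m s -> run (While i c0 c1) s n t ->
    run (While i c0 c1) r (m + n).+1 t.

Record flat := Flat { fV : finType; fstart : option fV; fcode : fV -> instr (option fV) }.

(** [None] is the exit of a piece of code; [e] is where that exit leads once the code is embedded by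
    [g]. *)
Definition jump V W (g : V -> W) (e : option W) (o : option V) : option W :=
  if o is Some v then Some (g v) else e.

Fixpoint compile (c : cmd) : flat :=
  match c with
  | Skip => @Flat void None (fun v => match v with end)
  | Push i b => @Flat unit (Some tt) (fun=> IPush i b None)
  | Seq c d =>
    let f := compile c in let g := compile d in
    let j := jump inl (omap inr (fstart g)) in
    @Flat (fV f + fV g)%type (j (fstart f))
      (fun v => match v with inl v => imap j (fcode v) | inr v => imap (jump inr None) (fcode v) end)
  | Case i cn c0 c1 =>
    let fn := compile cn in let f0 := compile c0 in let f1 := compile c1 in
    let jn := jump (fun v => Some (inl v)) None in
    let j0 := jump (fun v => Some (inr (inl v))) None in
    let j1 := jump (fun v => Some (inr (inr v))) None in
    @Flat (option (fV fn + (fV f0 + fV f1)))%type (Some None)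
      (fun v => match v with
                | None => IPop i (jn (fstart fn)) (j0 (fstart f0)) (j1 (fstart f1))
                | Some (inl v) => imap jn (fcode v)
                | Some (inr (inl v)) => imap j0 (fcode v)
                | Some (inr (inr v)) => imap j1 (fcode v)
                end)
  | While i c0 c1 =>
    let f0 := compile c0 in let f1 := compile c1 in
    let j0 := jump (fun v => Some (inl v)) (Some None) in
    let j1 := jump (fun v => Some (inr v)) (Some None) in
    @Flat (option (fV f0 + fV f1))%type (Some None)
      (fun v => match v with
                | None => IPop i None (j0 (fstart f0)) (j1 (fstart f1))
                | Some (inl v) => imap j0 (fcode v)
                | Some (inr v) => imap j1 (fcode v)
                end)
  end.

Lemma iexec_imap V W (f : V -> W) x r :
  iexec (imap f x) r = (f (iexec x r).1, (iexec x r).2).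
Proof. by case: x => [i b v|i vn v0 v1] //=; case: (r i) => [|[] w]. Qed.

Lemma fsteps_jump (V W : finType) (cV : V -> instr (option V)) (cW : W -> instr (option W))
    (g : V -> W) (e : option W) n c d :
  (forall v, cW (g v) = imap (jump g e) (cV v)) -> fsteps cV n c d ->
  fsteps cW n (jump g e c.1, c.2) (jump g e d.1, d.2).
Proof.
move=> cE; elim=> [c'|m v r f _ IH]; first exact: fsteps0.
by apply: fstepsS; rewrite cE iexec_imap.
Qed.

Lemma compileP c r n s : run c r n s ->
  fsteps (@fcode (compile c)) n (fstart (compile c), r) (None, s).
Proof.
elim=> {c r n s}.
- by move=> r; apply: fsteps0.
- by move=> i b r; apply/fstepsS/fsteps0.
- move=> c d r m s n t _ IHc _ IHd /=; apply: fsteps_trans.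
    exact: (fsteps_jump _ IHc).
  exact: (@fsteps_jump _ _ _ _ inr None _ _ _ _ IHd).
- move=> i cn c0 c1 r n s ri _ IH; apply: fstepsS; rewrite /= ri /=.
  exact: (fsteps_jump _ IH).
- move=> i cn c0 c1 r b w n s ri _ IH; apply: fstepsS; rewrite /= ri /=.
  by case: b IH {ri} => IH; exact: (fsteps_jump _ IH).
- by move=> i c0 c1 r ri; apply: fstepsS; rewrite /= ri; apply: fsteps0.
move=> i c0 c1 r b w m s n t ri _ IH _ IHw; rewrite -addSn; apply: fsteps_trans IHw.
apply: fstepsS; rewrite /= ri /=.
by case: b IH {ri} => IH; exact: (fsteps_jump _ IH).
Qed.

Fixpoint nregs (c : cmd) : nat :=
  match c with
  | Skip => 1
  | Push i _ => i.+1
  | Seq c d => maxn (nregs c) (nregs d)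
  | Case i cn c0 c1 => maxn i.+1 (maxn (nregs cn) (maxn (nregs c0) (nregs c1)))
  | While i c0 c1 => maxn i.+1 (maxn (nregs c0) (nregs c1))
  end.

Lemma nregs_gt0 c : 0 < nregs c.
Proof. by elim: c => //= *; rewrite !leq_max; apply/orP; left. Qed.

Lemma ireg_imap V W (f : V -> W) x : ireg (imap f x) = ireg x.
Proof. by case: x. Qed.

Lemma compile_ireg c k (v : fV (compile c)) : nregs c <= k -> ireg (fcode v) < k.
Proof.
elim: c v => [|i b|c IHc d IHd|i cn IHn c0 IH0 c1 IH1|i c0 IH0 c1 IH1] //=.
- by case=> v; rewrite ireg_imap geq_max => /andP[? ?]; [apply: IHc | apply: IHd].
- case=> [[v|[v|v]]|]; rewrite ?ireg_imap !geq_max => /and4P[? ? ? ?] //.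
  + exact: IHn.
  + exact: IH0.
  exact: IH1.
case=> [[v|v]|]; rewrite ?ireg_imap !geq_max => /and3P[? ? ?] //.
  exact: IH0.
exact: IH1.
Qed.

Definition input_regs (w : seq bool) : regs := upd (fun=> [::]) 0 w.

Lemma tape_of_input k w : 0 < k ->
  tape_of (input_regs w) (iota 0 k) +++ blanks = map sym_of_bool w +++ blanks.
Proof.
case: k => // k _; rewrite /tape_of /= cat_rcons sapp_cat /=; congr (_ +++ _).
rewrite -[RHS]scons_blanks; congr scons; rewrite -[1]addn0 iotaDl -map_comp.
elim: (iota 0 k) => [//|i l IH] /=; rewrite IH; exact: scons_blanks.
Qed.

(** [K] depends only on the number of registers. The square comes from [n] instructions, each linear
    in a tape that holds [size w] bits at the start and gains at most one per instruction. *)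
Lemma cmd_TM (c : cmd) : exists (M : TM) (K : nat), forall w n r, run c (input_regs w) n r ->
  exists2 fin, exec (M := M) (K * (n + size w).+1 ^ 2) (init M w) = Some fin & output fin = r 0.
Proof.
pose k := nregs c; have k0 : 0 < k := nregs_gt0 c.
have ltk v := @compile_ireg c k v (leqnn _).
pose q0 := seek_of (@fcode (compile c)) k (fstart (compile c)).
exists (to_TM (tm_step (@fcode (compile c)) (k := k)) q0), (4 * k + 8) => w n r rc.
have := fsteps_reach ltk (compileP rc) (leqnn _) => /=.
set S := regs_size k _ => rch.
have eS : S = size w + k.
  have := regs_size_upd (fun=> [::]) w k0; rewrite /= -/(input_regs w) -/S addn0 => ->.
  by rewrite /regs_size sum1_card card_ord addnC.
pose B := (4 * k + 8) * (n + size w).+1 ^ 2.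
have leB : n * (4 * (S + n) + 8) <= B by rewrite /B eS; nia.
have init_sim := sim_init (tm_step (@fcode (compile c)) (k := k)) q0 w.
have {}rch := reach_le leB rch.
have halt : gstep (tm_step (@fcode (compile c)) (k := k)) (home (@fcode (compile c)) k None r) = None by [].
rewrite /home tape_of_input // in rch.
have [fin ex sm] := sim_reach rch halt init_sim.
exists fin => //; pose s := tape_of r (iota 1 k.-1) +++ blanks.
apply: (sim_output sm (s := s)) => /=.
by case: (k) k0 @s => // k' _ s; rewrite /tape_of /= cat_rcons sapp_cat.
Qed.

(** * Programs on binary trees *)

(* Trees are stored in a register in prefix notation. *)
Inductive tree := Leaf | Node of tree & tree.

Fixpoint tbits (t : tree) : seq bool :=
  if t is Node a b then true :: tbits a ++ tbits b else [:: false].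
Definition tsize (t : tree) := size (tbits t).

Lemma tsize_Node a b : tsize (Node a b) = (tsize a + tsize b).+1.
Proof. by rewrite /tsize /= size_cat. Qed.

Lemma tsize_gt0 t : 0 < tsize t.
Proof. by case: t => [|a b]; rewrite ?tsize_Node. Qed.

Inductive prog :=
| PId | PNil | PCar | PCdr
| PPair of prog & prog
| PComp of prog & prog
| PIf of prog & prog & prog
| PLoop of prog.

(* [PLoop p] on [Node l y] folds [p] over the list [l] with accumulator [y]. *)
Fixpoint tloop (f : tree -> tree) (l y : tree) : tree :=
  if l is Node h l' then tloop f l' (f (Node h y)) else y.

Fixpoint eval (p : prog) (x : tree) : tree :=
  match p with
  | PId => x
  | PNil => Leaf
  | PCar => if x is Node a _ then a else Leaf
  | PCdr => if x is Node _ b then b else Leaf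
  | PPair p q => Node (eval p x) (eval q x)
  | PComp p q => eval p (eval q x)
  | PIf p q r => if eval p x is Node _ _ then eval q x else eval r x
  | PLoop p => if x is Node l y then tloop (eval p) l y else Leaf
  end.

Fixpoint lcost (f : tree -> tree) (g : tree -> nat) (l y : tree) : nat :=
  if l is Node h l' then
    tsize (Node h y) + g (Node h y) + lcost f g l' (f (Node h y))
  else tsize y.

(** Besides the cost of the subprograms, the sizes of the values that the compiled code copies,
    clears or moves are charged. So the cost bounds the running time up to a constant as well as the
    size of the result. *)
Fixpoint pcost (p : prog) (x : tree) : nat :=
  tsize x +
  match p with
  | PId | PNil | PCar | PCdr => 0
  | PPair p q => pcost p x + pcost q x + (tsize (eval p x) + tsize (eval q x))
  | PComp p q => pcost q x + pcost p (eval q x)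
  | PIf p q r => pcost p x + if eval p x is Node _ _ then pcost q x + tsize (eval p x) else pcost r x
  | PLoop p => if x is Node l y then lcost (eval p) (pcost p) l y + tsize (tloop (eval p) l y) else 0
  end.

Lemma tsize_eval p x : tsize (eval p x) <= pcost p x.
Proof.
elim: p x => [||||p IHp q IHq|p IHp q IHq|p IHp q IHq r IHr|p IHp] x /=.
- exact: leq_addr.
- by rewrite addn0 tsize_gt0.
- by case: x => // a b; rewrite tsize_Node; lia.
- by case: x => // a b; rewrite tsize_Node; lia.
- by rewrite tsize_Node; have := tsize_gt0 x; lia.
- by have := IHp (eval q x); lia.
- by have := IHq x; have := IHr x; case: (eval p x) => [|a b]; lia.
by case: x => [|l y] //; rewrite tsize_Node; lia.
Qed.

Definition runs c r B s := exists2 n, n <= B & run c r n s.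

Lemma runs_le c r B B' s : B <= B' -> runs c r B s -> runs c r B' s.
Proof. by move=> le [n leB rc]; exists n => //; exact: leq_trans le. Qed.

Lemma runs_skip r B : runs Skip r B r.
Proof. by exists 0 => //; constructor. Qed.

Lemma runs_push i b r B : runs (Push i b) r B.+1 (upd r i (b :: r i)).
Proof. by exists 1 => //; constructor. Qed.

Lemma runs_seq c d r B s B' t : runs c r B s -> runs d s B' t -> runs (Seq c d) r (B + B') t.
Proof.
by move=> [m lem rc] [n len rd]; exists (m + n); [exact: leq_add | exact: run_seq rc rd].
Qed.

Lemma runs_case i cn c0 c1 r b w B s : r i = b :: w ->
  runs (if b then c1 else c0) (upd r i w) B s -> runs (Case i cn c0 c1) r B.+1 s.
Proof. by move=> ri [n len rc]; exists n.+1 => //; exact: run_case ri rc. Qed.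

Lemma runs_while_nil i c0 c1 r B : r i = [::] -> runs (While i c0 c1) r B.+1 r.
Proof. by move=> ri; exists 1 => //; exact: run_while_nil. Qed.

Lemma runs_while i c0 c1 r b w B s B' t : r i = b :: w ->
  runs (if b then c1 else c0) (upd r i w) B s -> runs (While i c0 c1) s B' t ->
  runs (While i c0 c1) r (B + B').+1 t.
Proof.
move=> ri [m lem rc] [n len rw]; exists (m + n).+1; first by rewrite ltnS leq_add.
exact: run_while ri rc rw.
Qed.

(** * Compilation of tree programs *)

Ltac regs_eq := apply: functional_extensionality => ?; rewrite /upd;
  repeat case: eqP => ?; subst; try lia;
  rewrite ?cats0 ?revK ?rev_cons ?cat_rcons ?rev_cat ?catA //=; try congruence.

Definition Mv i j := While i (Push j false) (Push j true).
Definition Clear i := While i Skip Skip.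
Definition Mv2 i j k := While i (Seq (Push j false) (Push k false)) (Seq (Push j true) (Push k true)).
(** A move reverses a register; the detour through [t] restores the order of both copies. *)
Definition Copy i j t := Seq (Mv i t) (Mv2 t i j).
(** Prefix notation carries no length: the unary counter [c] holds the number of subtrees still to
    be read, which a leaf lowers by one and a node raises by one. *)
Definition Parse i j c := Seq (Push c true)
  (While c Skip (Case i Skip (Push j false) (Seq (Push j true) (Seq (Push c true) (Push c true))))).

Lemma runs_Mv i j r : i != j ->
  runs (Mv i j) r (2 * size (r i) + 1) (upd (upd r j (rev (r i) ++ r j)) i [::]).
Proof.
move=> /eqP ij; move ew: (r i) => w; elim: w r ew => [|b w IH] r ew.
  by rewrite (_ : upd _ _ _ = r); [exact: runs_while_nil | regs_eq].
rewrite (_ : 2 * _ + 1 = (1 + (2 * size w + 1)).+1) /=; last lia.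
apply: runs_while ew _ _.
  by case: b => /=; apply: runs_push.
set s := upd _ j _; have -> : upd (upd r j (rev (b :: w) ++ r j)) i [::] = upd (upd s j (rev w ++ s j)) i [::].
  by rewrite /s; regs_eq.
by apply: IH; rewrite /s /upd; case: eqP => [//|_]; rewrite eqxx.
Qed.

Lemma runs_Clear i r : runs (Clear i) r (size (r i) + 1) (upd r i [::]).
Proof.
move ew: (r i) => w; elim: w r ew => [|b w IH] r ew.
  by rewrite (_ : upd _ _ _ = r); [exact: runs_while_nil | regs_eq].
rewrite (_ : _ + 1 = (0 + (size w + 1)).+1) /=; last lia.
apply: runs_while ew _ _; first by case: b; apply: runs_skip.
rewrite (_ : upd r i [::] = upd (upd r i w) i [::]); last by regs_eq.
by apply: IH; rewrite /upd eqxx.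
Qed.

Lemma runs_Mv2 i j k r : i != j -> i != k -> j != k ->
  runs (Mv2 i j k) r (3 * size (r i) + 1)
    (upd (upd (upd r j (rev (r i) ++ r j)) k (rev (r i) ++ r k)) i [::]).
Proof.
move=> /eqP ij /eqP ik /eqP jk; move ew: (r i) => w; elim: w r ew => [|b w IH] r ew.
  by rewrite (_ : upd _ _ _ = r); [exact: runs_while_nil | regs_eq].
rewrite (_ : 3 * _ + 1 = (1 + 1 + (3 * size w + 1)).+1) /=; last lia.
apply: runs_while ew _ _.
  by case: b => /=; apply: runs_seq; apply: runs_push.
set s := upd _ k _.
have -> : upd (upd (upd r j (rev (b :: w) ++ r j)) k (rev (b :: w) ++ r k)) i [::]
   = upd (upd (upd s j (rev w ++ s j)) k (rev w ++ s k)) i [::].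
  by rewrite /s; regs_eq.
by apply: IH; rewrite /s /upd; do 2! case: eqP => [//|_]; rewrite eqxx.
Qed.

Lemma runs_Copy i j t r : i != j -> i != t -> j != t -> r t = [::] -> r j = [::] ->
  runs (Copy i j t) r (5 * size (r i) + 2) (upd r j (r i)).
Proof.
move=> ij it jt rt rj.
rewrite (_ : 5 * _ + 2 = (2 * size (r i) + 1) + (3 * size (r i) + 1)); last lia.
apply: runs_seq (runs_Mv _ it) _; set s := upd _ i _.
have st : s t = rev (r i) by rewrite /s /upd eq_sym (negbTE it) eqxx rt cats0.
have := @runs_Mv2 t i j s; rewrite st size_rev revK eq_sym it eq_sym jt ij => /(_ isT isT isT).
set u := upd _ t _; rewrite (_ : u = upd r j (r i)) //.
move: ij it jt => /eqP ij /eqP it /eqP jt.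
rewrite /u /s /upd; apply: functional_extensionality => x.
by repeat case: eqP => ?; subst; rewrite ?rj ?rt ?cats0 //; congruence.
Qed.

(** The invariant needs a list of trees, as reading a node replaces one pending tree by its two
    children; the induction is on the number of bits left. *)
Lemma runs_Parse_loop i j c r ts w : i != j -> i != c -> j != c ->
  r i = flatten (map tbits ts) ++ w -> r c = nseq (size ts) true ->
  runs (While c Skip (Case i Skip (Push j false) (Seq (Push j true) (Seq (Push c true) (Push c true)))))
    r (5 * size (flatten (map tbits ts)) + 1)
    (upd (upd (upd r j (rev (flatten (map tbits ts)) ++ r j)) i w) c [::]).
Proof.
move=> /eqP ij /eqP ic /eqP jc; move en: (size (flatten (map tbits ts))) => n.
elim: n {-2}n (leqnn n) ts en r => [|m IH] n lenm [|t ts] /= en r ri rc.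
1,3: by rewrite (_ : upd _ _ _ = r); [rewrite addn1; exact: runs_while_nil | regs_eq].
  by move: en; rewrite size_cat; have := tsize_gt0 t; rewrite /tsize; lia.
case: t en ri => [|a b] /= en ri.
  rewrite -{}en (_ : 5 * _ + 1 = (2 + (5 * size (flatten (map tbits ts)) + 1 + 2)).+1) in lenm *; last lia.
  apply: runs_while rc _ _ => /=.
    by apply: runs_case => /=; [rewrite /upd; case: eqP => // _; exact: ri | apply: runs_push].
  set s := upd _ j _.
  have -> : upd (upd (upd r j (rev (false :: flatten (map tbits ts)) ++ r j)) i w) c [::] =
     upd (upd (upd s j (rev (flatten (map tbits ts)) ++ s j)) i w) c [::] by rewrite /s; regs_eq.
  apply: runs_le (IH _ _ ts erefl s _ _); first lia.
  - lia.
  - by rewrite /s /upd; case: eqP => // _; rewrite eqxx.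
  by rewrite /s /upd; do 2! (case: eqP => [?|_]); rewrite ?eqxx //; lia.
pose ts' := a :: b :: ts.
have ets : flatten (map tbits ts') = (tbits a ++ tbits b) ++ flatten (map tbits ts) by rewrite /= catA.
rewrite -ets in en ri *.
rewrite -{}en (_ : 5 * _ + 1 = ((1 + (1 + 1)).+1 + (5 * size (flatten (map tbits ts')) + 1)).+1) in lenm *; last by rewrite /=; lia.
apply: runs_while rc _ _ => /=.
  apply: runs_case => /=; first by rewrite /upd; case: eqP => // _; exact: ri.
  by apply: runs_seq (runs_push _ _ _ _) _; apply: runs_seq (runs_push _ _ _ _) _; apply: runs_push.
set s := upd _ c _.
have -> : upd (upd (upd r j (rev (true :: flatten (map tbits ts')) ++ r j)) i w) c [::] =
   upd (upd (upd s j (rev (flatten (map tbits ts')) ++ s j)) i w) c [::] by rewrite /s; regs_eq.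
apply: (IH _ _ ts' erefl).
- by move: lenm => /=; lia.
- by rewrite /s /upd; repeat case: eqP => ?; congruence.
by rewrite /s /upd; repeat (case: eqP => ?; try congruence).
Qed.

Lemma runs_Parse i j c r t w : i != j -> i != c -> j != c ->
  r i = tbits t ++ w -> r c = [::] ->
  runs (Parse i j c) r (5 * tsize t + 2) (upd (upd r j (rev (tbits t) ++ r j)) i w).
Proof.
move=> ij ic jc ri rc; rewrite (_ : 5 * _ + 2 = 1 + (5 * tsize t + 1)); last lia.
apply: runs_seq (runs_push _ _ _ _) _.
set s := upd r c _; have sc : s c = [:: true] by rewrite /s /upd eqxx rc.
have si : s i = tbits t ++ w by rewrite /s /upd (negbTE ic).
have := @runs_Parse_loop i j c s [:: t] w ij ic jc; rewrite /= cats0 => /(_ si sc).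
set u := upd _ c [::]; rewrite (_ : u = upd (upd r j (rev (tbits t) ++ r j)) i w) //.
move: ij ic jc => /eqP ij /eqP ic /eqP jc.
by rewrite /u /s; regs_eq.
Qed.

(** Calling convention: argument and result are in register [b], the registers above are empty
    before and after, those below are untouched, so [b] acts as a stack pointer. [Mv] and [Parse]
    reverse, hence their use in pairs. *)
Fixpoint compP (p : prog) (b : nat) : cmd :=
  match p with
  | PId => Skip
  | PNil => Seq (Clear b) (Push b false)
  | PCar => Case b Skip (Push b false)
      (Seq (Parse b b.+1 b.+2) (Seq (Clear b) (Mv b.+1 b)))
  | PCdr => Case b Skip (Push b false) (Seq (Parse b b.+1 b.+2) (Clear b.+1))
  | PPair p q =>
    Seq (Copy b b.+1 b.+2) (Seq (compP p b.+1) (Seq (Copy b b.+2 b.+3) (Seq (compP q b.+2)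
    (Seq (Clear b) (Seq (Mv b.+2 b.+3) (Seq (Mv b.+3 b) (Seq (Mv b.+1 b.+3)
    (Seq (Mv b.+3 b) (Push b true)))))))))
  | PComp p q => Seq (compP q b) (compP p b)
  | PIf p q r =>
    Seq (Copy b b.+1 b.+2) (Seq (compP p b.+1)
      (Case b.+1 Skip (compP r b) (Seq (Clear b.+1) (compP q b))))
  | PLoop p =>
    Case b Skip (Push b false)
    (Seq (Parse b b.+1 b.+2) (Seq (Mv b b.+2) (Seq (Mv b.+1 b) (Seq (Mv b.+2 b.+1)
    (Seq (While b Skip (Seq (Parse b b.+2 b.+3) (Seq (Mv b.+2 b.+1)
        (Seq (Push b.+1 true) (compP p b.+1)))))
    (Seq (Mv b.+1 b.+2) (Mv b.+2 b)))))))
  end.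

(* Registers [b, b+1, ...] hold [ws], the registers below [b] are those of [r]. *)
Definition fr (r : regs) (b : nat) (ws : seq (seq bool)) : regs :=
  fun j => if j < b then r j else nth [::] ws (j - b).

Lemma fr_nth r b ws i : fr r b ws (i + b) = nth [::] ws i.
Proof. by rewrite /fr ltnNge leq_addl addnK. Qed.

Lemma fr_eq r b ws ws' : (forall i, nth [::] ws i = nth [::] ws' i) -> fr r b ws = fr r b ws'.
Proof. by move=> e; apply: functional_extensionality => j; rewrite /fr e. Qed.

Lemma fr_upd r b ws i w : upd (fr r b ws) (i + b) w = fr r b (set_nth [::] ws i w).
Proof.
apply: functional_extensionality => j; rewrite /upd /fr nth_set_nth /=.
case: eqP => [->|ne]; first by rewrite ltnNge leq_addl addnK eqxx.
by case: ltnP => // bj; case: eqP => // e; case: ne; lia.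
Qed.

Lemma fr_cons r b w ws : fr r b (w :: ws) = fr (fr r b [:: w]) b.+1 ws.
Proof.
apply: functional_extensionality => j; rewrite /fr ltnS.
case: (ltngtP j b) => [||->]; rewrite ?subnn // => bj.
by rewrite -[j - b]prednK ?subn_gt0 // subnS.
Qed.

Lemma fr_Mv i j r b ws ws' n : i != j -> size (nth [::] ws i) <= n ->
  (forall l, nth [::] (set_nth [::] (set_nth [::] ws j (rev (nth [::] ws i) ++ nth [::] ws j)) i [::]) l
     = nth [::] ws' l) ->
  runs (Mv (i + b) (j + b)) (fr r b ws) (2 * n + 1) (fr r b ws').
Proof.
move=> ij len /fr_eq <-; apply: runs_le (_ : 2 * size (nth [::] ws i) + 1 <= _) _; first lia.
rewrite -!fr_upd -!(fr_nth r b ws).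
by apply: runs_Mv; rewrite eqn_add2r.
Qed.

Lemma fr_Clear i r b ws ws' n : size (nth [::] ws i) <= n ->
  (forall l, nth [::] (set_nth [::] ws i [::]) l = nth [::] ws' l) ->
  runs (Clear (i + b)) (fr r b ws) (n + 1) (fr r b ws').
Proof.
move=> len /fr_eq <-; apply: runs_le (_ : size (nth [::] ws i) + 1 <= _) _; first lia.
by rewrite -!fr_upd -!(fr_nth r b ws); apply: runs_Clear.
Qed.

Lemma fr_push i x r b ws ws' :
  (forall l, nth [::] (set_nth [::] ws i (x :: nth [::] ws i)) l = nth [::] ws' l) ->
  runs (Push (i + b) x) (fr r b ws) 1 (fr r b ws').
Proof. by move=> /fr_eq <-; rewrite -!fr_upd -!(fr_nth r b ws); apply: runs_push. Qed.

Lemma fr_Copy i j t r b ws ws' : i != j -> i != t -> j != t ->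
  nth [::] ws t = [::] -> nth [::] ws j = [::] ->
  (forall l, nth [::] (set_nth [::] ws j (nth [::] ws i)) l = nth [::] ws' l) ->
  runs (Copy (i + b) (j + b) (t + b)) (fr r b ws) (5 * size (nth [::] ws i) + 2) (fr r b ws').
Proof.
move=> ij it jt wt wj /fr_eq <-; rewrite -!fr_upd -!(fr_nth r b ws).
by apply: runs_Copy; rewrite ?eqn_add2r // fr_nth.
Qed.

Lemma fr_Parse i j c r b ws ws' t w : i != j -> i != c -> j != c ->
  nth [::] ws i = tbits t ++ w -> nth [::] ws c = [::] ->
  (forall l, nth [::] (set_nth [::] (set_nth [::] ws j (rev (tbits t) ++ nth [::] ws j)) i w) l = nth [::] ws' l) ->
  runs (Parse (i + b) (j + b) (c + b)) (fr r b ws) (5 * tsize t + 2) (fr r b ws').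
Proof.
move=> ij ic jc wt wc /fr_eq <-; rewrite -!fr_upd -!(fr_nth r b ws).
by apply: runs_Parse; rewrite ?eqn_add2r // fr_nth.
Qed.

Lemma fr_case i cn c0 c1 r b ws x w ws' B s : nth [::] ws i = x :: w ->
  (forall l, nth [::] (set_nth [::] ws i w) l = nth [::] ws' l) ->
  runs (if x then c1 else c0) (fr r b ws') B s ->
  runs (Case (i + b) cn c0 c1) (fr r b ws) B.+1 s.
Proof.
move=> wi /fr_eq <-; rewrite -fr_upd => rc.
by apply: runs_case rc; rewrite fr_nth.
Qed.

Ltac nths := try by [rewrite /= ?size_rev | do 6? [case=> //=]; rewrite ?cats0 ?revK].

(** The factor 50 is a crude common constant: each construct handles every value charged in [pcost]
    a bounded number of times. *)
Lemma compP_runs p r b x :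
  runs (compP p b) (fr r b [:: tbits x]) (50 * pcost p x) (fr r b [:: tbits (eval p x)]).
Proof.
elim: p r b x => [||||p IHp q IHq|p IHp q IHq|p IHp q IHq r' IHr|p IHp] r b x /=; have x0 := tsize_gt0 x.
- exact: runs_skip.
- apply: runs_le (_ : tsize x + 1 + 1 <= _) _; first lia.
  by apply: runs_seq (@fr_Clear 0 r b _ [::] _ _ _) (@fr_push 0 false r b _ _ _); nths.
- case: x x0 => [|a c] x0.
    apply: (@runs_le _ _ 2); first lia.
    by apply: (@fr_case 0 _ _ _ r b _ _ _ [::]); nths; apply: (@fr_push 0); nths.
  apply: (@runs_le _ _ (5 * tsize a + 2 + (tsize c + 1 + (2 * tsize a + 1))).+1).
    by rewrite tsize_Node; lia.
  apply: (@fr_case 0 _ _ _ r b _ _ _ [:: tbits a ++ tbits c]); nths.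
  apply: runs_seq (@fr_Parse 0 1 2 r b _ [:: tbits c; rev (tbits a)] a _ _ _ _ _ _ _) _; nths.
  apply: runs_seq (@fr_Clear 0 r b _ [:: [::]; rev (tbits a)] _ _ _) _; nths.
  by apply: (@fr_Mv 1 0); nths.
- case: x x0 => [|a c] x0.
    apply: (@runs_le _ _ 2); first lia.
    by apply: (@fr_case 0 _ _ _ r b _ _ _ [::]); nths; apply: (@fr_push 0); nths.
  apply: (@runs_le _ _ (5 * tsize a + 2 + (tsize a + 1)).+1).
    by rewrite tsize_Node; lia.
  apply: (@fr_case 0 _ _ _ r b _ _ _ [:: tbits a ++ tbits c]); nths.
  apply: runs_seq (@fr_Parse 0 1 2 r b _ [:: tbits c; rev (tbits a)] a _ _ _ _ _ _ _) _; nths.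
  by apply: (@fr_Clear 1); nths.
- set u := tbits (eval p x); set v := tbits (eval q x).
  apply: (@runs_le _ _ (5 * tsize x + 2 + (50 * pcost p x + (5 * tsize x + 2 + (50 * pcost q x +
    (tsize x + 1 + (2 * size v + 1 + (2 * size v + 1 + (2 * size u + 1 + (2 * size u + 1 + 1)))))))))).
    by rewrite /tsize -/u -/v in x0 *; lia.
  apply: runs_seq (@fr_Copy 0 1 2 r b _ [:: tbits x; tbits x] _ _ _ _ _ _) _; nths.
  apply: runs_seq; first by rewrite fr_cons; apply: IHp.
  rewrite -fr_cons -/u.
  apply: runs_seq (@fr_Copy 0 2 3 r b _ [:: tbits x; u; tbits x] _ _ _ _ _ _) _; nths.
  apply: runs_seq; first by rewrite fr_cons fr_cons; apply: IHq.
  rewrite -!fr_cons -/v.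
  apply: runs_seq (@fr_Clear 0 r b _ [:: [::]; u; v] _ _ _) _; nths.
  apply: runs_seq (@fr_Mv 2 3 r b _ [:: [::]; u; [::]; rev v] _ _ _ _) _; nths.
  apply: runs_seq (@fr_Mv 3 0 r b _ [:: v; u] _ _ _ _) _; nths.
  apply: runs_seq (@fr_Mv 1 3 r b _ [:: v; [::]; [::]; rev u] _ _ _ _) _; nths.
  apply: runs_seq (@fr_Mv 3 0 r b _ [:: u ++ v] _ _ _ _) _; nths.
  by apply: (@fr_push 0); nths.
- by apply: runs_le (runs_seq (IHq _ _ _) (IHp _ _ _)); lia.
- apply: (@runs_le _ _ (5 * tsize x + 2 + (50 * pcost p x +
      if eval p x is Node _ _ then (tsize (eval p x) + 1 + 50 * pcost q x).+1 else (50 * pcost r' x).+1))).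
    by case: (eval p x) => *; lia.
  apply: runs_seq (@fr_Copy 0 1 2 r b _ [:: tbits x; tbits x] _ _ _ _ _ _) _; nths.
  apply: runs_seq; first by rewrite fr_cons; apply: IHp.
  rewrite -fr_cons; case: (eval p x) => [|a c].
    by apply: (@fr_case 1 _ _ _ r b _ _ _ [:: tbits x]); nths.
  apply: (@fr_case 1 _ _ _ r b _ _ _ [:: tbits x; tbits a ++ tbits c]); nths.
  apply: runs_seq (IHq _ _ _).
  by apply: (@fr_Clear 1); nths; rewrite /= tsize_Node size_cat /tsize; lia.
case: x x0 => [|l y] x0.
  apply: (@runs_le _ _ 2); first lia.
  by apply: (@fr_case 0 _ _ _ r b _ _ _ [::]); nths; apply: (@fr_push 0); nths.
(* Register [b] holds the rest of the list; [b.+1] holds the accumulator and is the frame of the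
   body. *)
have loop l' y' : runs (While b Skip (Seq (Parse b b.+2 b.+3) (Seq (Mv b.+2 b.+1)
        (Seq (Push b.+1 true) (compP p b.+1))))) (fr r b [:: tbits l'; tbits y'])
     (50 * lcost (eval p) (pcost p) l' y' + 2) (fr r b [:: [::]; tbits (tloop (eval p) l' y')]).
  elim: l' y' => [|h _ l' IH] y' /=.
    apply: (@runs_le _ _ (0 + 1).+1); first lia.
    apply: (@runs_while _ _ _ _ false [::]); first exact: (@fr_nth r b _ 0).
      exact: runs_skip.
    rewrite (_ : upd _ _ _ = fr r b [:: [::]; tbits y']); last exact: (@fr_upd r b _ 0).
    by apply: runs_while_nil; exact: (@fr_nth r b _ 0).
  apply: (@runs_le _ _ ((5 * tsize h + 2 + (2 * tsize h + 1 + (1 + 50 * pcost p (Node h y')))) +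
      (50 * lcost (eval p) (pcost p) l' (eval p (Node h y')) + 2)).+1).
    by rewrite tsize_Node; lia.
  apply: (@runs_while _ _ _ _ true (tbits h ++ tbits l')) (IH _); first exact: (@fr_nth r b _ 0).
  rewrite (_ : upd _ _ _ = fr r b [:: tbits h ++ tbits l'; tbits y']); last exact: (@fr_upd r b _ 0).
  apply: runs_seq (@fr_Parse 0 2 3 r b _ [:: tbits l'; tbits y'; rev (tbits h)] h _ _ _ _ _ _ _) _; nths.
  apply: runs_seq (@fr_Mv 2 1 r b _ [:: tbits l'; tbits h ++ tbits y'] _ _ _ _) _; nths.
  apply: runs_seq (@fr_push 1 true r b _ [:: tbits l'; tbits (Node h y')] _) _; nths.
  by rewrite fr_cons [X in runs _ _ _ X]fr_cons; apply: IHp.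
set t := tloop _ _ _.
apply: (@runs_le _ _ (5 * tsize l + 2 + (2 * tsize y + 1 + (2 * tsize l + 1 + (2 * tsize y + 1 +
   ((50 * lcost (eval p) (pcost p) l y + 2) + (2 * tsize t + 1 + (2 * tsize t + 1))))))).+1).
  by rewrite tsize_Node; lia.
apply: (@fr_case 0 _ _ _ r b _ _ _ [:: tbits l ++ tbits y]); nths.
apply: runs_seq (@fr_Parse 0 1 2 r b _ [:: tbits y; rev (tbits l)] l _ _ _ _ _ _ _) _; nths.
apply: runs_seq (@fr_Mv 0 2 r b _ [:: [::]; rev (tbits l); rev (tbits y)] _ _ _ _) _; nths.
apply: runs_seq (@fr_Mv 1 0 r b _ [:: tbits l; [::]; rev (tbits y)] _ _ _ _) _; nths.
apply: runs_seq (@fr_Mv 2 1 r b _ [:: tbits l; tbits y] _ _ _ _) _; nths.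
apply: runs_seq (loop _ _) _.
apply: runs_seq (@fr_Mv 1 2 r b _ [:: [::]; [::]; rev (tbits t)] _ _ _ _) _; nths.
by apply: (@fr_Mv 2 0); nths.
Qed.

(** * Polynomial-time functions *)

Structure encType := EncType { enc_sort :> Type; enc : enc_sort -> tree }.
Arguments enc {e} x : simpl never.
Canonical bool_encType := @EncType bool (fun b => if b then Node Leaf Leaf else Leaf).
Canonical prod_encType (A B : encType) :=
  @EncType (A * B)%type (fun x => Node (enc x.1) (enc x.2)).
Canonical seq_encType (A : encType) :=
  @EncType (seq A) (foldr (fun x t => Node (enc x) t) Leaf).
(** Encoding a number by its binary digits makes [n] and [bin n] the same tree, so converting
    between them costs nothing. *)
Canonical nat_encType := @EncType nat (fun n => enc (bin n)).

Definition sz (A : encType) (x : A) := tsize (enc x).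

Lemma sz_pair (A B : encType) (x : A) (y : B) : sz (x, y) = (sz x + sz y).+1.
Proof. exact: tsize_Node. Qed.
Lemma sz_nil (A : encType) : sz (Nil A) = 1. Proof. by []. Qed.
Lemma sz_cons (A : encType) (x : A) s : sz (x :: s) = (sz x + sz s).+1.
Proof. exact: tsize_Node. Qed.
Lemma sz_gt0 (A : encType) (x : A) : 0 < sz x.
Proof. exact: tsize_gt0. Qed.
Lemma sz_bool (b : bool) : sz b <= 3. Proof. by case: b. Qed.
Lemma sz_cat (A : encType) (s t : seq A) : (sz (s ++ t)).+1 = sz s + sz t.
Proof.
elim: s => [|x s IH] /=; first by rewrite sz_nil add1n.
by move: IH; rewrite !sz_cons; lia.
Qed.
Lemma size_le_sz (A : encType) (s : seq A) : size s < sz s.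
Proof. by elim: s => [|x s IH] //=; rewrite sz_cons; lia. Qed.

Lemma leq_exp2rW m n k : m <= n -> m ^ k <= n ^ k.
Proof. by move=> le; elim: k => [//|k IH]; rewrite !expnS leq_mul. Qed.

(** The base is at least 2, so constants are dominated by a power of it and the class is closed
    under sums. *)
Definition polyb (A : encType) (g : A -> nat) := exists c, forall x, g x <= (sz x).+2 ^ c.

Section Polyb.
Context {A : encType}.
Implicit Types f g : A -> nat.

Lemma polyb_le f g : polyb g -> (forall x, f x <= g x) -> polyb f.
Proof. by move=> [c gc] fg; exists c => x; exact: leq_trans (gc x). Qed.

Lemma polyb_const k : polyb (fun _ : A => k).
Proof. by exists k => x; apply: leq_trans (ltnW (ltn_expl k (ltnSn 1))) _; apply: leq_exp2rW. Qed.

Lemma polyb_sz : polyb (fun x : A => sz x).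
Proof. by exists 1 => x; rewrite expn1; lia. Qed.

Lemma polyb_mul f g : polyb f -> polyb g -> polyb (fun x => f x * g x).
Proof. by move=> [a fa] [b gb]; exists (a + b) => x; rewrite expnD leq_mul. Qed.

Lemma polyb_add f g : polyb f -> polyb g -> polyb (fun x => f x + g x).
Proof.
move=> [a fa] [b gb]; exists (a + b).+1 => x; rewrite expnS.
have [pa pb] : 0 < (sz x).+2 ^ a /\ 0 < (sz x).+2 ^ b by rewrite !expn_gt0.
by move: (fa x) (gb x); rewrite expnD; nia.
Qed.

Lemma polyb_exp f k : polyb f -> polyb (fun x => f x ^ k).
Proof.
move=> pf; elim: k => [|k IH]; first exact: polyb_const.
by apply: polyb_le (polyb_mul pf IH) _ => x; rewrite expnS.
Qed.

Lemma polyb_S f : polyb f -> polyb (fun x => (f x).+1).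
Proof. by move=> pf; apply: polyb_le (polyb_add pf (polyb_const 1)) _ => x; rewrite addn1. Qed.

End Polyb.

Lemma polyb_comp (A B : encType) (g : B -> nat) (f : A -> B) :
  polyb g -> polyb (fun x => sz (f x)) -> polyb (fun x => g (f x)).
Proof.
move=> [c gc] pf; apply: polyb_le (polyb_exp c (polyb_S (polyb_S pf))) _ => x.
exact: gc.
Qed.

(* A polynomial cost also bounds the size of the result polynomially, see [PT_sz]; this is what makes [PT] compose. *)
Definition PT (A B : encType) (f : A -> B) :=
  exists2 p, (forall x, eval p (enc x) = enc (f x)) & polyb (fun x : A => pcost p (enc x)).

Lemma PT_sz (A B : encType) (f : A -> B) : PT f -> polyb (fun x => sz (f x)).
Proof. by case=> p pf pc; apply: polyb_le pc _ => x; rewrite /sz -pf tsize_eval. Qed.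

Lemma PT_ext (A B : encType) (f g : A -> B) : PT f -> (forall x, f x = g x) -> PT g.
Proof. by case=> p pf pc fg; exists p => // x; rewrite -fg. Qed.

(* Same program, different types with the same encoding. *)
Lemma PT_recode (A B C : encType) (f : A -> B) (g : A -> C) :
  PT f -> (forall x, enc (f x) = enc (g x)) -> PT g.
Proof. by case=> p pf pc fg; exists p => // x; rewrite -fg. Qed.

Lemma PT_comp (A B C : encType) (g : B -> C) (f : A -> B) :
  PT g -> PT f -> PT (fun x => g (f x)).
Proof.
move=> [q qg qc] PTf; have pf := PT_sz PTf; case: PTf pf => p pf pc psz.
exists (PComp q p) => [x|]; first by rewrite /= pf qg.
apply: polyb_le (polyb_add polyb_sz (polyb_add pc (polyb_comp qc psz))) _ => x.
by rewrite /= pf.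
Qed.

Lemma Node_enc (A B : encType) (x : A) (y : B) : Node (enc x) (enc y) = enc (x, y).
Proof. by []. Qed.

Section Basic.
Context {A : encType}.

Lemma PT_id : PT (fun x : A => x).
Proof. by exists PId => //; apply: polyb_le polyb_sz _ => x; rewrite /= addn0. Qed.

Lemma PT_tree {T : encType} (c : T) : PT (fun _ : A => c).
Proof.
have [p [pc [k pk]]] : exists p, (forall x : A, eval p (enc x) = enc c) /\ polyb (fun x : A => pcost p (enc x)); last first.
  by exists p => //; exists k.
elim: (enc c) => [|a [p [pa pc]] b [q [qb qc]]].
  by exists PNil; split => //; apply: polyb_le polyb_sz _ => x; rewrite /= addn0.
exists (PPair p q); split=> [x|]; first by rewrite /= pa qb.
apply: polyb_le (polyb_add polyb_sz (polyb_add (polyb_add pc qc) (polyb_const (tsize a + tsize b)))) _ => x.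
by rewrite /= pa qb.
Qed.

Context {B C : encType}.

Lemma PT_pair (f : A -> B) (g : A -> C) : PT f -> PT g -> PT (fun x => (f x, g x)).
Proof.
move=> PTf PTg; have [sf sg] := (PT_sz PTf, PT_sz PTg).
case: PTf PTg sf sg => p pf pc [q qg qc] sf sg.
exists (PPair p q) => [x|]; first by rewrite /= pf qg.
apply: polyb_le (polyb_add polyb_sz (polyb_add (polyb_add pc qc) (polyb_add sf sg))) _ => x.
by rewrite /= pf qg.
Qed.

Lemma PT_fst (f : A -> B * C) : PT f -> PT (fun x => (f x).1).
Proof.
apply: PT_comp; exists PCar => //.
by apply: polyb_le polyb_sz _ => x; rewrite /= addn0.
Qed.

Lemma PT_snd (f : A -> B * C) : PT f -> PT (fun x => (f x).2).
Proof.
apply: PT_comp; exists PCdr => //.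
by apply: polyb_le polyb_sz _ => x; rewrite /= addn0.
Qed.

Lemma PT_if (b : A -> bool) (f g : A -> B) : PT b -> PT f -> PT g ->
  PT (fun x => if b x then f x else g x).
Proof.
move=> PTb; have sb := PT_sz PTb; case: PTb sb => r rb rc sb [p pf pc] [q qg qc].
exists (PIf r p q) => [x|]; first by rewrite /= rb; case: (b x); rewrite /= ?pf ?qg.
apply: polyb_le (polyb_add polyb_sz (polyb_add (polyb_add pc qc) (polyb_add rc sb))) _ => x.
by rewrite /= rb /sz; case: (b x) => /=; lia.
Qed.

Lemma PT_cons (f : A -> B) (g : A -> seq B) : PT f -> PT g -> PT (fun x => f x :: g x).
Proof.
move=> PTf PTg; have [sf sg] := (PT_sz PTf, PT_sz PTg).
case: PTf PTg sf sg => p pf pc [q qg qc] sf sg.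
exists (PPair p q) => [x|]; first by rewrite /= pf qg.
apply: polyb_le (polyb_add polyb_sz (polyb_add (polyb_add pc qc) (polyb_add sf sg))) _ => x.
by rewrite /= pf qg.
Qed.

Lemma PT_case (l : A -> seq B) (f : A -> C) (g : A * (B * seq B) -> C) : PT l -> PT f -> PT g ->
  PT (fun x => if l x is h :: t then g (x, (h, t)) else f x).
Proof.
move=> PTl; have sl := PT_sz PTl; case: PTl sl => r rl rc sl [p pf pc] [q qg [k qc]].
exists (PIf r (PComp q (PPair PId r)) p) => [x|].
  rewrite /= rl; case: (l x) => [|h t]; first exact: pf.
  by rewrite -[enc (h :: t)]/(Node (enc h) (enc t)); exact: (qg (x, (h, t))).
have pS : polyb (fun x : A => sz x + sz (l x) + 3) by apply: polyb_add (polyb_add polyb_sz sl) (polyb_const 3).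
apply: polyb_le (polyb_add (polyb_add polyb_sz (polyb_add rc sl)) (polyb_add pc (polyb_add (polyb_add
   (polyb_mul (polyb_const 5) (polyb_add polyb_sz sl)) rc) (polyb_exp k pS)))) _ => x.
rewrite /= rl /sz; case el: (l x) => [|h t] /=; first by lia.
have {}qc : pcost q (Node (enc x) (enc (h :: t))) <= (tsize (enc x) + tsize (enc (h :: t)) + 3) ^ k.
  by have := qc (x, (h, t)); rewrite sz_pair addn3; apply.
by lia.
Qed.

End Basic.

(* Syntax-directed search for [PT] goals, extended below through [pt_hook]. *)
Ltac pt_hook := fail.
Ltac pt_step :=
  match goal with
  | H : PT _ |- PT _ => exact H
  | |- PT (fun _ => ?c) => exact (PT_tree c)
  | |- PT (fun e => e) => exact PT_id
  | |- PT (fun e => (@?a e, @?b e)) => refine (PT_pair (f := a) (g := b) _ _)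
  | |- PT (fun e => (@?a e).1) => refine (PT_fst (f := a) _)
  | |- PT (fun e => (@?a e).2) => refine (PT_snd (f := a) _)
  | |- PT (fun e => @?a e :: @?b e) => refine (PT_cons (f := a) (g := b) _ _)
  | |- PT (fun e => if _ then _ else _) => refine (PT_if _ _ _)
  | _ => pt_hook
  end.
Ltac pt := repeat (cbv beta; pt_step; cbv beta).

Lemma enc_foldl (A T : encType) p (F : T * A -> A) (s : seq T) (y : A) :
  (forall x, eval p (enc x) = enc (F x)) ->
  tloop (eval p) (enc s) (enc y) = enc (foldl (fun a x => F (x, a)) y s).
Proof.
move=> pF; elim: s y => [|x s IH] y //=.
by rewrite Node_enc pF IH.
Qed.

Lemma lcost_le (A T : encType) p (F : T * A -> A) (s : seq T) (y : A) X :
  (forall x, eval p (enc x) = enc (F x)) ->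
  (forall s1 s2, s = s1 ++ s2 ->
    let a := foldl (fun a x => F (x, a)) y s1 in
    sz a <= X /\ forall x t, s2 = x :: t -> sz (x, a) + pcost p (enc (x, a)) <= X) ->
  lcost (eval p) (pcost p) (enc s) (enc y) <= (size s).+1 * X.
Proof.
move=> pF; elim: s y => [|x s IH] y H /=.
  by have [/= le _] := H [::] [::] erefl; rewrite mul1n.
have [_ /(_ x s erefl) le] := H [::] (x :: s) erefl.
rewrite mulSn Node_enc pF leq_add // IH // => s1 s2 es.
exact: (H (x :: s1) s2 (congr1 (cons x) es)).
Qed.

Lemma sz_mem (A : encType) (s1 s2 : seq A) x : sz x <= sz (s1 ++ x :: s2).
Proof. by elim: s1 => [|y s1 IH] /=; rewrite sz_cons; lia. Qed.

(** A polynomial body could still square the size of the accumulator in every round; the bound [g]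
    on all intermediate accumulators excludes this. *)
Lemma PT_foldl (E A T : encType)
    (G : E -> A -> T -> A) (a : E -> A) (l : E -> seq T) (g : E -> nat) :
  PT (fun p : E * (A * T) => G p.1 p.2.1 p.2.2) -> PT a -> PT l -> polyb g ->
  (forall e s1 s2, l e = s1 ++ s2 -> sz (foldl (G e) (a e) s1) <= g e) ->
  PT (fun e => foldl (G e) (a e) (l e)).
Proof.
move=> PG Pa Pl pg bound.
(* A loop body sees only the list element and the accumulator, so the parameter [e] travels in the
   accumulator. *)
pose F (x : T * (E * A)) : E * A := (x.2.1, G x.2.1 x.2.2 x.1).
have PF : PT F.
  rewrite /F; pt; refine (PT_comp PG (f := fun x : T * (E * A) => (x.2.1, (x.2.2, x.1))) _); pt.
have FE e s y : foldl (fun a x => F (x, a)) (e, y) s = (e, foldl (G e) y s).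
  by elim: s y => //= x s IH y; exact: IH.
case: PF => p pF [k pk].
have PL : PT (fun e => foldl (fun a x => F (x, a)) (e, a e) (l e)); last first.
  apply: PT_ext (PT_snd PL) _ => e; by rewrite FE.
have Py : PT (fun e => (l e, (e, a e))) by pt.
have sl := PT_sz Pl; have sy := PT_sz Py.
case: Py sy => q qe qc sy.
exists (PComp (PLoop p) q) => [e|]; first by rewrite /= qe; exact: (enc_foldl (l e) (e, a e) pF).
pose X (e : E) := (sz (l e) + sz e + g e + 2) + (sz (l e) + sz e + g e + 4) ^ k.
have pX : polyb X.
  by repeat first [exact sl | exact pg | refine (polyb_sz) | refine (polyb_const _) | refine (polyb_add _ _) | refine (polyb_exp _ _)].
apply: polyb_le (polyb_add (polyb_add polyb_sz qc) (polyb_add sy (polyb_add (polyb_mul sl pX) (polyb_add polyb_sz (polyb_S pg))))) _ => e.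
rewrite /= qe /= (enc_foldl _ _ pF) -[tsize (enc (foldl _ _ _))]/(sz _) FE sz_pair.
have le1 := bound e (l e) [::] (esym (cats0 _)).
have le2 : lcost (eval p) (pcost p) (enc (l e)) (enc (e, a e)) <= sz (l e) * X e.
  apply: leq_trans (lcost_le (X := X e) pF _) _; last by rewrite leq_mul2r size_le_sz orbT.
  move=> s1 s2 es /=; rewrite FE; have le := bound _ _ _ es.
  split; first by rewrite sz_pair /X; lia.
  move=> x t es2; have lx : sz x <= sz (l e) by rewrite es es2 sz_mem.
  apply: leq_add; first by rewrite !sz_pair; lia.
  by apply: leq_trans (pk _) _; apply: leq_exp2rW; rewrite !sz_pair; lia.
by rewrite -!addnA -addnS !leq_add.
Qed.

Section Lists.
Context {E T : encType}.

Lemma PT_foldl_bool (G : E -> bool -> T -> bool) (a : E -> bool) (l : E -> seq T) :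
  PT (fun p : E * (bool * T) => G p.1 p.2.1 p.2.2) -> PT a -> PT l ->
  PT (fun e => foldl (G e) (a e) (l e)).
Proof.
move=> PG Pa Pl; apply: (PT_foldl PG Pa Pl (g := fun=> 3)); first exact: polyb_const.
by move=> *; exact: sz_bool.
Qed.

Lemma sz_rev (s : seq T) : sz (rev s) = sz s.
Proof.
elim: s => [//|x s IH]; rewrite rev_cons -cats1; apply: succn_inj.
by rewrite sz_cat IH !sz_cons sz_nil; lia.
Qed.

Lemma PT_rev (l : E -> seq T) : PT l -> PT (fun e => rev (l e)).
Proof.
move=> Pl; pose G (_ : E) (a : seq T) (x : T) := x :: a.
have GE e a s : foldl (G e) a s = rev s ++ a.
  by elim: s a => //= x s IH a; rewrite IH rev_cons cat_rcons.
apply: (PT_ext (f := fun e => foldl (G e) [::] (l e))) => [|e]; last by rewrite GE cats0.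
apply: (PT_foldl (g := fun e => sz (l e))) => //; first by rewrite /G; pt.
- by pt.
- exact: PT_sz.
by move=> e s1 s2 ->; rewrite GE cats0 sz_rev; have := sz_cat s1 s2; have := sz_gt0 s2; lia.
Qed.

Lemma PT_cat (l1 l2 : E -> seq T) : PT l1 -> PT l2 -> PT (fun e => l1 e ++ l2 e).
Proof.
move=> P1 P2; pose G (_ : E) (a : seq T) (x : T) := x :: a.
have GE e a s : foldl (G e) a s = rev s ++ a.
  by elim: s a => //= x s IH a; rewrite IH rev_cons cat_rcons.
apply: (PT_ext (f := fun e => foldl (G e) (l2 e) (rev (l1 e)))) => [|e]; last by rewrite GE revK.
apply: (PT_foldl (g := fun e => sz (l1 e) + sz (l2 e))) => //; first by rewrite /G; pt.
- exact: PT_rev.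
- by apply: polyb_add; exact: PT_sz.
move=> e s1 s2 /(congr1 (fun s => sz (rev s))); rewrite revK rev_cat GE => ->.
by have := sz_cat (rev s2) (rev s1); have := sz_cat (rev s1) (l2 e); have := sz_gt0 (rev s2); lia.
Qed.

End Lists.

Section Lists2.
Context {E A T : encType}.

Lemma sz_prefix (s1 s2 s : seq T) : s = s1 ++ s2 -> sz s1 <= sz s.
Proof. by move=> ->; have := sz_cat s1 s2; have := sz_gt0 s2; lia. Qed.

Lemma sz_map_le (f : T -> A) (s : seq T) X :
  (forall s1 x s2, s = s1 ++ x :: s2 -> sz (f x) <= X) -> sz (map f s) <= (size s * X.+1).+1.
Proof.
elim: s => [//|x s IH] H /=; rewrite sz_cons mulSn.
have := H [::] x s erefl; have : sz (map f s) <= (size s * X.+1).+1; last by lia.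
by apply: IH => s1 y s2 es; apply: (H (x :: s1) y s2); rewrite es.
Qed.

Lemma PT_map (g : E -> T -> A) (l : E -> seq T) :
  PT (fun p : E * T => g p.1 p.2) -> PT l -> PT (fun e => map (g e) (l e)).
Proof.
move=> Pg Pl; pose G (e : E) (a : seq A) (x : T) := g e x :: a.
have GE e a s : foldl (G e) a s = rev (map (g e) s) ++ a.
  by elim: s a => //= x s IH a; rewrite IH rev_cons cat_rcons.
have [k kc] := PT_sz Pg.
have pX : polyb (fun e : E => (sz (l e) * ((sz e + sz (l e)).+3 ^ k).+1).+1).
  have Sl := PT_sz Pl; apply/polyb_S/polyb_mul => //; apply/polyb_S/polyb_exp.
  by apply/polyb_S/polyb_S/polyb_S/polyb_add => //; exact: polyb_sz.
have PG : PT (fun e => foldl (G e) [::] (l e)); last first.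
  by apply: PT_ext (PT_rev PG) _ => e; rewrite GE cats0 revK.
apply: (PT_foldl (g := fun e => (sz (l e) * ((sz e + sz (l e)).+3 ^ k).+1).+1)) => //; last first.
- move=> e s1 s2 es; rewrite GE cats0; set m := map _ _.
  rewrite sz_rev.
  apply: leq_trans (sz_map_le (X := (sz e + sz (l e)).+3 ^ k) _) _.
    move=> u x v eu; apply: leq_trans (kc (e, x)) _; apply: leq_exp2rW.
    by rewrite sz_pair es eu -catA cat_cons; have := sz_mem u (v ++ s2) x; lia.
  rewrite ltnS leq_mul2r; have := size_le_sz (l e); rewrite es size_cat => ?.
  by apply/orP; right; lia.
- by pt.
rewrite /G; pt; refine (PT_comp Pg (f := fun p : E * (seq A * T) => (p.1, p.2.2)) _); pt.
Qed.

Lemma PT_filter (P : E -> T -> bool) (l : E -> seq T) :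
  PT (fun p : E * T => P p.1 p.2) -> PT l -> PT (fun e => filter (P e) (l e)).
Proof.
move=> PP Pl; pose G (e : E) (a : seq T) (x : T) := if P e x then x :: a else a.
have GE e a s : foldl (G e) a s = rev (filter (P e) s) ++ a.
  by elim: s a => //= x s IH a; rewrite IH /G; case: (P e x); rewrite // rev_cons cat_rcons.
have PG : PT (fun e => foldl (G e) [::] (l e)); last first.
  by apply: PT_ext (PT_rev PG) _ => e; rewrite GE cats0 revK.
apply: (PT_foldl (g := fun e => sz (l e))) => //.
- rewrite /G; pt; refine (PT_comp PP (f := fun p : E * (seq T * T) => (p.1, p.2.2)) _); pt.
- by pt.
- exact: PT_sz.
move=> e s1 s2 /sz_prefix; apply: leq_trans; rewrite GE cats0 sz_rev.
by elim: s1 => //= x s IH; case: (P e x); rewrite !sz_cons; lia.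
Qed.

End Lists2.

Ltac pt_list :=
  match goal with
  | |- PT (fun e => @?a e ++ @?b e) => refine (PT_cat (l1 := a) (l2 := b) _ _)
  | |- PT (fun e => rev (@?a e)) => refine (PT_rev (l := a) _)
  | |- PT (fun e => map _ _) => refine (PT_map _ _)
  | |- PT (fun e => filter _ _) => refine (PT_filter _ _)
  end.
Ltac pt_hook ::= pt_list.

Lemma PT_negb {E : encType} (b : E -> bool) : PT b -> PT (fun e => ~~ b e).
Proof. by move=> Pb; apply: (PT_ext (f := fun e => if b e then false else true)); pt. Qed.

Lemma PT_andb {E : encType} (b c : E -> bool) : PT b -> PT c -> PT (fun e => b e && c e).
Proof. by move=> Pb Pc; apply: (PT_ext (f := fun e => if b e then c e else false)) => //; pt. Qed.

Lemma PT_orb {E : encType} (b c : E -> bool) : PT b -> PT c -> PT (fun e => b e || c e).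
Proof. by move=> Pb Pc; apply: (PT_ext (f := fun e => if b e then true else c e)) => //; pt. Qed.

Lemma PT_addb {E : encType} (b c : E -> bool) : PT b -> PT c -> PT (fun e => b e (+) c e).
Proof.
move=> Pb Pc; apply: (PT_ext (f := fun e => if b e then ~~ c e else c e)) => //.
  by pt; exact: PT_negb.
by move=> e; case: (b e).
Qed.

Lemma PT_all {E T : encType} (P : E -> T -> bool) (l : E -> seq T) :
  PT (fun p : E * T => P p.1 p.2) -> PT l -> PT (fun e => all (P e) (l e)).
Proof.
move=> PP Pl; apply: (PT_ext (f := fun e => foldl (fun b x => b && P e x) true (l e))) => [|e].
  apply: PT_foldl_bool => //; last by pt.
  by apply: PT_andb; [pt | refine (PT_comp PP (f := fun p : E * (bool * T) => (p.1, p.2.2)) _); pt].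
rewrite -[RHS]andTb; move: true; elim: (l e) => [|x s IH] b /=; first by rewrite andbT.
by rewrite IH andbA.
Qed.

Lemma PT_has {E T : encType} (P : E -> T -> bool) (l : E -> seq T) :
  PT (fun p : E * T => P p.1 p.2) -> PT l -> PT (fun e => has (P e) (l e)).
Proof.
move=> PP Pl; apply: (PT_ext (f := fun e => ~~ all (fun x => ~~ P e x) (l e))) => [|e].
  by apply/PT_negb/PT_all => //; apply: PT_negb.
by rewrite -has_predC; apply: eq_has => x /=; rewrite negbK.
Qed.

Lemma PT_behead {E T : encType} (l : E -> seq T) : PT l -> PT (fun e => behead (l e)).
Proof.
move=> Pl; apply: (PT_ext (f := fun e => if l e is h :: t then t else [::])).
  by apply: (PT_case (g := fun p : E * (T * seq T) => p.2.2)) => //; pt.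
by move=> e; case: (l e).
Qed.

Lemma PT_nilp {E T : encType} (l : E -> seq T) : PT l -> PT (fun e => nilp (l e)).
Proof.
move=> Pl; apply: (PT_ext (f := fun e => if l e is h :: t then false else true)).
  by apply: (PT_case (g := fun p : E * (T * seq T) => false)) => //; pt.
by move=> e; case: (l e).
Qed.

(* Binary numerals, least significant bit first. *)
Definition bval (s : seq bool) : nat := foldr (fun (b : bool) v => b + v.*2) 0 s.

Definition trim (s : seq bool) : seq bool :=
  foldr (fun b a => if b || ~~ nilp a then b :: a else a) [::] s.

Lemma bval_bin n : bval (bin n) = n.
Proof.
suff H f : forall m, m <= f -> bval (bin_aux f m) = m by exact: H.
elim: f => [|f IH] [|m] //= le; rewrite IH; last by rewrite uphalfE -(odd_double_half m.+1) in le *; lia.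
by rewrite -[RHS](odd_double_half m.+1).
Qed.

Lemma bin_aux_fuel f n : n <= f -> bin_aux f n = bin n.
Proof.
suff H g : forall f m, m <= f -> m <= g -> bin_aux f m = bin_aux g m by move=> le; exact: H.
elim: g => [|g IH] [|{}f] [|m] //= le1 le2; congr (_ :: _).
by have := odd_double_half m.+1; rewrite /= => ?; apply: IH; lia.
Qed.

(** [bin] yields no zeros in the highest positions, and removing these is what [trim] does. *)
Lemma bin_bval s : bin (bval s) = trim s.
Proof.
elim: s => [//|b s IH] /=; rewrite -IH.
have binE n : bin n = if n == 0 then [::] else odd n :: bin n./2.
  case: n => // n; rewrite [in LHS]/bin /=; congr (_ :: _); apply: bin_aux_fuel.
  by have := odd_double_half n.+1; lia.
rewrite binE oddD odd_double addbF halfD odd_double andbF add0n doubleK.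
have -> : b./2 = 0 by case: (b). 
rewrite add0n addn_eq0 double_eq0; case: b => //=.
by case: (bval s) => // n; rewrite binE.
Qed.

Lemma size_bin_ltn n k : (size (bin n) <= k) = (n < 2 ^ k).
Proof.
have up m : m < 2 ^ size (bin m).
  by rewrite -{1}(bval_bin m); elim: (bin m) => [//|b s IH] /=; rewrite expnS; case: b => /=; lia.
have lo m : 0 < m -> 2 ^ (size (bin m)).-1 <= m.
  elim/ltn_ind: m => m IH m0; case: (posnP m./2) => [h0|h0].
    have -> : m = 1 by have := odd_double_half m; rewrite h0; lia.
    by [].
  have em : m = odd m + m./2.*2 by rewrite odd_double_half.
  have -> : bin m = odd m :: bin m./2.
    case: m m0 {IH h0 em} => // m _; rewrite /bin /=; congr (_ :: _); apply: bin_aux_fuel.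
    by have := odd_double_half m.+1; lia.
  have lt : m./2 < m by lia.
  have := IH _ lt h0; have : 0 < size (bin m./2) by case: (m./2) h0.
  rewrite /=; case: (size (bin m./2)) => //= j _; rewrite expnS; lia.
apply/idP/idP => [le|lt]; first exact: leq_trans (up n) (leq_pexp2l _ le).
case: (posnP n) => [->//|n0]; have := leq_ltn_trans (lo n n0) lt.
by rewrite ltn_exp2l //; case: (size (bin n)).
Qed.

Lemma sz_nat_le n k : n < 2 ^ k -> sz n <= (4 * k).+1.
Proof.
rewrite -size_bin_ltn /sz -[enc n]/(enc (bin n)) => le.
suff : tsize (enc (bin n)) <= (4 * size (bin n)).+1 by lia.
elim: (bin n) {le} => [//|b s IH] /=; rewrite -[tsize _]/(sz (b :: s)) sz_cons.
by have := sz_bool b; move: IH; rewrite /sz; lia.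
Qed.

Lemma ltn_exp_sz (n : nat) : n < 2 ^ sz n.
Proof.
rewrite -size_bin_ltn; rewrite /sz -[enc n]/(enc (bin n)) -/(sz (bin n)).
exact/ltnW/size_le_sz.
Qed.

Lemma sumn_lt_sz (s : seq nat) : sumn s < 2 ^ sz s.
Proof.
elim: s => [//|n s IH] /=; rewrite sz_cons expnS expnD.
by have := ltn_exp_sz n; move: IH; nia.
Qed.

Lemma prod_lt_sz (s : seq nat) : foldr muln 1 s < 2 ^ sz s.
Proof.
elim: s => [//|n s IH] /=; rewrite sz_cons expnS expnD.
by have := ltn_exp_sz n; move: IH; nia.
Qed.

Lemma PT_bin {E : encType} (a : E -> nat) : PT a -> PT (fun e => bin (a e)).
Proof. by move=> Pa; apply: (PT_recode Pa). Qed.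

Lemma PT_foldr {E A T : encType} (G : E -> T -> A -> A) (a : E -> A) (l : E -> seq T) (g : E -> nat) :
  PT (fun p : E * (T * A) => G p.1 p.2.1 p.2.2) -> PT a -> PT l -> polyb g ->
  (forall e s1 s2, l e = s1 ++ s2 -> sz (foldr (G e) (a e) s2) <= g e) ->
  PT (fun e => foldr (G e) (a e) (l e)).
Proof.
move=> PG Pa Pl pg bound.
apply: (PT_ext (f := fun e => foldl (fun y x => G e x y) (a e) (rev (l e)))) => [|e].
  apply: (PT_foldl (g := g)) => //; last 2 first.
  - by pt.
  - move=> e s1 s2 es; rewrite -[s1]revK foldl_rev; apply: (bound e (rev s2)).
    by rewrite -rev_cat -es revK.
  refine (PT_comp PG (f := fun p : E * (A * T) => (p.1, (p.2.2, p.2.1))) _); pt.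
by rewrite foldl_rev.
Qed.

(** As trees [bval s] and [trim s] coincide, so evaluating a digit list amounts to trimming it. *)
Lemma PT_bval {E : encType} (s : E -> seq bool) : PT s -> PT (fun e => bval (s e)).
Proof.
move=> Ps; suff PT1 : PT (fun e => trim (s e)).
  by apply: (PT_recode PT1) => e; rewrite -bin_bval.
apply: (PT_foldr (g := fun e => sz (s e))) => //.
- by pt; refine (PT_orb _ _); [pt | apply: PT_negb; refine (PT_nilp _); pt].
- by pt.
- exact: PT_sz.
move=> e s1 s2 ->; have : sz s2 <= sz (s1 ++ s2).
  by have := sz_cat s1 s2; have := sz_gt0 s1; lia.
apply: leq_trans; elim: s2 => //= b t IH; rewrite sz_cons.
by case: ifP => _; rewrite ?sz_cons; lia.
Qed.

Lemma sz_bits (s : seq bool) : sz s <= (4 * size s).+1.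
Proof. by elim: s => [//|b s IH] /=; rewrite sz_cons; have := sz_bool b; lia. Qed.

Lemma sz_nats_le (s : seq nat) k : (forall x, x \in s -> x < 2 ^ k) -> sz s <= (size s * (4 * k).+2).+1.
Proof.
elim: s => [//|x s IH] H /=; rewrite sz_cons mulSn.
have := sz_nat_le (H x (mem_head _ _)).
have : sz s <= (size s * (4 * k).+2).+1 by apply: IH => y ys; apply: H; rewrite inE ys orbT.
lia.
Qed.

Lemma zip_foldl T U (l1 : seq T) (l2 : seq U) acc :
  foldl (fun st x => if st.1 is y :: r then (r, (x, y) :: st.2) else st) (l2, acc) l1
  = (drop (size l1) l2, rev (zip l1 l2) ++ acc).
Proof.
elim: l1 l2 acc => [|x l1 IH] [|y l2] acc //=; last by rewrite IH rev_cons cat_rcons.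
by rewrite IH; case: (l1).
Qed.

Lemma sz_zip {T U : encType} (l1 : seq T) (l2 : seq U) : sz (zip l1 l2) <= sz l1 + sz l2.
Proof.
elim: l1 l2 => [|x l1 IH] [|y l2] /=.
1-3: by apply: (@leq_trans 1); rewrite // addn_gt0 sz_gt0.
by have := IH l2; rewrite !sz_cons sz_pair; lia.
Qed.

Lemma PT_zip {E T U : encType} (l1 : E -> seq T) (l2 : E -> seq U) : PT l1 -> PT l2 ->
  PT (fun e => zip (l1 e) (l2 e)).
Proof.
move=> P1 P2.
pose G (_ : E) (st : seq U * seq (T * U)) (x : T) := if st.1 is y :: r then (r, (x, y) :: st.2) else st.
have PF : PT (fun e => foldl (G e) (l2 e, [::]) (l1 e)).
  apply: (PT_foldl (g := fun e => (sz (l2 e) + (sz (l1 e) + sz (l2 e))).+1)) => //.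
  - rewrite /G; apply: (PT_case (g := fun p : (E * ((seq U * seq (T * U)) * T)) * (U * seq U) =>
      (p.2.2, (p.1.2.2, p.2.1) :: p.1.2.1.2))); pt.
  - by pt.
  - have S1 := PT_sz P1; have S2 := PT_sz P2.
    exact: (polyb_S (polyb_add S2 (polyb_add S1 S2))).
  move=> e s1 s2 es; rewrite /G zip_foldl cats0 sz_pair sz_rev ltnS.
  apply: leq_add.
    by rewrite -{2}(cat_take_drop (size s1) (l2 e)); have := sz_cat (take (size s1) (l2 e)) (drop (size s1) (l2 e));
       have := sz_gt0 (take (size s1) (l2 e)); lia.
  by apply: leq_trans (sz_zip _ _) _; rewrite leq_add2r es; exact: sz_prefix erefl.
apply: (PT_ext (f := fun e => rev (foldl (G e) (l2 e, [::]) (l1 e)).2)); first by pt.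
by move=> e; rewrite /G zip_foldl cats0 revK.
Qed.

Ltac pt_bool :=
  match goal with
  | |- PT (fun e => zip (@?a e) (@?b e)) => refine (PT_zip (l1 := a) (l2 := b) _ _)
  | |- PT (fun e => ~~ @?a e) => refine (PT_negb (b := a) _)
  | |- PT (fun e => @?a e && @?b e) => refine (PT_andb (b := a) (c := b) _ _)
  | |- PT (fun e => @?a e || @?b e) => refine (PT_orb (b := a) (c := b) _ _)
  | |- PT (fun e => @?a e (+) @?b e) => refine (PT_addb (b := a) (c := b) _ _)
  | |- PT (fun e => all _ _) => refine (PT_all _ _)
  | |- PT (fun e => has _ _) => refine (PT_has _ _)
  | |- PT (fun e => behead (@?a e)) => refine (PT_behead (l := a) _)
  | |- PT (fun e => nilp (@?a e)) => refine (PT_nilp (l := a) _)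
  | |- PT (fun e => bval (@?a e)) => refine (PT_bval (s := a) _)
  | |- PT (fun e => bin (@?a e)) => refine (PT_bin (a := a) _)
  end.
Ltac pt_hook ::= first [pt_list | pt_bool].

(** * Binary arithmetic *)

Definition add_step (st : bool * seq bool) (p : bool * bool) : bool * seq bool :=
  ((p.1 && p.2) || (st.1 && (p.1 || p.2)), ((p.1 (+) p.2) (+) st.1) :: st.2).
Definition sub_step (st : bool * seq bool) (p : bool * bool) : bool * seq bool :=
  ((~~ p.1 && (p.2 || st.1)) || (p.2 && st.1), ((p.1 (+) p.2) (+) st.1) :: st.2).
(** Padding both lists to the sum of the lengths keeps [zip] from losing digits. *)
Definition pad2 (s t : seq bool) : seq (bool * bool) :=
  zip (s ++ [seq false | _ <- t]) (t ++ [seq false | _ <- s]).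
Definition bits_add (s t : seq bool) := foldl add_step (false, [::]) (pad2 s t).
Definition bits_sub (s t : seq bool) := foldl sub_step (false, [::]) (pad2 s t).

Lemma bval_cat s t : bval (s ++ t) = bval s + 2 ^ size s * bval t.
Proof. by elim: s => [|b s IH] /=; rewrite ?mul1n // IH expnS; lia. Qed.

Lemma bval_rev_cons b s : bval (rev (b :: s)) = bval (rev s) + 2 ^ size s * b.
Proof. by rewrite rev_cons -cats1 bval_cat size_rev /= addn0. Qed.

Lemma bval_lt s : bval s < 2 ^ size s.
Proof. by elim: s => [//|b s IH] /=; rewrite expnS; case: b => /=; lia. Qed.

Lemma add_stepP l c acc : let r := foldl add_step (c, acc) l in
  bval (rev (r.1 :: r.2)) = bval (rev acc) + 2 ^ size acc * (c + bval (unzip1 l) + bval (unzip2 l)).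
Proof.
elim: l c acc => [|[x y] l IH] c acc; first by rewrite /= bval_rev_cons !addn0.
rewrite /= IH bval_rev_cons /= expnS.
by case: c x y => [] [] [] /=; lia.
Qed.

(** Operands, digits and borrows are balanced on two sides to avoid truncated subtraction; the final
    borrow weighs [2 ^ size r.2]. *)
Lemma sub_stepP l c acc : let r := foldl sub_step (c, acc) l in
  bval (rev r.2) + 2 ^ size acc * (c + bval (unzip2 l)) =
  bval (rev acc) + 2 ^ size acc * bval (unzip1 l) + 2 ^ size r.2 * r.1.
Proof.
elim: l c acc => [|[x y] l IH] c acc; first by rewrite /= !addn0 muln0 addn0.
have := IH (sub_step (c, acc) (x, y)).1 (sub_step (c, acc) (x, y)).2.
rewrite [foldl _ _ (_ :: _)]/= -surjective_pairing; move: (foldl _ _ l) => r.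
rewrite [(sub_step _ _).2]/= bval_rev_cons [size (_ :: acc)]/= expnS.
by case: c x y => [] [] [] /=; lia.
Qed.

Lemma bval_pad2 s t : bval (unzip1 (pad2 s t)) = bval s /\ bval (unzip2 (pad2 s t)) = bval t.
Proof.
have z U (u : seq U) : bval [seq false | _ <- u] = 0 by elim: u => //= _ u ->.
have e : size (s ++ [seq false | _ <- t]) = size (t ++ [seq false | _ <- s]).
  by rewrite !size_cat !size_map addnC.
by rewrite /pad2 unzip1_zip ?e // unzip2_zip ?e // !bval_cat !z !muln0 !addn0.
Qed.

Lemma bits_addP s t : bval (rev ((bits_add s t).1 :: (bits_add s t).2)) = bval s + bval t.
Proof.
by have := add_stepP (pad2 s t) false [::]; have [-> ->] := bval_pad2 s t; rewrite /= mul1n => ->.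
Qed.

(** The digits represent a number below the weight of the final borrow, so this borrow is set
    exactly when [t] exceeds [s]. *)
Lemma bits_subP s t :
  (bval t <= bval s) = ~~ (bits_sub s t).1 /\
  bval s - bval t = if (bits_sub s t).1 then 0 else bval (rev (bits_sub s t).2).
Proof.
have := sub_stepP (pad2 s t) false [::]; have [-> ->] := bval_pad2 s t.
rewrite /= !mul1n -/(bits_sub s t) => e; have := bval_lt (rev (bits_sub s t).2); rewrite size_rev.
by case: (bits_sub s t).1 e => /=; lia.
Qed.

Lemma size_add_step st l : size (foldl add_step st l).2 = size l + size st.2.
Proof. by elim: l st => //= p l IH st; rewrite IH /=; lia. Qed.

Lemma size_sub_step st l : size (foldl sub_step st l).2 = size l + size st.2.
Proof. by elim: l st => //= p l IH st; rewrite IH /=; lia. Qed.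

Lemma bits_bound (l l' : seq (bool * bool)) : 3 + (4 * size l).+1 < 4 * sz (l ++ l') + 5.
Proof.
have : size l < sz (l ++ l') by apply: leq_trans (size_le_sz l) (sz_prefix erefl).
lia.
Qed.

Lemma PT_bits_add {E : encType} (s t : E -> seq bool) : PT s -> PT t -> PT (fun e => bits_add (s e) (t e)).
Proof.
move=> Ps Pt; have Pp : PT (fun e => pad2 (s e) (t e)) by rewrite /pad2; pt.
apply: (PT_foldl (G := fun _ => add_step) (g := fun e => 4 * sz (pad2 (s e) (t e)) + 5)) => //.
- by rewrite /add_step; pt.
- by pt.
- exact: (polyb_add (polyb_mul (polyb_const 4) (PT_sz Pp)) (polyb_const 5)).
move=> e s1 s2 es; rewrite [foldl _ _ _]surjective_pairing sz_pair.
apply: leq_ltn_trans (leq_add (sz_bool _) (sz_bits _)) _; rewrite size_add_step /= addn0 es.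
exact: bits_bound.
Qed.

Lemma PT_bits_sub {E : encType} (s t : E -> seq bool) : PT s -> PT t -> PT (fun e => bits_sub (s e) (t e)).
Proof.
move=> Ps Pt; have Pp : PT (fun e => pad2 (s e) (t e)) by rewrite /pad2; pt.
apply: (PT_foldl (G := fun _ => sub_step) (g := fun e => 4 * sz (pad2 (s e) (t e)) + 5)) => //.
- by rewrite /sub_step; pt.
- by pt.
- exact: (polyb_add (polyb_mul (polyb_const 4) (PT_sz Pp)) (polyb_const 5)).
move=> e s1 s2 es; rewrite [foldl _ _ _]surjective_pairing sz_pair.
apply: leq_ltn_trans (leq_add (sz_bool _) (sz_bits _)) _; rewrite size_sub_step /= addn0 es.
exact: bits_bound.
Qed.

Lemma PT_add {E : encType} (a b : E -> nat) : PT a -> PT b -> PT (fun e => a e + b e).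
Proof.
move=> Pa Pb; pose r e := bits_add (bin (a e)) (bin (b e)).
have Pr : PT r by apply: PT_bits_add; pt.
apply: (PT_ext (f := fun e => bval (rev ((r e).1 :: (r e).2)))); first by pt.
by move=> e; rewrite bits_addP !bval_bin.
Qed.

Lemma PT_sub {E : encType} (a b : E -> nat) : PT a -> PT b -> PT (fun e => a e - b e).
Proof.
move=> Pa Pb; pose r e := bits_sub (bin (a e)) (bin (b e)).
have Pr : PT r by apply: PT_bits_sub; pt.
apply: (PT_ext (f := fun e => if (r e).1 then 0 else bval (rev (r e).2))); first by pt.
by move=> e; have [_ <-] := bits_subP (bin (a e)) (bin (b e)); rewrite !bval_bin.
Qed.

Lemma PT_leq {E : encType} (a b : E -> nat) : PT a -> PT b -> PT (fun e => a e <= b e).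
Proof.
move=> Pa Pb; pose r e := bits_sub (bin (b e)) (bin (a e)).
have Pr : PT r by apply: PT_bits_sub; pt.
apply: (PT_ext (f := fun e => ~~ (r e).1)); first by pt.
by move=> e; have [<- _] := bits_subP (bin (b e)) (bin (a e)); rewrite !bval_bin.
Qed.

Lemma PT_succ {E : encType} (a : E -> nat) : PT a -> PT (fun e => (a e).+1).
Proof. by move=> Pa; apply: (PT_ext (f := fun e => a e + 1)) => [|e]; [apply: PT_add; pt | rewrite addn1]. Qed.

Lemma PT_eqn {E : encType} (a b : E -> nat) : PT a -> PT b -> PT (fun e => a e == b e).
Proof.
move=> Pa Pb; apply: (PT_ext (f := fun e => (a e <= b e) && (b e <= a e))) => [|e].
  by pt; apply: PT_leq.
by rewrite -eqn_leq.
Qed.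

Lemma PT_minn {E : encType} (a b : E -> nat) : PT a -> PT b -> PT (fun e => minn (a e) (b e)).
Proof.
by move=> Pa Pb; rewrite /minn; pt; apply: PT_leq => //; exact: PT_succ.
Qed.

(** Horner's rule, starting from the most significant digit. *)
Lemma mul_foldl y s acc :
  foldl (fun acc (b : bool) => acc + acc + (if b then y else 0)) acc s = acc * 2 ^ size s + bval (rev s) * y.
Proof.
elim: s acc => [|b s IH] acc /=; first by rewrite muln1 addn0.
rewrite IH bval_rev_cons expnS; case: b; nia.
Qed.

Lemma PT_mul {E : encType} (a b : E -> nat) : PT a -> PT b -> PT (fun e => a e * b e).
Proof.
move=> Pa Pb.
pose G (e : E) acc (c : bool) := acc + acc + (if c then b e else 0).
apply: (PT_ext (f := fun e => foldl (G e) 0 (rev (bin (a e))))) => [|e]; last first.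
  by rewrite /G mul_foldl revK bval_bin.
apply: (PT_foldl (g := fun e => (4 * (sz (a e) + sz (b e))).+1)).
- rewrite /G; apply: PT_add; first by apply: PT_add; pt.
  by pt; refine (PT_comp Pb (f := fun p : E * (nat * bool) => p.1) _); pt.
- by pt.
- by pt.
- exact: (polyb_S (polyb_mul (polyb_const 4) (polyb_add (PT_sz Pa) (PT_sz Pb)))).
move=> e s1 s2 es; apply: sz_nat_le; rewrite /G mul_foldl mul0n expnD.
have : bval (rev s1) <= a e.
  rewrite -{1}(bval_bin (a e)) -[bin _]revK es rev_cat bval_cat.
  by apply: leq_trans (leq_addl _ _); rewrite leq_pmull // expn_gt0.
by rewrite add0n => le; apply: leq_ltn_trans (leq_mul le (leqnn _)) _; apply: ltn_mul; exact: ltn_exp_sz.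
Qed.

Ltac pt_arith :=
  match goal with
  | |- PT (fun e => @?a e + @?b e) => refine (PT_add (a := a) (b := b) _ _)
  | |- PT (fun e => @?a e - @?b e) => refine (PT_sub (a := a) (b := b) _ _)
  | |- PT (fun e => @?a e * @?b e) => refine (PT_mul (a := a) (b := b) _ _)
  | |- PT (fun e => (@?a e).+1 <= @?b e) => refine (PT_leq (a := fun e => (a e).+1) (b := b) _ _)
  | |- PT (fun e => @?a e <= @?b e) => refine (PT_leq (a := a) (b := b) _ _)
  | |- PT (fun e => (@?a e).+1) => refine (PT_succ (a := a) _)
  | |- PT (fun e => (@?a e : nat) == @?b e) => refine (PT_eqn (a := a) (b := b) _ _)
  | |- PT (fun e => minn (@?a e) (@?b e)) => refine (PT_minn (a := a) (b := b) _ _)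
  end.
Ltac pt_hook ::= first [pt_list | pt_bool | pt_arith].

Lemma PT_size {E T : encType} (l : E -> seq T) : PT l -> PT (fun e => size (l e)).
Proof.
move=> Pl; have FE n (s : seq T) : foldl (fun n _ => n.+1) n s = n + size s.
  by elim: s n => [|x s IH] n /=; rewrite ?addn0 // IH addnS.
apply: (PT_ext (f := fun e => foldl (fun n _ => n.+1) 0 (l e))) => [|e]; last exact: FE.
apply: (PT_foldl (G := fun _ n _ => n.+1) (g := fun e => (4 * sz (l e)).+1)); [pt|pt|pt| |].
  exact: (polyb_S (polyb_mul (polyb_const 4) (PT_sz Pl))).
move=> e s1 s2 es; apply: sz_nat_le; rewrite FE add0n es.
exact: ltn_trans (leq_trans (size_le_sz s1) (sz_prefix erefl)) (ltn_expl _ _).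
Qed.

Lemma PT_count {E T : encType} (P : E -> T -> bool) (l : E -> seq T) :
  PT (fun p : E * T => P p.1 p.2) -> PT l -> PT (fun e => count (P e) (l e)).
Proof.
move=> PP Pl; apply: (PT_ext (f := fun e => size (filter (P e) (l e)))) => [|e]; last exact: size_filter.
by apply: PT_size; pt.
Qed.

Lemma PT_sumn {E : encType} (l : E -> seq nat) : PT l -> PT (fun e => sumn (l e)).
Proof.
move=> Pl; apply: (PT_foldr (G := fun _ => addn) (g := fun e => (4 * sz (l e)).+1)); [pt|pt|pt| |].
  exact: (polyb_S (polyb_mul (polyb_const 4) (PT_sz Pl))).
move=> e s1 s2 es; apply: sz_nat_le; apply: leq_trans (sumn_lt_sz _) _.
by rewrite leq_exp2l // es; have := sz_cat s1 s2; have := sz_gt0 s1; lia.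
Qed.

Lemma PT_prod {E : encType} (l : E -> seq nat) : PT l -> PT (fun e => foldr muln 1 (l e)).
Proof.
move=> Pl; apply: (PT_foldr (G := fun _ => muln) (g := fun e => (4 * sz (l e)).+1)); [pt|pt|pt| |].
  exact: (polyb_S (polyb_mul (polyb_const 4) (PT_sz Pl))).
move=> e s1 s2 es; apply: sz_nat_le; apply: leq_trans (prod_lt_sz _) _.
by rewrite leq_exp2l // es; have := sz_cat s1 s2; have := sz_gt0 s1; lia.
Qed.

(** Numbers are given in binary, so counting up to one may take exponential time; ranges are
    therefore always taken from the length of a list. *)
Definition indices T (s : seq T) := iota 0 (size s).

Lemma PT_indices {E T : encType} (l : E -> seq T) : PT l -> PT (fun e => indices (l e)).
Proof.
move=> Pl.
pose G (_ : E) (st : nat * seq nat) (_ : T) := (st.1.+1, st.1 :: st.2).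
have FE e n acc (s : seq T) : foldl (G e) (n, acc) s = (n + size s, rev (iota n (size s)) ++ acc).
  by elim: s n acc => [|x s IH] n acc /=; rewrite ?addn0 // IH addSnnS rev_cons cat_rcons.
apply: (PT_ext (f := fun e => rev (foldl (G e) (0, [::]) (l e)).2)) => [|e]; last by rewrite FE cats0 revK.
suff PF : PT (fun e => foldl (G e) (0, [::]) (l e)) by pt.
apply: (PT_foldl (g := fun e => ((4 * sz (l e)).+1 + (sz (l e) * (4 * sz (l e)).+2).+1).+1)); [rewrite /G; pt|pt|pt| |].
  have Sl := PT_sz Pl; have S4 := polyb_S (polyb_mul (polyb_const 4) Sl).
  exact: (polyb_S (polyb_add S4 (polyb_S (polyb_mul Sl (polyb_S S4))))).
move=> e s1 s2 es; rewrite FE cats0 sz_pair sz_rev add0n.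
have lt : size s1 < sz (l e) by rewrite es; exact: leq_trans (size_le_sz s1) (sz_prefix erefl).
rewrite ltnS leq_add //.
  by apply: sz_nat_le; exact: ltn_trans lt (ltn_expl _ _).
apply: leq_trans (sz_nats_le (k := sz (l e)) _) _.
  move=> x; rewrite mem_iota add0n => /andP[_ xs].
  exact: ltn_trans (ltn_trans xs lt) (ltn_expl _ _).
by rewrite size_iota ltnS leq_mul2r (ltnW lt) orbT.
Qed.

Lemma take_filter T n (s : seq T) : take n s = map snd [seq p <- zip (indices s) s | p.1 < n].
Proof.
rewrite /indices; suff H m : map snd [seq p <- zip (iota m (size s)) s | p.1 < n] = take (n - m) s.
  by rewrite H subn0.
elim: s m => [//|x s IH] m /=; case: (ltnP m n) => mn.
  by rewrite /= IH -(subnSK mn).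
rewrite IH; have -> : n - m = 0 by lia.
by rewrite (_ : n - m.+1 = 0) ?take0 //; lia.
Qed.

Lemma drop_filter T n (s : seq T) : drop n s = map snd [seq p <- zip (indices s) s | n <= p.1].
Proof.
rewrite /indices; suff H m : map snd [seq p <- zip (iota m (size s)) s | n <= p.1] = drop (n - m) s.
  by rewrite H subn0.
elim: s m => [//|x s IH] m /=; case: (leqP n m) => mn.
  rewrite /= IH; have -> : n - m = 0 by lia.
  by rewrite (_ : n - m.+1 = 0) ?drop0 //; lia.
by rewrite IH -[n - m]subnSK.
Qed.

Lemma PT_take {E T : encType} (n : E -> nat) (l : E -> seq T) : PT n -> PT l -> PT (fun e => take (n e) (l e)).
Proof.
move=> Pn Pl; have Pi := PT_indices Pl.
apply: (PT_ext (f := fun e => map snd [seq p <- zip (indices (l e)) (l e) | p.1 < n e])) => [|e].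
  pt; refine (PT_comp Pn (f := fun p : E * (nat * T) => p.1) _); pt.
by rewrite -take_filter.
Qed.

Lemma PT_drop {E T : encType} (n : E -> nat) (l : E -> seq T) : PT n -> PT l -> PT (fun e => drop (n e) (l e)).
Proof.
move=> Pn Pl; have Pi := PT_indices Pl.
apply: (PT_ext (f := fun e => map snd [seq p <- zip (indices (l e)) (l e) | n e <= p.1])) => [|e].
  pt; refine (PT_comp Pn (f := fun p : E * (nat * T) => p.1) _); pt.
by rewrite -drop_filter.
Qed.

(* Bitwise search; for a decreasing list of powers of two down to 1 it finds [lo] with [P lo] and [~~ P lo.+1],
   given [P 0] and that [P] fails at twice the largest power. *)
Definition search (P : nat -> bool) (pows : seq nat) : nat :=
  foldl (fun lo d => if P (lo + d) then lo + d else lo) 0 pows.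

Lemma search_le P s lo : foldl (fun lo d => if P (lo + d) then lo + d else lo) lo s <= lo + sumn s.
Proof.
elim: s lo => [|d s IH] lo /=; first by rewrite addn0.
by apply: leq_trans (IH _) _; case: ifP => _; lia.
Qed.

Lemma PT_search {E : encType} (P : E -> nat -> bool) (s : E -> seq nat) :
  PT (fun p : E * nat => P p.1 p.2) -> PT s -> PT (fun e => search (P e) (s e)).
Proof.
move=> PP Ps; apply: (PT_foldl (G := fun e lo d => if P e (lo + d) then lo + d else lo)
   (g := fun e => (4 * sz (s e)).+1)); [|pt|pt| |].
- pt; refine (PT_comp PP (f := fun p : E * (nat * nat) => (p.1, p.2.1 + p.2.2)) _); pt.
- exact: (polyb_S (polyb_mul (polyb_const 4) (PT_sz Ps))).
move=> e s1 s2 es; apply: sz_nat_le; apply: leq_ltn_trans (search_le _ _ _) _.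
apply: leq_trans (sumn_lt_sz _) _; rewrite leq_exp2l // es.
by have := sz_cat s1 s2; have := sz_gt0 s2; lia.
Qed.

Definition powers T (s : seq T) : seq nat := foldr (fun _ l => (2 * head 1 l) :: l) [:: 1] s.

(* Conversion between the raw contents of register 0 and the encoding of a bit string. *)
Definition in_cmd : cmd :=
  Seq (Mv 0 1) (Seq (Push 0 false)
    (While 1 (Seq (Push 0 false) (Push 0 true))
       (Seq (Push 0 false) (Seq (Push 0 false) (Seq (Push 0 true) (Push 0 true)))))).
Definition out_cmd : cmd :=
  Seq (While 0 Skip (Case 0 Skip (Push 1 false)
    (Case 0 Skip (Case 0 Skip (Push 1 true) Skip) Skip))) (Mv 1 0).

Lemma in_cmd_runs w : runs in_cmd (input_regs w) (10 * size w + 10)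
  (fr (input_regs w) 0 [:: tbits (enc w)]).
Proof.
apply: (@runs_le _ _ (2 * size w + 1 + (1 + (5 * size w + 1)))); first lia.
have -> : input_regs w = fr (input_regs w) 0 [:: w].
  by apply: functional_extensionality => -[|j]; rewrite /fr /= ?subn0 ?nth_nil.
apply: runs_seq (@fr_Mv 0 1 _ 0 _ [:: [::]; rev w] _ _ _ _) _; nths.
apply: runs_seq (@fr_push 0 false _ 0 _ [:: [:: false]; rev w] _) _; nths.
set r := input_regs w.
suff H u v : runs (While 1 (Seq (Push 0 false) (Push 0 true))
       (Seq (Push 0 false) (Seq (Push 0 false) (Seq (Push 0 true) (Push 0 true)))))
    (fr r 0 [:: tbits (enc v); u]) (5 * size u + 1) (fr r 0 [:: tbits (enc (rev u ++ v))]).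
  rewrite -(size_rev w); have := H (rev w) [::]; rewrite revK cats0.
  rewrite (_ : fr _ 0 [:: tbits (enc w)] = fr (fr r 0 [:: w]) 0 [:: tbits (enc w)]) //.
elim: u v => [|b u IH] v.
  by rewrite (fr_eq r 0 (ws' := [:: tbits (enc v)])) /=; [exact: runs_while_nil | do 4?[case=> //=]].
apply: (@runs_le _ _ (4 + (5 * size u + 1)).+1); first by rewrite /=; lia.
rewrite rev_cons cat_rcons; apply: (@runs_while _ _ _ _ b u) (IH (b :: v)) => //.
rewrite (_ : upd _ _ _ = fr r 0 [:: tbits (enc v); u]); last exact: (@fr_upd r 0 _ 1).
case: b.
  apply: (@runs_le _ _ (1 + (1 + (1 + 1)))) => //.
  apply: runs_seq (@fr_push 0 false _ 0 _ [:: _; u] _) _; nths.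
  apply: runs_seq (@fr_push 0 false _ 0 _ [:: _; u] _) _; nths.
  apply: runs_seq (@fr_push 0 true _ 0 _ [:: _; u] _) _; nths.
  by apply: (@fr_push 0 true _ 0); nths.
apply: (@runs_le _ _ (1 + 1)) => //.
apply: runs_seq (@fr_push 0 false _ 0 _ [:: _; u] _) _; nths.
by apply: (@fr_push 0 true _ 0); nths.
Qed.

Lemma out_cmd_runs r w : runs out_cmd (fr r 0 [:: tbits (enc w)]) (10 * size w + 10) (fr r 0 [:: w]).
Proof.
suff H u v : runs (While 0 Skip (Case 0 Skip (Push 1 false)
    (Case 0 Skip (Case 0 Skip (Push 1 true) Skip) Skip)))
    (fr r 0 [:: tbits (enc u); v]) (5 * size u + 2) (fr r 0 [:: [::]; rev u ++ v]).
  apply: (@runs_le _ _ (5 * size w + 2 + (2 * size w + 1))); first lia.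
  have := H w [::]; rewrite cats0 (@fr_eq r 0 [:: tbits (enc w)] [:: tbits (enc w); [::]]); last by do 4?[case=> //=].
  move=> /runs_seq; apply; apply: (@fr_Mv 1 0 r 0); rewrite ?size_rev //.
  by do 4?[case => //=]; rewrite revK cats0.
elim: u v => [|b u IH] v.
  apply: (@runs_le _ _ (0 + 1).+1) => //; apply: (@runs_while _ _ _ _ false [::]) => //; first exact: runs_skip.
  rewrite (_ : upd _ _ _ = fr r 0 [:: [::]; v]); last exact: (@fr_upd r 0 _ 0).
  exact: runs_while_nil.
apply: (@runs_le _ _ (4 + (5 * size u + 2)).+1); first by rewrite /=; lia.
rewrite rev_cons cat_rcons.
apply: (@runs_while _ _ _ _ true (tbits (enc b) ++ tbits (enc u))) (IH (b :: v)) => //.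
rewrite (_ : upd _ _ _ = fr r 0 [:: tbits (enc b) ++ tbits (enc u); v]); last exact: (@fr_upd r 0 _ 0).
case: b.
  rewrite -[tbits (enc true) ++ _]/([:: true, false, false & tbits (enc u)]).
  apply: (@fr_case 0 _ _ _ r 0 _ true _ [:: [:: false, false & tbits (enc u)]; v]); nths.
  apply: (@fr_case 0 _ _ _ r 0 _ false _ [:: [:: false & tbits (enc u)]; v]); nths.
  apply: (@fr_case 0 _ _ _ r 0 _ false _ [:: tbits (enc u); v]); nths.
  by apply: (@fr_push 1 true); nths.
rewrite -[tbits (enc false) ++ _]/(false :: tbits (enc u)).
apply: (@runs_le _ _ 2) => //.
apply: (@fr_case 0 _ _ _ r 0 _ false _ [:: tbits (enc u); v]); nths.
by apply: (@fr_push 1 false); nths.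
Qed.

Lemma exec_le M m n (c fin : config M) : m <= n -> exec m c = Some fin -> exec n c = Some fin.
Proof.
elim: m n c => [|m IH] [|n] c //= le; case: (step c) => // d; first by move=> e; exact: (IH n).
Qed.

Theorem PT_TM (f : seq bool -> seq bool) : PT f ->
  exists (M : TM) (c : nat), forall w, exists2 fin,
    exec (M := M) ((size w).+2 ^ c) (init M w) = Some fin & output fin = f w.
Proof.
move=> [p pf [c pc]].
have [M [K MK]] := cmd_TM (Seq in_cmd (Seq (compP p 0) out_cmd)).
pose B (w : seq bool) := 10 * size w + 10 + (50 * (4 * size w + 3) ^ c + (10 * (4 * size w + 3) ^ c + 10)).
have rB w : runs (Seq in_cmd (Seq (compP p 0) out_cmd)) (input_regs w) (B w)
    (fr (input_regs w) 0 [:: f w]).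
  have szw : pcost p (enc w) <= (4 * size w + 3) ^ c.
    by apply: leq_trans (pc w) _; apply: leq_exp2rW; have := sz_bits w; lia.
  apply: runs_seq (in_cmd_runs w) _; apply: runs_seq.
    by apply: runs_le (compP_runs p _ 0 _); rewrite leq_mul2l szw.
  rewrite pf; apply: runs_le (out_cmd_runs _ _).
  rewrite leq_add2r leq_mul2l /=; apply: leq_trans szw; apply: leq_trans (tsize_eval _ _).
  by rewrite pf; apply: ltnW; exact: size_le_sz.
have [d dP] : polyb (fun w : seq bool => K * (B w + size w).+1 ^ 2).
  have Pn : polyb (fun w : seq bool => size w).
    by apply: polyb_le polyb_sz _ => w; exact/ltnW/size_le_sz.
  have P1 k l : polyb (fun w : seq bool => k * size w + l).
    exact: (polyb_add (polyb_mul (polyb_const k) Pn) (polyb_const l)).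
  have P2 k : polyb (fun w : seq bool => k * (4 * size w + 3) ^ c).
    exact: (polyb_mul (polyb_const k) (polyb_exp c (P1 4 3))).
  have PB : polyb B by exact: (polyb_add (P1 10 10) (polyb_add (P2 50) (polyb_add (P2 10) (polyb_const 10)))).
  exact: (polyb_mul (polyb_const K) (polyb_exp 2 (polyb_S (polyb_add PB Pn)))).
exists M, (3 * d) => w; have [n len rn] := rB w.
have [fin ex out] := MK w n _ rn; exists fin; last exact: out.
apply: exec_le ex; apply: leq_trans (_ : K * (B w + size w).+1 ^ 2 <= _).
  by rewrite leq_mul2l leq_exp2rW ?orbT // ltnS leq_add2r.
(* The tree of [w] has at most [4 * size w + 1] bits, and [4 n + 3 <= (n + 2) ^ 3]. *)
apply: leq_trans (dP w) _; rewrite expnM; apply: leq_exp2rW.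
by have := sz_bits w; rewrite !expnS expn0; nia.
Qed.

(** * The algorithm *)

(* A facility is (index, (opening cost, distances to the clients)); an entry of a run adds the time at
   which the facility was paid for and the clients contributing to it. *)
Notation site := (nat * (nat * seq nat))%type.
Notation entry := (site * (nat * seq bool))%type.

(* [caps] holds the values of the frozen clients, and a value beyond every time for the others; at time [T] the
   value of a client is the minimum of its cap and [T]. *)
Definition contrib (caps row : seq nat) (T : nat) :=
  sumn [seq minn p.1 T - p.2 | p <- zip caps row].
Definition feas (fs : seq site) (lam : nat) (caps : seq nat) (T : nat) :=
  all (fun g : site => contrib caps g.2.2 T <= g.2.1 + lam) fs.
Definition bad (fs : seq site) (lam : nat) (caps : seq nat) (T : nat) :=
  [seq g <- fs | ~~ (contrib caps g.2.2 T <= g.2.1 + lam)].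
Definition freeze (caps row : seq nat) (T : nat) :=
  [seq if (T < p.1) && (p.2 <= T) then T else p.1 | p <- zip caps row].

(** One facility is recorded per step; another that remains overpaid at [T.+1] after the freezing
    comes up in a later step with the same [T]. *)
Definition jv_next (st : seq nat * seq (site * nat)) (T : nat) (b : seq site) :=
  if b is g :: _ then (freeze st.1 g.2.2 T, (g, T) :: st.2) else st.
Definition jv_time (fs : seq site) (lam : nat) (pows : seq nat) (caps : seq nat) :=
  search (feas fs lam caps) pows.
Definition jv_step (fs : seq site) (lam : nat) (pows : seq nat) (q : nat) (st : seq nat * seq (site * nat)) :=
  if q <= count (fun c => c < (sumn pows).+1) st.1 then st
  else jv_next st (jv_time fs lam pows st.1) (bad fs lam st.1 (jv_time fs lam pows st.1).+1).
(** As argument of the fold, [cls] only counts rounds: each freezes a new client until [q] are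
    frozen. The initial cap [(sumn pows).+1] exceeds every time that the search can return. *)
Definition jv (fs : seq site) (lam : nat) (pows : seq nat) (q : nat) (cls : seq nat) :=
  foldl (fun st _ => jv_step fs lam pows q st) ([seq (sumn pows).+1 | _ <- cls], [::]) cls.

Definition last_time (W : seq (site * nat)) := head 0 [seq w.2 | w <- W].
Definition entries (st : seq nat * seq (site * nat)) : seq entry :=
  [seq (w.1, (w.2, [seq p.2 < minn p.1 w.2 |
                     p <- zip [seq minn c (last_time st.2) | c <- st.1] w.1.2.2])) | w <- st.2].
Definition run_entries fs pows q cls lam := entries (jv fs lam pows q cls).

Definition meets (N N' : seq bool) := has (fun p => p.1 && p.2) (zip N N').
(** A run lists its latest facility first and [foldr] starts from the end, so facilities are tried
    in the order in which they were recorded. *)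
Definition greedy (es : seq entry) : seq entry :=
  foldr (fun e F => if has (fun e' : entry => meets e.2.2 e'.2.2) F then F else e :: F) [::] es.

(** Facilities are compared through a client, as only distances from facilities to clients are
    stored. The 7 has to cover the link found in [early_linked]. *)
Definition linked (v f : entry) := has (fun p => p.1 + p.2 <= 7 * v.2.1) (zip v.1.2.2 f.1.2.2).
(** Each facility of [F2] that has a link elects only the first one of [F1] linked to it, so at most
    as many are kept as there are electors. *)
Definition kept (F1 F2 : seq entry) :=
  [seq p.2 | p <- [seq p <- zip (indices F1) F1 | has (fun v => find (linked v) F1 == p.1) F2]].
Definition filler (F1 F2 : seq entry) :=
  [seq p.2 | p <- [seq p <- zip (indices F1) F1 | ~~ has (fun v => find (linked v) F1 == p.1) F2]].
Definition fresh (F1 F2 : seq entry) := [seq v <- F2 | ~~ has (linked v) F1].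
(** Taking [s.+1] from [X] but [k - size Y - s] from [Z] gives the one extra facility: the set
    contains both the [k] facilities counted for [s] and those counted for [s.+1]. For [s = size X]
    there is no extra one. *)
Definition blend (k : nat) (Y X Z : seq entry) (s : nat) :=
  Y ++ take s.+1 X ++ take (k - size Y - s) Z.
Definition mix (k : nat) (F1 F2 : seq entry) : seq (seq entry) :=
  [seq blend k (kept F1 F2) (fresh F1 F2) (filler F1 F2) s
     | s <- size (fresh F1 F2) :: indices (fresh F1 F2)].

(** Without the latest facility, all contributors lie in the set [E] of [run_ok], which has fewer
    than [q] clients; see [must0]. *)
Definition many fs pows q cls k lam := k <= size (greedy (behead (run_entries fs pows q cls lam))).
Definition crit fs pows q cls k lpows := search (many fs pows q cls k) lpows.
Definition cand_sets fs pows q cls k lpows : seq (seq entry) :=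
  if many fs pows q cls k 0 then
    mix k (greedy (behead (run_entries fs pows q cls (crit fs pows q cls k lpows))))
          (greedy (run_entries fs pows q cls (crit fs pows q cls k lpows).+1))
  else [:: greedy (run_entries fs pows q cls 0)].

Definition near (O : seq site) (j : nat) : nat * nat :=
  foldr (fun g acc => if acc.1 <= nth 0 g.2.2 j then acc else (nth 0 g.2.2 j, g.1))
    (nth 0 (head (0, (0, [::])) O).2.2 j, (head (0, (0, [::])) O).1) O.
(* Ranking the clients by distance, with ties broken by index. *)
Definition keys (cls : seq nat) (O : seq site) : seq nat :=
  [seq (near O j).1 * size cls + j | j <- cls].
Definition serves (cls : seq nat) (O : seq site) (q j : nat) :=
  count (fun x => x < (near O j).1 * size cls + j) (keys cls O) < q.
Definition cost_of (cls : seq nat) (q : nat) (O : seq site) : nat :=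
  sumn [seq g.2.1 | g <- O] + sumn [seq if serves cls O q j then (near O j).1 else 0 | j <- cls].

(** Both families may select the same facility; filtering [fs] by index opens it once and restores
    the unscaled data. *)
Definition opened_of (fs : seq site) (c : seq entry) : seq site :=
  [seq g <- fs | has (fun e : entry => e.1.1 == g.1) c].
Definition scale (N : nat) (fs : seq site) : seq site :=
  [seq (g.1, (N * g.2.1, [seq N * d | d <- g.2.2])) | g <- fs].
Definition cheap (fs : seq site) (g : site) : seq site := [seq h <- fs | h.2.1 <= g.2.1].
Definition candidates fs N pows q cls k lpows : seq (seq site) :=
  [seq opened_of fs c |
    c <- flatten [seq cand_sets (scale N (cheap fs g)) pows q cls k lpows | g <- fs]].
Definition best cls q (L : seq (seq site)) : seq site :=
  foldr (fun O acc => if nilp acc || (cost_of cls q O <= cost_of cls q acc) then O else acc) [::] L.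

(* Large enough to dominate the rounding errors, see [factor_bounds]. *)
Definition factor (cls : seq nat) := foldr muln 1 [seq size cls + 64 | _ <- [:: 0; 0; 0] ++ cls].
Definition total (fs : seq site) := sumn [seq g.2.1 + sumn g.2.2 | g <- fs].
(** Exceeds [m + 1] times the scaled cost and distances of any single facility, so that [many] fails
    at the power of two ending the search for [lam]; see [cand_good]. *)
Definition lam_bound fs cls := (size cls).+1 * (factor cls * total fs).+1.
Definition lam_powers fs cls := powers (bin (lam_bound fs cls)).
Definition time_powers fs cls := powers (bin (8 * lam_bound fs cls)).
(** [best] reads [[::]] as absence of a candidate, hence the filter and the separate treatment of
    [q == 0]. *)
Definition solve fs q cls k : seq site :=
  if q == 0 then [::] else
  best cls q [seq O <- candidates fs (factor cls) (time_powers fs cls) q cls k (lam_powers fs cls)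
                | ~~ nilp O && (size O <= k.+1)].

Definition assigned cls O q : seq nat := [seq if serves cls O q j then (near O j).2.+1 else 0 | j <- cls].
Definition write_sol cls O q : seq bool :=
  enc_nat (size O) ++ flatten [seq enc_nat g.1 | g <- (O : seq site)] ++
  flatten [seq enc_nat a | a <- assigned cls O q].

(* (skip the next bit, first bit of the current pair, bits of the current number, numbers read so far), the last
   two being reversed. After the four sizes every number is preceded by a sign, which is skipped. *)
Definition tok_state := (bool * (seq bool * (seq bool * seq nat)))%type.
Definition tok_step (st : tok_state) (b : bool) : tok_state :=
  if st.1 then (false, st.2)
  else if st.2.1 is h :: _ then
    if h == b then (false, ([::], (b :: st.2.2.1, st.2.2.2)))
    else (4 <= (size st.2.2.2).+1, ([::], ([::], bval (rev st.2.2.1) :: st.2.2.2)))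
  else (false, ([:: b], st.2.2)).
Definition tokens (w : seq bool) : seq nat :=
  rev (foldl tok_step (false, ([::], ([::], [::]))) w).2.2.2.
Definition pair_up (s : seq nat) : seq (nat * nat) :=
  (foldr (fun x st => if st.1 is y :: _ then ([::], (x, y) :: st.2) else ([:: x], st.2))
    (Nil nat, Nil (nat * nat)) s).2.
(** Every numerator is multiplied by all the other denominators, which brings all fractions to the
    product of the denominators without any division. *)
Definition unscale (ps : seq (nat * nat)) : seq nat :=
  [seq p.2.1 * foldr muln 1 [seq if r.1 == p.1 then 1 else r.2.2 | r <- zip (indices ps) ps]
     | p <- zip (indices ps) ps].
Definition read_facs (nf nc : nat) (vals : seq nat) : seq site :=
  [seq (i, (nth 0 vals i, take nc (drop (i * (nf + nc) + nf) (drop nf vals))))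
     | i <- indices (take nf vals)].
Definition tok_vals (ts : seq nat) := unscale (pair_up (drop 4 ts)).
Definition tok_facs (ts : seq nat) := read_facs (nth 0 ts 0) (nth 0 ts 1) (tok_vals ts).
(** Cutting the list of values to [nc] entries gives a list of the right length without counting up
    to a number read in binary. *)
Definition tok_clients (ts : seq nat) := indices (take (nth 0 ts 1) (drop (nth 0 ts 0) (tok_vals ts))).
Definition tok_solve (ts : seq nat) : seq site :=
  solve (tok_facs ts) (nth 0 ts 1 - nth 0 ts 2) (tok_clients ts) (nth 0 ts 3).
Definition algorithm (w : seq bool) : seq bool :=
  write_sol (tok_clients (tokens w)) (tok_solve (tokens w)) (nth 0 (tokens w) 1 - nth 0 (tokens w) 2).

(** * Running time of the algorithm *)

Lemma sz_suffix {T : encType} (s1 s2 : seq T) : sz s2 <= sz (s1 ++ s2).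
Proof. by have := sz_cat s1 s2; have := sz_gt0 s1; lia. Qed.

Lemma sz_seq_le {T : encType} (s : seq T) X : (forall s1 x s2, s = s1 ++ x :: s2 -> sz x <= X) -> sz s <= (size s * X.+1).+1.
Proof. by move=> H; rewrite -{1}(map_id s); apply: sz_map_le. Qed.

Lemma PT_head {E T : encType} (x0 : T) (l : E -> seq T) : PT l -> PT (fun e => head x0 (l e)).
Proof.
move=> Pl; apply: (PT_ext (f := fun e => if l e is h :: t then h else x0)).
  by apply: (PT_case (g := fun p : E * (T * seq T) => p.2.1)) => //; pt.
by move=> e; case: (l e).
Qed.

Lemma PT_nth {E T : encType} (x0 : T) (l : E -> seq T) (n : E -> nat) : PT l -> PT n -> PT (fun e => nth x0 (l e) (n e)).
Proof.
move=> Pl Pn; apply: (PT_ext (f := fun e => head x0 (drop (n e) (l e)))).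
  by apply: PT_head; exact: PT_drop.
by move=> e; rewrite -nth0 nth_drop addn0.
Qed.

Lemma PT_flatten {E T : encType} (l : E -> seq (seq T)) : PT l -> PT (fun e => flatten (l e)).
Proof.
move=> Pl; apply: (PT_foldr (G := fun _ => cat) (g := fun e => sz (l e))); [pt|pt|pt|exact: PT_sz|].
move=> e s1 s2 ->; apply: leq_trans (sz_suffix s1 s2); elim: s2 => //= x s IH.
by rewrite sz_cons; have := sz_cat x (foldr cat [::] s); move: IH; lia.
Qed.

Lemma PT_find {E T : encType} (P : E -> T -> bool) (l : E -> seq T) :
  PT (fun p : E * T => P p.1 p.2) -> PT l -> PT (fun e => find (P e) (l e)).
Proof.
move=> PP Pl; apply: (PT_ext (f := fun e => foldr (fun x n => if P e x then 0 else n.+1) 0 (l e))) => [|e]; last first.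
  by elim: (l e) => //= x s ->.
apply: (PT_foldr (G := fun e x n => if P e x then 0 else n.+1) (g := fun e => (4 * sz (l e)).+1)); [|pt|pt| |].
- pt; refine (PT_comp PP (f := fun p : E * (T * nat) => (p.1, p.2.1)) _); pt.
- exact: (polyb_S (polyb_mul (polyb_const 4) (PT_sz Pl))).
move=> e s1 s2 ->; apply: sz_nat_le; apply: leq_trans (ltn_expl _ (ltnSn 1)).
rewrite ltnS; apply: leq_trans (_ : size s2 <= _).
  by elim: s2 => //= x s IH; case: ifP.
by apply: leq_trans (ltnW (size_le_sz _)) (sz_suffix s1 s2).
Qed.

Lemma size_powers T (s : seq T) : head 1 (powers s) = 2 ^ size s.
Proof. by elim: s => [//|x s IH] /=; rewrite IH expnS. Qed.

Lemma PT_powers {E T : encType} (l : E -> seq T) : PT l -> PT (fun e => powers (l e)).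
Proof.
move=> Pl; apply: (PT_foldr (G := fun _ _ l => (2 * head 1 l) :: l)
  (g := fun e => ((sz (l e)).+1 * (4 * (sz (l e)).+1).+2).+1)); [|pt|pt| |].
- by pt; apply: PT_head; pt.
- have Sl := PT_sz Pl; have S1 := polyb_S Sl.
  exact: (polyb_S (polyb_mul S1 (polyb_S (polyb_S (polyb_mul (polyb_const 4) S1))))).
move=> e s1 s2 es; rewrite -/(powers s2).
have le : size s2 < sz (l e) by rewrite es; apply: leq_trans (size_le_sz _) (sz_suffix s1 s2).
have sp (s : seq T) : size (powers s) = (size s).+1 by elim: s => //= x s ->.
apply: leq_trans (sz_nats_le (k := (sz (l e)).+1) _) _; last by rewrite ltnS sp leq_mul2r ltnS (ltnW le) orbT.
move=> x; elim: s2 le {es} => [|y s IH] /= le.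
  by rewrite inE => /eqP->; rewrite -[1]/(2 ^ 0) ltn_exp2l.
rewrite inE => /orP[/eqP->|]; last by apply: IH; lia.
by rewrite size_powers -expnS ltn_exp2l //; lia.
Qed.

Ltac pt_un a L := refine (PT_comp L (f := a) _).

Ltac pt_nat :=
  match goal with
  | |- PT fst => refine (PT_fst PT_id)
  | |- PT snd => refine (PT_snd PT_id)
  | |- PT (fun e => count _ _) => refine (PT_count _ _)
  | |- PT (fun e => find _ _) => refine (PT_find _ _)
  | |- PT (fun e => search _ _) => refine (PT_search _ _)
  | |- PT (fun e => size (@?a e)) => refine (PT_size (l := a) _)
  | |- PT (fun e => sumn (@?a e)) => refine (PT_sumn (l := a) _)
  | |- PT (fun e => foldr muln 1 (@?a e)) => refine (PT_prod (l := a) _)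
  | |- PT (fun e => indices (@?a e)) => refine (PT_indices (l := a) _)
  | |- PT (fun e => take (@?a e) (@?b e)) => refine (PT_take (n := a) (l := b) _ _)
  | |- PT (fun e => drop (@?a e) (@?b e)) => refine (PT_drop (n := a) (l := b) _ _)
  | |- PT (fun e => head ?x (@?a e)) => refine (PT_head x (l := a) _)
  | |- PT (fun e => nth ?x (@?a e) (@?b e)) => refine (PT_nth x (l := a) (n := b) _ _)
  | |- PT (fun e => flatten (@?a e)) => refine (PT_flatten (l := a) _)
  | |- PT (fun e => powers (@?a e)) => refine (PT_powers (l := a) _)
  end.
Ltac pt_base := first [pt_list | pt_bool | pt_arith | pt_nat].
Ltac pt_hook ::= pt_base.

Lemma PT_contrib : PT (fun p : seq nat * (seq nat * nat) => contrib p.1 p.2.1 p.2.2).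
Proof. rewrite /contrib; pt. Qed.

Lemma PT_feas : PT (fun p : (seq site * nat) * (seq nat * nat) => feas p.1.1 p.1.2 p.2.1 p.2.2).
Proof. by rewrite /feas /contrib; pt. Qed.

Lemma PT_bad : PT (fun p : (seq site * nat) * (seq nat * nat) => bad p.1.1 p.1.2 p.2.1 p.2.2).
Proof. by rewrite /bad /contrib; pt. Qed.

Lemma PT_freeze : PT (fun p : seq nat * (seq nat * nat) => freeze p.1 p.2.1 p.2.2).
Proof. by rewrite /freeze; pt. Qed.

Ltac pt_jv :=
  match goal with
  | |- PT (fun e => contrib (@?a e) (@?b e) (@?c e)) => pt_un (fun e => (a e, (b e, c e))) PT_contrib
  | |- PT (fun e => feas (@?a e) (@?b e) (@?c e) (@?d e)) => pt_un (fun e => ((a e, b e), (c e, d e))) PT_feas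
  | |- PT (fun e => bad (@?a e) (@?b e) (@?c e) (@?d e)) => pt_un (fun e => ((a e, b e), (c e, d e))) PT_bad
  | |- PT (fun e => freeze (@?a e) (@?b e) (@?c e)) => pt_un (fun e => (a e, (b e, c e))) PT_freeze
  end.
Ltac pt_hook ::= first [pt_base | pt_jv].

Notation jv_state := (seq nat * seq (site * nat))%type.

Lemma PT_jv_next : PT (fun p : jv_state * (nat * seq site) => jv_next p.1 p.2.1 p.2.2).
Proof.
apply: (PT_case (g := fun p : (jv_state * (nat * seq site)) * (site * seq site) =>
  (freeze p.1.1.1 p.2.1.2.2 p.1.2.1, (p.2.1, p.1.2.1) :: p.1.1.2))); pt.
Qed.

Lemma PT_jv_time : PT (fun p : (seq site * nat) * (seq nat * seq nat) => jv_time p.1.1 p.1.2 p.2.1 p.2.2).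
Proof. by rewrite /jv_time; pt. Qed.

Lemma PT_jv_step : PT (fun p : ((seq site * nat) * (seq nat * nat)) * jv_state =>
  jv_step p.1.1.1 p.1.1.2 p.1.2.1 p.1.2.2 p.2).
Proof.
rewrite /jv_step.
have Pt : PT (fun p : ((seq site * nat) * (seq nat * nat)) * jv_state => jv_time p.1.1.1 p.1.1.2 p.1.2.1 p.2.1).
  by pt_un (fun p : ((seq site * nat) * (seq nat * nat)) * jv_state => ((p.1.1.1, p.1.1.2), (p.1.2.1, p.2.1))) PT_jv_time; pt.
apply: PT_if; [by pt | by pt |].
pt_un (fun p : ((seq site * nat) * (seq nat * nat)) * jv_state =>
   (p.2, (jv_time p.1.1.1 p.1.1.2 p.1.2.1 p.2.1, bad p.1.1.1 p.1.1.2 p.2.1 (jv_time p.1.1.1 p.1.1.2 p.1.2.1 p.2.1).+1))) PT_jv_next.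
pt.
Qed.

(** Keeps the state of polynomial size in [PT_jv]: the recorded facilities come from [fs], and caps
    and times never pass the initial cap. *)
Lemma jv_size fs lam pows q (cls s : seq nat) :
  let st := foldl (fun st _ => jv_step fs lam pows q st) ([seq (sumn pows).+1 | _ <- cls], [::]) s in
  [/\ size st.1 <= size cls, forall c, c \in st.1 -> c <= (sumn pows).+1, size st.2 <= size s &
    forall w : site * nat, w \in st.2 -> w.1 \in fs /\ w.2 <= sumn pows].
Proof.
elim/last_ind: s => [|s x IH].
  by rewrite /= size_map; split=> // c /mapP[y _ ->].
rewrite /= foldl_rcons size_rcons; set st := foldl _ _ _ in IH *; rewrite /= in IH.
case: IH => i1 i2 i3 i4; rewrite /jv_step; case: ifP => _; first by split=> //; exact: leqW.
have Tle : jv_time fs lam pows st.1 <= sumn pows by exact: search_le.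
move: (jv_time _ _ _ _) Tle => T Tle.
rewrite /jv_next; case eb: (bad _ _ _ _) => [|g t]; first by split=> //; exact: leqW.
have gf : g \in fs by have : g \in bad fs lam st.1 T.+1; [rewrite eb mem_head | rewrite mem_filter => /andP[]].
split=> /=.
- by rewrite size_map size_zip; apply: leq_trans i1; exact: geq_minl.
- move=> c /mapP[[a b] ab ->] /=; case: ifP => _; first exact: leqW.
  apply: i2; move: ab => /(nthP (0, 0))[i lt e]; move: lt; rewrite size_zip leq_min => /andP[l1 l2].
  have -> : a = (nth (0, 0) (zip st.1 g.2.2) i).1 by rewrite e.
  by rewrite nth_zip_cond size_zip leq_min l1 l2 /= mem_nth.
- by rewrite ltnS.
move=> w; rewrite inE => /orP[/eqP->|]; [by split | exact: i4].
Qed.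

Lemma PT_jv : PT (fun p : ((seq site * nat) * (seq nat * nat)) * seq nat => jv p.1.1.1 p.1.1.2 p.1.2.1 p.1.2.2 p.2).
Proof.
apply: (PT_foldl (G := fun (p : ((seq site * nat) * (seq nat * nat)) * seq nat) st _ => jv_step p.1.1.1 p.1.1.2 p.1.2.1 p.1.2.2 st)
  (g := fun p => (sz p * (4 * (sz p).+1).+2 + sz p * (sz p + (4 * sz p).+1).+2).+3)); [|by pt|by pt| |].
- pt_un (fun p : (((seq site * nat) * (seq nat * nat)) * seq nat) * (jv_state * nat) => (p.1.1, p.2.1)) PT_jv_step; pt.
- have Sp : polyb (fun p : ((seq site * nat) * (seq nat * nat)) * seq nat => sz p) by exact: polyb_sz.
  do 3!apply: polyb_S; apply: polyb_add; apply: polyb_mul => //; do 2!apply: polyb_S.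
    by apply: polyb_mul; [exact: polyb_const | exact: polyb_S].
  by apply: polyb_add => //; apply: polyb_S; apply: polyb_mul => //; exact: polyb_const.
move=> [[[fs lam] [pows q]] cls] s1 s2 /= es.
have := jv_size fs lam pows q cls s1; set st := foldl _ _ _ => /= -[i1 i2 i3 i4].
set X := sz (_, cls); have [szf szp szc] : [/\ sz fs <= X, sz pows <= X & sz cls <= X].
  by rewrite /X !sz_pair; split; lia.
have c1 : size cls <= X by apply: leq_trans (ltnW (size_le_sz _)) szc.
have c2 : size s1 <= X by apply: leq_trans (_ : size cls <= X) => //; rewrite es size_cat leq_addr.
have S1 : sumn pows < 2 ^ X by apply: leq_trans (sumn_lt_sz _) _; rewrite leq_exp2l.
have -> : st = (st.1, st.2) by case: (st).
rewrite sz_pair ltnS -addSn -addnS; apply: leq_add.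
  apply: leq_trans (sz_nats_le (k := X.+1) _) _; last by rewrite ltnS leq_mul // (leq_trans i1).
  by move=> x /i2 le; rewrite expnS; lia.
apply: leq_trans (sz_seq_le (X := (X + (4 * X).+1).+1) _) _; last by rewrite ltnS leq_mul // (leq_trans i3).
move=> u [g T] v e2; have [gf /= Tle] : (g, T).1 \in fs /\ (g, T).2 <= sumn pows by apply: i4; rewrite e2 mem_cat mem_head orbT.
rewrite sz_pair ltnS; apply: leq_add; last by apply: sz_nat_le; lia.
by apply: leq_trans szf; case/splitPr: gf => p1 p2; exact: sz_mem.
Qed.

Lemma PT_last_time : PT (fun W : seq (site * nat) => last_time W).
Proof. by rewrite /last_time; pt. Qed.

Lemma PT_entries : PT (fun st : jv_state => entries st).
Proof.
rewrite /entries; have L := PT_last_time.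
have P1 : PT (fun p : jv_state * (site * nat) => last_time p.1.2) by pt_un (fun p : jv_state * (site * nat) => p.1.2) L; pt.
pt; pt_un (fun p : jv_state * (site * nat) * nat => p.1.1.2) L; pt.
Qed.

Lemma PT_run_entries : PT (fun p : ((seq site * nat) * (seq nat * nat)) * seq nat =>
  run_entries p.1.1.1 p.1.2.1 p.1.2.2 p.2 p.1.1.2).
Proof. exact: (PT_comp PT_entries PT_jv). Qed.

Lemma PT_meets : PT (fun p : seq bool * seq bool => meets p.1 p.2).
Proof. by rewrite /meets; pt. Qed.

Lemma PT_greedy : PT (fun es : seq entry => greedy es).
Proof.
apply: (PT_foldr (G := fun (_ : seq entry) (e : entry) F => if has (fun e' : entry => meets e.2.2 e'.2.2) F then F else e :: F)
  (g := fun es => sz es)); [|by pt|by pt|exact: polyb_sz|].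
  pt; pt_un (fun p : seq entry * (entry * seq entry) * entry => (p.1.2.1.2.2, p.2.2.2)) PT_meets; pt.
move=> es s1 s2 ->; apply: leq_trans (sz_suffix s1 s2); elim: s2 => //= e s IH.
by case: ifP; rewrite !sz_cons; lia.
Qed.

Lemma PT_linked : PT (fun p : entry * entry => linked p.1 p.2).
Proof. by rewrite /linked; pt. Qed.

Ltac pt_alg :=
  match goal with
  | |- PT (fun e => run_entries (@?a e) (@?b e) (@?c e) (@?d e) (@?l e)) => pt_un (fun e => (((a e, l e), (b e, c e)), d e)) PT_run_entries
  | |- PT (fun e => greedy (@?a e)) => pt_un a PT_greedy
  | |- PT (fun e => linked (@?a e) (@?b e)) => pt_un (fun e => (a e, b e)) PT_linked
  end.
Ltac pt_hook ::= first [pt_base | pt_jv | pt_alg].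

Lemma PT_kept : PT (fun p : seq entry * seq entry => kept p.1 p.2).
Proof. by rewrite /kept; pt. Qed.

Lemma PT_filler : PT (fun p : seq entry * seq entry => filler p.1 p.2).
Proof. by rewrite /filler; pt. Qed.

Lemma PT_fresh : PT (fun p : seq entry * seq entry => fresh p.1 p.2).
Proof. by rewrite /fresh; pt. Qed.

Ltac pt_mix :=
  match goal with
  | |- PT (fun e => kept (@?a e) (@?b e)) => pt_un (fun e => (a e, b e)) PT_kept
  | |- PT (fun e => filler (@?a e) (@?b e)) => pt_un (fun e => (a e, b e)) PT_filler
  | |- PT (fun e => fresh (@?a e) (@?b e)) => pt_un (fun e => (a e, b e)) PT_fresh
  end.
Ltac pt_hook ::= first [pt_base | pt_jv | pt_alg | pt_mix].

Lemma PT_mix : PT (fun p : nat * (seq entry * seq entry) => mix p.1 p.2.1 p.2.2).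
Proof. by rewrite /mix /blend; pt. Qed.

Lemma PT_many : PT (fun p : (seq site * nat) * ((seq nat * nat) * (seq nat * nat)) =>
  many p.1.1 p.2.1.1 p.2.1.2 p.2.2.1 p.1.2 p.2.2.2).
Proof. by rewrite /many; pt. Qed.

Lemma PT_crit : PT (fun p : (seq site * nat) * ((seq nat * nat) * (seq nat * seq nat)) =>
  crit p.1.1 p.2.1.1 p.2.1.2 p.2.2.1 p.1.2 p.2.2.2).
Proof.
rewrite /crit; pt; pt_un (fun p : ((seq site * nat) * ((seq nat * nat) * (seq nat * seq nat))) * nat =>
  ((p.1.1.1, p.1.1.2), (p.1.2.1, (p.1.2.2.1, p.2)))) PT_many; pt.
Qed.

Lemma PT_cand_sets : PT (fun p : (seq site * nat) * ((seq nat * nat) * (seq nat * seq nat)) =>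
  cand_sets p.1.1 p.2.1.1 p.2.1.2 p.2.2.1 p.1.2 p.2.2.2).
Proof.
rewrite /cand_sets; have C := PT_crit; pt.
  by pt_un (fun p : (seq site * nat) * ((seq nat * nat) * (seq nat * seq nat)) => (p.1, (p.2.1, (p.2.2.1, 0)))) PT_many; pt.
pt_un (fun p : (seq site * nat) * ((seq nat * nat) * (seq nat * seq nat)) => (p.1.2,
  (greedy (behead (run_entries p.1.1 p.2.1.1 p.2.1.2 p.2.2.1 (crit p.1.1 p.2.1.1 p.2.1.2 p.2.2.1 p.1.2 p.2.2.2))),
   greedy (run_entries p.1.1 p.2.1.1 p.2.1.2 p.2.2.1 (crit p.1.1 p.2.1.1 p.2.1.2 p.2.2.1 p.1.2 p.2.2.2).+1)))) PT_mix.
pt.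
Qed.

Lemma PT_near : PT (fun p : seq site * nat => near p.1 p.2).
Proof.
apply: (PT_foldr (G := fun (p : seq site * nat) (g : site) acc => if acc.1 <= nth 0 g.2.2 p.2 then acc else (nth 0 g.2.2 p.2, g.1))
  (g := fun p => sz p + 5)); [by pt|by pt|by pt| |].
  by apply: polyb_add; [exact: polyb_sz | exact: polyb_const].
move=> [O j] s1 s2 /= es.
have sn (l : seq nat) : sz (nth 0 l j) <= sz l.
  case: (ltnP j (size l)) => lj; last by rewrite nth_default // sz_gt0.
  by rewrite -{2}(cat_take_drop j l) (drop_nth 0 lj); exact: sz_mem.
have sg (g : site) : sz (nth 0 g.2.2 j, g.1) <= sz g.
  by case: g => i [f l]; rewrite !sz_pair /=; have := sn l; lia.
apply: (@leq_trans (sz O + 5)); last by rewrite leq_add2r sz_pair leqW ?leq_addr.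
have gO (g : site) p1 p2 : O = p1 ++ g :: p2 -> sz g <= sz O by move=> ->; exact: sz_mem.
elim: s2 s1 es => [|g s IH] s1 es /=.
  case: (O) gO => [|g t] gO /=; first by rewrite nth_default.
  exact: leq_trans (leq_trans (sg _) (gO g [::] t erefl)) (leq_addr _ _).
case: ifP => _; first by apply: (IH (rcons s1 g)); rewrite cat_rcons.
exact: leq_trans (leq_trans (sg _) (gO g s1 s es)) (leq_addr _ _).
Qed.

Ltac pt_solve :=
  match goal with
  | |- PT (fun e => near (@?a e) (@?b e)) => pt_un (fun e => (a e, b e)) PT_near
  | |- PT (fun e => cand_sets (@?a e) (@?b e) (@?c e) (@?d e) (@?h e) (@?i e)) =>
      pt_un (fun e => ((a e, h e), ((b e, c e), (d e, i e)))) PT_cand_sets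
  end.
Ltac pt_hook ::= first [pt_base | pt_jv | pt_alg | pt_mix | pt_solve].

Lemma PT_serves : PT (fun p : (seq nat * seq site) * (nat * nat) => serves p.1.1 p.1.2 p.2.1 p.2.2).
Proof. by rewrite /serves /keys; pt. Qed.

Lemma PT_cost_of : PT (fun p : (seq nat * seq site) * nat => cost_of p.1.1 p.2 p.1.2).
Proof.
rewrite /cost_of; pt.
pt_un (fun p : ((seq nat * seq site) * nat) * nat => (p.1.1, (p.1.2, p.2))) PT_serves; pt.
Qed.

Lemma PT_opened_of : PT (fun p : seq site * seq entry => opened_of p.1 p.2).
Proof. by rewrite /opened_of; pt. Qed.

Lemma PT_scale : PT (fun p : nat * seq site => scale p.1 p.2).
Proof. by rewrite /scale; pt. Qed.

Lemma PT_cheap : PT (fun p : seq site * site => cheap p.1 p.2).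
Proof. by rewrite /cheap; pt. Qed.

Ltac pt_final :=
  match goal with
  | |- PT (fun e => serves (@?a e) (@?b e) (@?c e) (@?d e)) => pt_un (fun e => ((a e, b e), (c e, d e))) PT_serves
  | |- PT (fun e => cost_of (@?a e) (@?b e) (@?c e)) => pt_un (fun e => ((a e, c e), b e)) PT_cost_of
  | |- PT (fun e => opened_of (@?a e) (@?b e)) => pt_un (fun e => (a e, b e)) PT_opened_of
  | |- PT (fun e => scale (@?a e) (@?b e)) => pt_un (fun e => (a e, b e)) PT_scale
  | |- PT (fun e => cheap (@?a e) (@?b e)) => pt_un (fun e => (a e, b e)) PT_cheap
  end.
Ltac pt_hook ::= first [pt_base | pt_jv | pt_alg | pt_mix | pt_solve | pt_final].

Lemma PT_candidates : PT (fun p : ((seq site * nat) * (seq nat * nat)) * (seq nat * (nat * seq nat)) =>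
  candidates p.1.1.1 p.1.1.2 p.1.2.1 p.1.2.2 p.2.1 p.2.2.1 p.2.2.2).
Proof. by rewrite /candidates; pt. Qed.

Lemma PT_best : PT (fun p : (seq nat * nat) * seq (seq site) => best p.1.1 p.1.2 p.2).
Proof.
apply: (PT_foldr (G := fun (p : (seq nat * nat) * seq (seq site)) O acc =>
   if nilp acc || (cost_of p.1.1 p.1.2 O <= cost_of p.1.1 p.1.2 acc) then O else acc)
  (g := fun p => sz p)); [by pt|by pt|by pt|exact: polyb_sz|].
move=> [[cls q] L] s1 s2 /= es; rewrite -/(best cls q s2).
apply: leq_trans (_ : sz L <= _); last by rewrite sz_pair; lia.
rewrite es; apply: leq_trans (sz_suffix s1 s2); elim: s2 {es} => //= O s IH.
by case: ifP => _; rewrite sz_cons; lia.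
Qed.

Lemma PT_factor : PT (fun cls : seq nat => factor cls).
Proof. by rewrite /factor; pt; apply: (PT_cat (l1 := fun _ => [:: 0; 0; 0]) (l2 := fun s => s)); pt. Qed.

Lemma PT_lam_bound : PT (fun p : seq site * seq nat => lam_bound p.1 p.2).
Proof. by rewrite /lam_bound /total; have F := PT_factor; pt; pt_un (fun p : seq site * seq nat => p.2) F; pt. Qed.

Lemma PT_solve : PT (fun p : (seq site * nat) * (seq nat * nat) => solve p.1.1 p.1.2 p.2.1 p.2.2).
Proof.
rewrite /solve; pose T := (seq site * nat * (seq nat * nat))%type.
have B : PT (fun p : T => lam_bound p.1.1 p.2.1).
  by pt_un (fun p : T => (p.1.1, p.2.1)) PT_lam_bound; pt.
have LP : PT (fun p : T => lam_powers p.1.1 p.2.1) by rewrite /lam_powers; pt.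
have TP : PT (fun p : T => time_powers p.1.1 p.2.1) by rewrite /time_powers; pt.
have F : PT (fun p : T => factor p.2.1) by pt_un (fun p : T => p.2.1) PT_factor; pt.
apply: PT_if; [by pt | by pt |].
pt_un (fun p : T => ((p.2.1, p.1.2), [seq O <- candidates p.1.1 (factor p.2.1) (time_powers p.1.1 p.2.1) p.1.2 p.2.1 p.2.2 (lam_powers p.1.1 p.2.1)
                | ~~ nilp O && (size O <= p.2.2.+1)])) PT_best.
apply: PT_pair; first by pt.
apply: PT_filter; first by pt.
pt_un (fun p : T => (((p.1.1, factor p.2.1), (time_powers p.1.1 p.2.1, p.1.2)), (p.2.1, (p.2.2, lam_powers p.1.1 p.2.1)))) PT_candidates.
pt.
Qed.

Lemma PT_enc_nat {E : encType} (a : E -> nat) : PT a -> PT (fun e => enc_nat (a e)).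
Proof. by move=> Pa; rewrite /enc_nat; pt. Qed.

Lemma PT_write_sol : PT (fun p : (seq nat * seq site) * nat => write_sol p.1.1 p.1.2 p.2).
Proof.
rewrite /write_sol /assigned; apply: PT_cat; first by apply: PT_enc_nat; pt.
apply: PT_cat; apply: PT_flatten; apply: PT_map.
- by apply: PT_enc_nat; pt.
- by pt.
- by apply: PT_enc_nat; pt.
by pt.
Qed.

Lemma PT_tok_step : PT (fun p : tok_state * bool => tok_step p.1 p.2).
Proof.
rewrite /tok_step; apply: PT_if; [by pt | by pt |].
apply: (PT_case (g := fun p : (tok_state * bool) * (bool * seq bool) =>
  if p.2.1 == p.1.2 then (false, ([::], (p.1.2 :: p.1.1.2.2.1, p.1.1.2.2.2)))
    else (4 <= (size p.1.1.2.2.2).+1, ([::], ([::], bval (rev p.1.1.2.2.1) :: p.1.1.2.2.2))))); [by pt | by pt |].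
apply: PT_if; [|by pt|by pt].
apply: (PT_ext (f := fun p : (tok_state * bool) * (bool * seq bool) => ~~ (p.2.1 (+) p.1.2))) => [|p].
  by apply: PT_negb; apply: PT_addb; pt.
by case: p.2.1; case: p.1.2.
Qed.

Lemma PT_tokens : PT (fun w : seq bool => tokens w).
Proof.
pose st (w : seq bool) := foldl tok_step (false, ([::], ([::], [::]))) w.
rewrite /tokens -/st; suff S : PT (fun w => st w) by pt.
apply: (PT_foldl (G := fun _ => tok_step) (g := fun w => 20 * sz w + 20)); [|by pt|by pt| |].
- by pt_un (fun p : seq bool * (tok_state * bool) => p.2) PT_tok_step; pt.
- by apply: polyb_add; [apply: polyb_mul; [exact: polyb_const | exact: polyb_sz] | exact: polyb_const].
move=> w s1 s2 es; apply: leq_trans (_ : 20 * size s1 + 20 <= _); last first.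
  have : size s1 <= size w by rewrite es size_cat leq_addr.
  by have := size_le_sz w; lia.
(* A potential: a number of [n] bits is produced from [2 n + 2] input bits. *)
suff : size (st s1).2.1 <= 1 /\ sz (st s1).2.2.2 + 4 * size (st s1).2.2.1 + 3 * size (st s1).2.1 <= 5 * size s1 + 1.
  rewrite /st; case: (foldl _ _ _) => b [h [cur ts]] /=; rewrite !sz_pair; have := sz_bool b; have := sz_bits h; have := sz_bits cur; lia.
elim/last_ind: s1 {s2 es} => [//|s b]; rewrite /st foldl_rcons size_rcons -/(st s).
case: (st s) => skip [h [cur ts]] /= [i1 i2]; rewrite /tok_step /=; case: skip => /=; first by lia.
case: h i1 i2 => [|c h] /=; first by lia.
case: h => // _; case: (c == b) => /=; first by lia.
move=> le; rewrite sz_cons; split=> //.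
have : sz (bval (rev cur)) <= (4 * size cur).+1 by rewrite -(size_rev cur); apply: sz_nat_le; exact: bval_lt.
by lia.
Qed.

Lemma PT_pair_up : PT (fun s : seq nat => pair_up s).
Proof.
pose G (x : nat) (st : seq nat * seq (nat * nat)) := if st.1 is y :: _ then (Nil nat, (x, y) :: st.2) else ([:: x], st.2).
rewrite /pair_up -/G; suff S : PT (fun s => foldr G (Nil nat, Nil (nat * nat)) s) by pt.
apply: (PT_foldr (G := fun _ => G) (g := fun s => sz s + 2)); [|by pt|by pt| |].
- apply: (PT_case (g := fun p : (seq nat * (nat * (seq nat * seq (nat * nat)))) * (nat * seq nat) =>
    (Nil nat, (p.1.2.1, p.2.1) :: p.1.2.2.2))); pt.
- by apply: polyb_add; [exact: polyb_sz | exact: polyb_const].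
move=> s s1 s2 ->; apply: leq_trans (_ : sz s2 + 2 <= _); last by rewrite leq_add2r sz_suffix.
suff : size (foldr G (Nil nat, Nil (nat * nat)) s2).1 <= 1 /\
  sz (foldr G (Nil nat, Nil (nat * nat)) s2) <= sz s2 + 2 by case.
elim: s2 => [//|x t] /=; case: (foldr _ _ _) => [r ps] /= []; rewrite /G sz_pair sz_cons /=.
case: r => [|y r] _ le; split=> //; move: le; rewrite !sz_pair !sz_cons !sz_nil ?sz_pair /=; first lia.
by have := sz_gt0 r; lia.
Qed.

Lemma PT_unscale : PT (fun ps : seq (nat * nat) => unscale ps).
Proof. by rewrite /unscale; pt. Qed.

Lemma PT_read_facs : PT (fun p : (nat * nat) * seq nat => read_facs p.1.1 p.1.2 p.2).
Proof. by rewrite /read_facs; pt. Qed.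

Lemma PT_algorithm : PT (fun w : seq bool => algorithm w).
Proof.
have T := PT_tokens.
have V : PT (fun w : seq bool => tok_vals (tokens w)).
  rewrite /tok_vals; pt_un (fun w : seq bool => pair_up (drop 4 (tokens w))) PT_unscale.
  by pt_un (fun w : seq bool => drop 4 (tokens w)) PT_pair_up; pt.
have F : PT (fun w : seq bool => tok_facs (tokens w)).
  rewrite /tok_facs; pt_un (fun w : seq bool => ((nth 0 (tokens w) 0, nth 0 (tokens w) 1), tok_vals (tokens w))) PT_read_facs; pt.
have C : PT (fun w : seq bool => tok_clients (tokens w)) by rewrite /tok_clients; pt.
have O : PT (fun w : seq bool => tok_solve (tokens w)).
  rewrite /tok_solve; pt_un (fun w : seq bool => ((tok_facs (tokens w), nth 0 (tokens w) 1 - nth 0 (tokens w) 2), (tok_clients (tokens w), nth 0 (tokens w) 3))) PT_solve; pt.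
rewrite /algorithm; pt_un (fun w : seq bool => ((tok_clients (tokens w), tok_solve (tokens w)), nth 0 (tokens w) 1 - nth 0 (tokens w) 2)) PT_write_sol; pt.
Qed.

(** * Analysis of one run *)

Lemma foldl_search P (s : seq nat) lo : foldl (fun lo d => if P (lo + d) then lo + d else lo) lo s
  = lo + search (fun x => P (lo + x)) s.
Proof.
rewrite /search -{1}[lo]addn0; elim: s 0 => [//|d s IH] b /=.
by rewrite -addnA; case: (P _); exact: IH.
Qed.

Lemma sumn_powers T (s : seq T) : (sumn (powers s)).+1 = 2 ^ (size s).+1.
Proof.
elim: s => [//|x s IH] /=; rewrite -addnS IH size_powers !expnS; lia.
Qed.

(** Invariant: [P] holds at the current value and fails at that value plus twice the next power.
    This is an argument without monotonicity, as the use for [many] requires. *)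
Lemma search_spec T (P : nat -> bool) (s : seq T) : P 0 -> ~~ P (2 ^ (size s).+1) ->
  P (search P (powers s)) /\ ~~ P (search P (powers s)).+1.
Proof.
elim: s P => [|x s IH] P P0 Ptop; first by rewrite /search /= add0n; case: ifP => [P1|->].
rewrite {1 2}/search /= add0n size_powers -expnS; case: ifP => Px.
  rewrite foldl_search -addnS; apply: (IH (fun y => P (2 ^ (size s).+1 + y))); first by rewrite addn0.
  by rewrite addnn -mul2n -expnS.
by apply: IH => //; rewrite Px.
Qed.

Section Run.
Variables (m : nat) (fs : seq site) (q : nat).
Hypothesis rows : forall g : site, g \in fs -> size g.2.2 = m.

Definition dst (g : site) (j : nat) := nth 0 g.2.2 j.

Lemma contribE caps row T : size caps = m -> size row = m ->
  contrib caps row T = \sum_(j < m) (minn (nth 0 caps j) T - nth 0 row j).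
Proof.
move=> sc sr; rewrite /contrib sumnE big_map (big_nth (0, 0)) size_zip sc sr minnn big_mkord.
by apply: eq_bigr => j _; rewrite nth_zip ?sc ?sr.
Qed.

(* [al] are the dual values, [ga] the time at which the run stops, [Fz] the frozen clients and [E] those frozen
   before the last facility was recorded. The term [m] in [ro_pay] is the loss due to integral times. *)
Record run_ok (lam : nat) (es : seq entry) (al : 'I_m -> nat) (ga : nat) (Fz E : {set 'I_m}) : Prop := RunOk {
  ro_feas : forall g : site, g \in fs -> \sum_j (al j - dst g j) <= g.2.1 + lam;
  ro_le : forall j, al j <= ga;
  ro_len : size es <= m;
  ro_E : forall j, j \notin E -> al j = ga;
  ro_card : #|E| < q <= #|Fz|;
  ro_sub : E \subset Fz;
  ro_fs : forall e : entry, e \in es -> e.1 \in fs;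
  ro_size : forall e : entry, e \in es -> size e.2.2 = m;
  ro_mem : forall (e : entry) (j : 'I_m), e \in es -> nth false e.2.2 j = (dst e.1 j < minn (al j) e.2.1);
  ro_pay : forall e : entry, e \in es ->
    e.1.2.1 + lam <= \sum_(j : 'I_m | nth false e.2.2 j) (al j - dst e.1 j) + m;
  ro_early : forall (e : entry) (j : 'I_m), e \in behead es -> nth false e.2.2 j -> j \in E;
  ro_time : forall (e : entry) (j : 'I_m), e \in es -> nth false e.2.2 j -> al j <= e.2.1;
  ro_wit : forall j, j \in Fz -> exists2 e : entry, e \in es & dst e.1 j <= al j /\ e.2.1 = al j;
  ro_witE : forall j, j \in E -> exists2 e : entry, e \in behead es & dst e.1 j <= al j /\ e.2.1 = al j;
  ro_src : forall e : entry, e \in es -> exists2 j : 'I_m, j \in Fz & dst e.1 j <= al j /\ e.2.1 = al j;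
  ro_sorted : sorted (fun e e' : entry => e'.2.1 <= e.2.1) es }.

Section Lam.
Variables (lam : nat) (T0 : Type) (pw : seq T0).
Notation inf := (2 ^ (size pw).+1).
Hypothesis top : forall g : site, g \in fs -> g.2.1 + lam + \sum_(j < m) dst g j < inf.
Hypothesis fs0 : fs != [::].

Definition frozen (caps : seq nat) : {set 'I_m} := [set j : 'I_m | nth 0 caps j < inf].

Record jv_inv (st : seq nat * seq (site * nat)) : Prop := JvInv {
  ji_size : size st.1 = m;
  ji_len : size st.2 <= #|frozen st.1|;
  ji_cap : forall j, j < m -> nth 0 st.1 j = inf \/ nth 0 st.1 j <= last_time st.2;
  ji_last : last_time st.2 < inf;
  ji_feas : feas fs lam st.1 (last_time st.2);
  ji_sorted : sorted (fun w w' : site * nat => w'.2 <= w.2) st.2;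
  ji_fs : forall w : site * nat, w \in st.2 -> w.1 \in fs;
  ji_time : forall w : site * nat, w \in st.2 -> w.2 <= last_time st.2;
  ji_pay : forall w : site * nat, w \in st.2 -> w.1.2.1 + lam <= contrib st.1 w.1.2.2 w.2 + m;
  ji_frz : forall (w : site * nat) j, w \in st.2 -> j < m -> dst w.1 j <= w.2 -> nth 0 st.1 j <= w.2;
  ji_src : forall w : site * nat, w \in st.2 -> exists2 j, j < m & dst w.1 j <= w.2 /\ nth 0 st.1 j = w.2;
  ji_wit : forall j, j < m -> nth 0 st.1 j < inf ->
    exists2 w : site * nat, w \in st.2 & dst w.1 j <= w.2 /\ nth 0 st.1 j = w.2 }.

Lemma leq_contrib caps row T T' : T <= T' -> contrib caps row T <= contrib caps row T'.
Proof.
move=> le; rewrite /contrib; elim: (zip caps row) => //= p s IH; apply: leq_add => //.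
by lia.
Qed.

Lemma feas_le caps T T' : T <= T' -> feas fs lam caps T' -> feas fs lam caps T.
Proof.
move=> le /allP H; apply/allP => g gf; exact: leq_trans (leq_contrib _ _ le) (H g gf).
Qed.

Lemma jv_inv0 (cls : seq nat) : size cls = m -> jv_inv ([seq inf | _ <- cls], [::]).
Proof.
move=> sc; split=> //=; rewrite ?size_map ?expn_gt0 //.
- by move=> j jm; left; rewrite (nth_map 0) ?sc.
- apply/allP => g gf; rewrite contribE ?size_map ?rows // big1 //.
by move=> j jm; rewrite (nth_map 0) ?sc // ltnn.
Qed.

Lemma count_frozen caps : size caps = m -> count (fun c => c < inf) caps = #|frozen caps|.
Proof.
move=> sc; rewrite -sum1_count (big_nth 0) sc big_mkord -sum1_card.
by apply: eq_bigl => j; rewrite inE.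
Qed.

(** By [top], a client that is not frozen overpays any facility on its own at time [inf]. *)
Lemma not_feas_top caps : size caps = m -> #|frozen caps| < m -> ~~ feas fs lam caps inf.
Proof.
move=> sc lt; have [j] : exists j, j \notin frozen caps.
  by apply/existsP; rewrite -negb_forall; apply: contraL lt => /forallP H; rewrite -leqNgt -{1}(card_ord m) subset_leq_card //; apply/subsetP.
rewrite inE -leqNgt => le; case: fs fs0 top rows => // g s _ tp rw /=.
rewrite negb_and -ltnNge; apply/orP; left.
rewrite contribE ?rw ?mem_head // (bigD1 j) //=; have := tp g (mem_head _ _).
rewrite (bigD1 j) //= /dst (minn_idPr le); lia.
Qed.

(** Lowering a cap to [T] is invisible at times up to [T], so what was paid to recorded facilities
    stays paid. *)
Lemma minn_freeze (c d T x : nat) : x <= T -> minn (if (T < c) && (d <= T) then T else c) x = minn c x.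
Proof. by case: ifP => [/andP[lt _]|//]; lia. Qed.

Lemma nth_freeze caps row T j : size caps = m -> size row = m -> j < m ->
  nth 0 (freeze caps row T) j = if (T < nth 0 caps j) && (nth 0 row j <= T) then T else nth 0 caps j.
Proof. by move=> sc sr jm; rewrite (nth_map (0, 0)) ?size_zip ?sc ?sr ?minnn // nth_zip ?sc ?sr. Qed.

Lemma size_freeze caps row T : size caps = m -> size row = m -> size (freeze caps row T) = m.
Proof. by move=> sc sr; rewrite size_map size_zip sc sr minnn. Qed.

Lemma jv_stepP (st : seq nat * seq (site * nat)) : jv_inv st -> #|frozen st.1| < q -> q <= m ->
  let st' := jv_step fs lam (powers pw) q st in
  exists (g : site) T, [/\ st' = (freeze st.1 g.2.2 T, (g, T) :: st.2), jv_inv st', g \in fs, last_time st.2 <= T & #|frozen st.1| < #|frozen st'.1|].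
Proof.
move=> inv ltq qm; have ltm := leq_trans ltq qm; have sc := ji_size inv.
rewrite /= /jv_step sumn_powers count_frozen // leqNgt ltq /=.
set T := jv_time _ _ _ _; have [Tf Tn] : feas fs lam st.1 T /\ ~~ feas fs lam st.1 T.+1.
  apply: search_spec; last exact: not_feas_top.
  apply/allP => g gf; rewrite contribE ?rows // big1 //.
have leT : last_time st.2 <= T.
  by rewrite leqNgt; apply: contra Tn => lt; apply: feas_le (ji_feas inv).
have Tinf : T < inf.
  by rewrite -(sumn_powers pw) ltnS; have := search_le (feas fs lam st.1) (powers pw) 0; rewrite add0n.
case eb: (bad _ _ _ _) => [|g s].
  case/negP: Tn; apply/allP => g gf; apply: contraT => ng.
  by have : g \in bad fs lam st.1 T.+1; [rewrite mem_filter ng | rewrite eb].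
have : g \in bad fs lam st.1 T.+1 by rewrite eb mem_head.
rewrite mem_filter -ltnNge => /andP[gbad gf]; have sr := rows gf.
have Tg : contrib st.1 g.2.2 T <= g.2.1 + lam by exact: (allP Tf).
rewrite /=; exists g, T.
(* The payment of [g] grows between [T] and [T.+1], so some unfrozen client is within reach;
   freezing it is the progress of this step. *)
have [j0 jT jc] : exists2 j : 'I_m, T < nth 0 st.1 j & dst g j <= T.
  have lt := leq_ltn_trans Tg gbad; rewrite !contribE // in lt.
  have [j] : exists j : 'I_m, minn (nth 0 st.1 j) T - nth 0 g.2.2 j < minn (nth 0 st.1 j) T.+1 - nth 0 g.2.2 j.
    apply/existsP; rewrite -[X in is_true X]negbK negb_exists; apply: contraL lt => /forallP H.
    by rewrite -leqNgt leq_sum // => j _; rewrite leqNgt.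
  by move=> lt1; exists j; rewrite /dst; lia.
have nf j : j < m -> nth 0 (freeze st.1 g.2.2 T) j = if (T < nth 0 st.1 j) && (dst g j <= T) then T else nth 0 st.1 j.
  by move=> jm; rewrite nth_freeze.
have cE h x : h \in fs -> x <= T -> contrib (freeze st.1 g.2.2 T) h.2.2 x = contrib st.1 h.2.2 x.
  move=> hf xT; rewrite !contribE ?size_freeze ?rows //; apply: eq_bigr => j _.
  by rewrite nf // minn_freeze.
have lowE j x : j < m -> nth 0 st.1 j = x -> x <= T -> nth 0 (freeze st.1 g.2.2 T) j = x.
  by move=> jm e le; rewrite nf // ltnNge e le.
have mono j : j < m -> nth 0 (freeze st.1 g.2.2 T) j <= nth 0 st.1 j.
  by move=> jm; rewrite nf //; case: ifP => // /andP[lt _]; exact: ltnW.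
have wT (w : site * nat) : w \in st.2 -> w.2 <= T by move=> ws; exact: leq_trans (ji_time inv ws) leT.
have ltf : #|frozen st.1| < #|frozen (freeze st.1 g.2.2 T)|.
  apply: proper_card; apply/properP; split.
    by apply/subsetP => j; rewrite !inE => lt; exact: leq_ltn_trans (mono _ _) lt.
  exists j0; rewrite inE; first by rewrite nf // jT jc.
  by have [->|le] := ji_cap inv (ltn_ord j0); rewrite ?ltnn //; lia.
split=> //.
split=> //=; rewrite ?size_freeze //; first exact: leq_ltn_trans (ji_len inv) ltf.
- move=> j jm; rewrite nf //; case: ifP => _; first by right.
  by case: (ji_cap inv jm) => [|le]; [left | right; exact: leq_trans le leT].
- by apply/allP => h hf; rewrite cE //; exact: (allP Tf).
- rewrite path_sortedE; last by move=> x y z h1 h2; exact: leq_trans h2 h1.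
  by apply/andP; split; [apply/allP => w /wT | exact: ji_sorted inv].
- by move=> w; rewrite inE => /orP[/eqP->//|/(ji_fs inv)].
- by move=> w; rewrite inE => /orP[/eqP->//|/wT].
- move=> w; rewrite inE => /orP[/eqP->|ws] /=; last first.
    by rewrite cE ?wT //; [exact: ji_pay inv _ _ | exact: ji_fs inv _ _].
  (* [g] is overpaid at [T.+1], and one unit of time adds at most 1 per client: the loss is at most
     [m]. *)
  rewrite cE //; apply: leq_trans (ltnW gbad) _; rewrite !contribE //.
  have em : \sum_(j < m) 1 = m by rewrite sum1_card card_ord.
  by rewrite -[X in _ <= _ + X]em -big_split /=; apply: leq_sum => j _; lia.
- move=> w j; rewrite inE => /orP[/eqP->|ws] jm /= le; last first.
    exact: leq_trans (mono _ jm) (ji_frz inv ws jm le).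
  by rewrite nf // le andbT; case: ltnP.
- move=> w; rewrite inE => /orP[/eqP->|ws] /=.
    by exists j0 => //; rewrite nf // jT jc.
  by have [j jm [lj ej]] := ji_src inv ws; exists j => //; split=> //; rewrite (lowE _ _ jm ej) ?wT.
move=> j jm; rewrite nf //; case: ifP => [/andP[_ le] _|_ lt].
  by exists (g, T) => //; rewrite mem_head.
have [w ws [lw ew]] := ji_wit inv jm lt; exists w => //; by rewrite inE ws orbT.
Qed.

Hypothesis q0 : 0 < q.

(** The state [st] before the last step is exhibited as well: its frozen clients become the set [E]
    of [run_ok]. *)
Lemma jv_final (cls : seq nat) : size cls = m -> q <= m ->
  exists (st : seq nat * seq (site * nat)) (g : site) T, [/\ jv_inv st, #|frozen st.1| < q, g \in fs & last_time st.2 <= T] /\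
    [/\ jv fs lam (powers pw) q cls = (freeze st.1 g.2.2 T, (g, T) :: st.2),
    jv_inv (jv fs lam (powers pw) q cls) & q <= #|frozen (jv fs lam (powers pw) q cls).1| ].
Proof.
move=> sc qm; rewrite /jv sumn_powers.
have inv0 := jv_inv0 sc; set st0 := (_, _) in inv0 *.
have fr0 : #|frozen st0.1| = 0.
  apply: eq_card0 => j; rewrite inE (nth_map 0) ?sc // ?ltnn //.
have le0 : q <= #|frozen st0.1| + size cls by rewrite fr0 sc.
have lt0 : #|frozen st0.1| < q by rewrite fr0.
move: le0; elim: cls {sc fr0} st0 inv0 lt0 => [|x cls IH] st inv lt /=; first by rewrite addn0 leqNgt lt.
have [g [T [est inv' gf leT ltf]]] := jv_stepP inv lt qm.
move=> le; case: (ltnP #|frozen (jv_step fs lam (powers pw) q st).1| q) => lt'.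
  by apply: IH => //; apply: leq_trans le _; rewrite /= addnS -addSn leq_add2r.
exists st, g, T; set st' := jv_step _ _ _ _ _ in est inv' lt' *.
have fix_st' : jv_step fs lam (powers pw) q st' = st'.
  by rewrite /jv_step sumn_powers count_frozen ?lt' //; exact: ji_size inv'.
have -> : foldl (fun st _ => jv_step fs lam (powers pw) q st) st' cls = st' by elim: cls {IH le} => //= _ cls; rewrite fix_st'.
by split.
Qed.

Lemma run_entriesP (cls : seq nat) : size cls = m -> q <= m ->
  exists al ga Fz E, run_ok lam (run_entries fs (powers pw) q cls lam) al ga Fz E.
Proof.
move=> sc qm; have [st [g [T [[inv lt gf leT] [est inv' leq]]]]] := jv_final sc qm.
rewrite /run_entries; move: leq inv'; rewrite {}est; set st' := (_, _) => leq inv'.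
have ga_lt : T < inf := ji_last inv'.
(* The minimum gives a frozen client its cap and any other client the final time [T]. *)
exists (fun j => minn (nth 0 st'.1 j) T), T, (frozen st'.1), (frozen st.1).
have sz1 := ji_size inv; have sz' := ji_size inv'; have sr := rows gf.
have nthE (w : site * nat) (j : 'I_m) : w \in st'.2 ->
    nth false [seq p.2 < minn p.1 w.2 | p <- zip [seq minn c (last_time st'.2) | c <- st'.1] w.1.2.2] j
    = (dst w.1 j < minn (minn (nth 0 st'.1 j) T) w.2).
  move=> ws; have rw := rows (ji_fs inv' ws).
  have js : j < size (zip [seq minn c (last_time st'.2) | c <- st'.1] w.1.2.2).
    by rewrite size_zip size_map sz' rw minnn.
  have e1 : nth 0 [seq minn c (last_time st'.2) | c <- st'.1] j = minn (nth 0 st'.1 j) T.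
    by rewrite (nth_map 0) ?sz'.
  have e2 : nth (0, 0) (zip [seq minn c (last_time st'.2) | c <- st'.1] w.1.2.2) j
      = (minn (nth 0 st'.1 j) T, dst w.1 j).
    have ez : size [seq minn c (last_time st'.2) | c <- st'.1] = size w.1.2.2 by rewrite size_map rw.
    by rewrite (nth_zip _ _ _ ez) e1.
  by rewrite (nth_map (0, 0)) // e2.
have same (w : site * nat) (j : 'I_m) : w \in st.2 -> nth 0 st.1 j = w.2 -> minn (nth 0 st'.1 j) T = w.2.
  move=> ws e; have le := leq_trans (ji_time inv ws) leT.
  by rewrite /st' /= nth_freeze // e ltnNge le /=; apply/minn_idPl.
have memE (e : entry) : e \in entries st' -> exists2 w : site * nat, w \in st'.2 &
    e = (w.1, (w.2, [seq p.2 < minn p.1 w.2 | p <- zip [seq minn c (last_time st'.2) | c <- st'.1] w.1.2.2])).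
  by move=> /mapP[w ws ->]; exists w.
have wle (w : site * nat) : w \in st'.2 -> w.2 <= T by move=> ws; exact: (ji_time inv').
have mem_le (w : site * nat) (j : 'I_m) : w \in st'.2 -> dst w.1 j < minn (minn (nth 0 st'.1 j) T) w.2 -> nth 0 st'.1 j <= w.2.
  by move=> ws lj; apply: (ji_frz inv' ws) => //; lia.
split.
- move=> h hf; have := allP (ji_feas inv') _ hf; rewrite contribE ?rows //.
- by move=> j; exact: geq_minr.
- by rewrite size_map; apply: leq_trans (ji_len inv') _; rewrite -[X in _ <= X]card_ord max_card.
- move=> j; rewrite inE -leqNgt => le; rewrite /st' /= nth_freeze //.
  by case: ifP => _; [rewrite minnn | apply/minn_idPr; lia].
- by rewrite lt.
- apply/subsetP => j; rewrite !inE /st' /= nth_freeze // => lt1.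
  by case: ifP.
- by move=> e /memE[w ws ->] /=; exact: (ji_fs inv').
- by move=> e /memE[w ws ->] /=; rewrite size_map size_zip size_map sz' (rows (ji_fs inv' ws)) minnn.
- by move=> e j /memE[w ws ->] /=; exact: nthE.
- move=> e /memE[w ws ->] /=; have := ji_pay inv' ws.
  rewrite contribE ?(rows (ji_fs inv' ws)) // => /leq_trans; apply; rewrite leq_add2r.
  rewrite (bigID (fun j : 'I_m => dst w.1 j < minn (minn (nth 0 st'.1 j) T) w.2)) /=.
  rewrite [X in _ + X]big1 ?addn0; last first.
    by move=> j; rewrite -leqNgt /dst; have := wle _ ws; lia.
  rewrite (eq_bigl _ _ (fun j => nthE w j ws)); apply: leq_sum => j _.
  by rewrite /dst; have := wle _ ws; lia.
- move=> e j; rewrite /= => /mapP[w ws ->] /=; have ws' : w \in st'.2 by rewrite inE ws orbT.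
  rewrite nthE // inE => lj; apply: leq_ltn_trans (ji_last inv).
  by apply: leq_trans (ji_time inv ws); apply: (ji_frz inv ws) => //; lia.
- by move=> e j /memE[w ws ->] /=; rewrite nthE // => lj; exact: leq_trans (geq_minl _ _) (mem_le _ _ ws lj).
- move=> j; rewrite inE => lj; have [w ws [lw ew]] := ji_wit inv' (ltn_ord j) lj.
  eexists; first by apply: map_f; exact: ws.
  by have := wle _ ws; rewrite /= ew => le; rewrite (minn_idPl le).
- move=> j; rewrite inE => lj; have [w ws [lw ew]] := ji_wit inv (ltn_ord j) lj.
  eexists; first by rewrite /=; apply: map_f; exact: ws.
  by rewrite /= (same _ _ ws ew).
- move=> e /memE[w ws ->] /=; have [j jm [lw ew]] := ji_src inv' ws.
  have le := wle _ ws; exists (Ordinal jm); first by rewrite inE /= ew; lia.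
  by rewrite /= ew (minn_idPl le).
rewrite sorted_map; exact: ji_sorted inv'.
Qed.

End Lam.
End Run.

Lemma sub_card_between (T : finType) (A B : {set T}) n : A \subset B -> #|A| <= n <= #|B| ->
  exists S : {set T}, [/\ A \subset S, S \subset B & #|S| = n].
Proof.
move=> sAB /andP[lA lB]; elim: n lA lB => [|n IH] lA lB.
  by exists A; split=> //; apply/eqP; rewrite -leqn0.
move: lA; rewrite leq_eqVlt => /orP[/eqP e|lA]; first by exists A.
have [S [AS SB eS]] := IH lA (ltnW lB).
have /subsetPn[x xB xS] : ~~ (B \subset S) by apply: contraL lB => /subset_leq_card; rewrite eS -ltnNge ltnS.
exists (x |: S); split; first exact: subset_trans AS (subsetU1 _ _).
  by rewrite subUset sub1set xB.
by rewrite cardsU1 xS eS.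
Qed.

Lemma big_count1 (T : eqType) (P : seq T) (p : pred T) (F : T -> nat) x :
  count p P <= 1 -> x \in P -> p x -> \sum_(y <- P | p y) F y = F x.
Proof.
elim: P => [//|y P IH] /=; rewrite inE big_cons => le /orP[/eqP-> px|xP px].
  have c0 : count p P = 0 by move: le; rewrite px; case: (count p P).
  by rewrite px big_hasC ?addn0 // has_count c0.
have : 0 < count p P by rewrite -has_count; apply/hasP; exists x.
by case: ifP le => [_|_] le lt; [move: le => /=; lia | apply: IH].
Qed.

Lemma card_notin m (S : {set 'I_m}) : #|(fun j : 'I_m => j \notin S)| = m - #|S|.
Proof.
have -> : #|(fun j : 'I_m => j \notin S)| = #|~: S| by apply: eq_card => j; rewrite !inE.
by rewrite cardsCs setCK card_ord.
Qed.

(** The arithmetic of [primal_bound]: [c] is the connection cost, [x] the contributions, [a] the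
    values on [S] and [t] all values, [p] the opening cost, [L] and [lk] the Lagrangian terms for
    [P] and for [k], [g] the value of the outliers, [o] the cost compared with. *)
Lemma arith c x a mD p L mp t d2 o lk g md2 :
  c + 10 * x <= 10 * (a + mD) -> p + L <= x + mp -> a + g <= t + d2 -> t <= o + lk + g -> lk <= L ->
  d2 <= md2 -> c + 10 * p <= 10 * o + 10 * (mD + md2 + mp).
Proof. lia. Qed.

(** * Duality, and comparison of two runs *)

Section Duality.
Variables (m : nat) (fs : seq site) (q k : nat).
Implicit Types (S : {set 'I_m}) (al : 'I_m -> nat) (F : seq site).

Definition sol_cost F S (sg : 'I_m -> site) := \sum_(g <- F) g.2.1 + \sum_(j in S) dst (sg j) j.

(** At most [m - q] clients are outside [S], each of value at most [ga]. A client of [S] is worth at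
    most its distance plus its contribution to [sg j], and contributions to each of the at most [k]
    facilities are bounded by its cost plus [lam]. *)
Lemma weak_duality lam al ga F S sg :
  (forall g : site, g \in fs -> \sum_j (al j - dst g j) <= g.2.1 + lam) ->
  (forall j, al j <= ga) -> {subset F <= fs} -> size F <= k -> q <= #|S| ->
  (forall j, j \in S -> sg j \in F) ->
  \sum_j al j <= sol_cost F S sg + lam * k + (m - q) * ga.
Proof.
move=> feasible le sub sF qS sgF; rewrite (bigID (fun j => j \in S)) /=; apply: leq_add; last first.
  apply: (@leq_trans (\sum_(j | j \notin S) ga)); first exact: leq_sum.
  by rewrite sum_nat_const card_notin leq_mul2r leq_sub2l ?orbT.
apply: (@leq_trans (\sum_(j in S) (dst (sg j) j + \sum_(g <- F) (al j - dst g j)))).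
  apply: leq_sum => j jS; rewrite (big_rem (sg j)) ?sgF //=; lia.
rewrite big_split /= addnC /sol_cost -addnA [in X in _ <= X]addnCA [in X in _ <= X]addnC leq_add2r exchange_big /=.
apply: (@leq_trans (\sum_(g <- F) (g.2.1 + lam))).
  rewrite big_seq [X in _ <= X]big_seq; apply: leq_sum => g gF.
  apply: leq_trans (feasible g (sub _ gF)); rewrite [X in _ <= X](bigID (fun j => j \in S)) /=.
  exact: leq_addr.
by rewrite big_split /= big_const_seq count_predT iter_addn_0 leq_add2l leq_mul2l sF orbT.
Qed.

(** The facilities in [P] are paid up to [m] each, by values [be] that may come from either of two
    runs but exceed [al] by at most [D]. [S] contains all contributors, and clients left out have
    almost the value [ga], as in weak duality. Then [lam * size P] cancels [lam * k]. *)
Lemma primal_bound lam al ga D D2 S (P : seq entry) (be : entry -> 'I_m -> nat) (phi : 'I_m -> entry) F S' sg :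
  (forall g : site, g \in fs -> \sum_j (al j - dst g j) <= g.2.1 + lam) -> (forall j, al j <= ga) ->
  #|S| = q -> (forall j, j \notin S -> ga <= al j + D2) ->
  (forall e : entry, e \in P -> e.1.2.1 + lam <= \sum_(j : 'I_m | nth false e.2.2 j) (be e j - dst e.1 j) + m) ->
  (forall (e : entry) j, e \in P -> be e j <= al j + D) ->
  (forall j : 'I_m, count (fun e : entry => nth false e.2.2 j) P <= 1) ->
  (forall (e : entry) (j : 'I_m), e \in P -> nth false e.2.2 j -> j \in S) ->
  (forall j, j \in S ->
     [/\ phi j \in P, nth false (phi j).2.2 j & dst (phi j).1 j <= be (phi j) j] \/
     (forall e : entry, e \in P -> ~~ nth false e.2.2 j) /\ dst (phi j).1 j <= 10 * (al j + D)) ->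
  lam * k <= lam * size P ->
  {subset F <= fs} -> size F <= k -> q <= #|S'| -> (forall j, j \in S' -> sg j \in F) ->
  \sum_(j in S) dst (phi j).1 j + 10 * \sum_(e <- P) e.1.2.1 <=
  10 * sol_cost F S' sg + 10 * (m * (D + D2) + m * size P).
Proof.
move=> feasible le cS out pay beD disj PS cov lamP sub sF qS sgF.
have wd := weak_duality feasible le sub sF qS sgF.
have qm : q <= m by rewrite -cS -[X in _ <= X]card_ord max_card.
have out_le : \sum_(j in S) al j + (m - q) * ga <= \sum_j al j + (m - q) * D2.
  rewrite [X in _ <= X + _](bigID (fun j => j \in S)) /= -addnA leq_add2l.
  have cC : #|(fun j : 'I_m => j \notin S)| = m - q by rewrite card_notin cS.
  rewrite -[X in X * ga]cC -[X in X * D2]cC -!sum_nat_const -big_split /=.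
  exact: leq_sum.
have payS : \sum_(e <- P) (e.1.2.1 + lam) <=
    \sum_(j in S) \sum_(e <- P | nth false e.2.2 j) (be e j - dst e.1 j) + m * size P.
  rewrite (exchange_big_dep predT) //=.
  have -> : m * size P = \sum_(e <- P) m by rewrite big_const_seq count_predT iter_addn_0.
  rewrite -big_split /= big_seq [X in _ <= X]big_seq; apply: leq_sum => e eP.
  apply: leq_trans (pay e eP) _; rewrite leq_add2r (eq_bigl (fun j => (j \in S) && nth false e.2.2 j)) //.
  by move=> j /=; case ej: (nth false e.2.2 j); rewrite ?andbF // (PS e j eP ej).
(* Client by client: a contributor to [phi j] has [dst + 10 (be - dst) <= 10 be]; any other client
   contributes nothing and connects within [10 (al + D)]. *)
have conn : \sum_(j in S) dst (phi j).1 j +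
    10 * \sum_(j in S) \sum_(e <- P | nth false e.2.2 j) (be e j - dst e.1 j) <= 10 * (\sum_(j in S) al j + m * D).
  apply: (@leq_trans (\sum_(j in S) 10 * (al j + D))); last first.
    rewrite -big_distrr /= leq_mul2l /= big_split /= leq_add2l sum_nat_const cS leq_mul2r qm orbT //.
  rewrite big_distrr /= -big_split /=; apply: leq_sum => j jS.
  case: (cov j jS) => [[pP pj dle]|[none dle]].
    by rewrite (big_count1 _ (disj j) pP pj); have := beD (phi j) j pP; lia.
  by rewrite big_seq_cond big_pred0 ?muln0 ?addn0 // => e; apply/negbTE/negP => /andP[/none/negbTE->].
move: payS; rewrite big_split /= big_const_seq count_predT iter_addn_0 => payS.
have mq : (m - q) * D2 <= m * D2 by rewrite leq_mul2r leq_subr orbT.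
rewrite (mulnDr m); exact: arith conn payS out_le wd lamP mq.
Qed.

End Duality.

(** * Stability of the dual values when [lam] changes by at most 1 *)

Section Close.
Variables (m : nat) (fs : seq site) (q : nat).

(* Bound on the distance of the values of the [s] closest clients in two runs whose [lam]s differ by at most 1. *)
Fixpoint delta (s : nat) : nat := if s is s'.+1 then m.+1 + m * delta s' else 0.

Lemma delta_le s : (delta s).+1 <= m.+2 ^ s.
Proof. by elim: s => [//|s IH] /=; rewrite expnS; nia. Qed.

Lemma delta_S s : delta s <= delta s.+1.
Proof. by elim: s => [//|s IH] /=; rewrite leq_add2l leq_mul2l IH orbT. Qed.

Lemma delta_mono s t : s <= t -> delta s <= delta t.
Proof. by move=> /subnKC <-; elim: (t - s) => [|n IH]; rewrite ?addn0 // addnS; exact: leq_trans IH (delta_S _). Qed.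

Definition close (al al' : 'I_m -> nat) d j := (al j <= al' j + d) && (al' j <= al j + d).

(** The facility that froze [j] was recorded at time [al j]; its contributors were frozen by then,
    so values may be cut at [al j]. *)
Lemma witness lam es al ga Fz E (j : 'I_m) : run_ok fs q lam es al ga Fz E -> j \in Fz ->
  exists2 g : site, g \in fs & dst g j <= al j /\
    g.2.1 + lam <= \sum_(i : 'I_m) (minn (al i) (al j) - dst g i) + m.
Proof.
move=> r /(ro_wit r)[e ee [le Te]]; exists e.1; first exact: (ro_fs r).
split=> //; apply: leq_trans (ro_pay r ee) _; rewrite leq_add2r.
rewrite [X in _ <= X](bigID (fun i : 'I_m => nth false e.2.2 i)) /=; apply: leq_trans (leq_addr _ _).
by apply: leq_sum => i ie; have := ro_time r ee ie; rewrite Te => /minn_idPl ->.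
Qed.

(* One more client is close, namely one whose value is the smallest outside [D] over both runs,
   unless every frozen client is in [D]. *)
Lemma close_step lam lam' es es' al al' ga ga' Fz Fz' E E' (D : {set 'I_m}) d (j : 'I_m) :
  run_ok fs q lam es al ga Fz E -> run_ok fs q lam' es' al' ga' Fz' E' -> lam <= lam'.+1 ->
  (forall i, i \in D -> close al al' d i) -> j \notin D ->
  (forall i, i \notin D -> al' j <= al i /\ al' j <= al' i) ->
  (exists2 i, i \notin D & close al al' (m.+1 + m * d) i) \/ (forall i, close al al' d i).
Proof.
move=> r r' llam cD jD mn.
(* Let [g] have frozen [i] in the run for [lam']. In the run for [lam], clients of [D] contribute to
   [g] at most [d] less, the others no less since their values are at least [al' i], and [i] itself
   contributes [al i - al' i] more. Feasibility for [lam] bounds that excess by [m + m * d + 1]. *)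
have key i : i \notin D -> i \in Fz' -> al' i = al' j -> close al al' (m.+1 + m * d) i.
  move=> iD iF ei; have [g gf [le pay]] := witness r' iF.
  have [le1 _] := mn i iD; rewrite /close; apply/andP; split; last by rewrite ei; lia.
  have feasible := ro_feas r gf.
  have lower : \sum_(h : 'I_m) (minn (al' h) (al' i) - dst g h) + (al i - al' i) <= \sum_(h : 'I_m) (al h - dst g h) + m * d.
    rewrite (bigD1 i) //= [X in _ <= X + _](bigD1 i) //=.
    have rest : \sum_(h < m | h != i) (minn (al' h) (al' i) - dst g h) <= \sum_(h < m | h != i) (al h - dst g h) + m * d.
      apply: (@leq_trans (\sum_(h < m | h != i) ((al h - dst g h) + d))).
        apply: leq_sum => h _; case: (boolP (h \in D)) => hD.
          by have /andP[_] := cD h hD; lia.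
        by have [] := mn h hD; rewrite ei; lia.
      rewrite big_split /= leq_add2l sum_nat_const leq_mul2r.
      by apply/orP; right; rewrite -[X in _ <= X]card_ord max_card.
    rewrite addnAC -[X in _ <= X]addnA; apply: leq_add rest; rewrite minnn; move: le le1; rewrite ei; lia.
  have : g.2.1 + lam' + (al i - al' i) <= g.2.1 + lam + m * d + m.
    apply: leq_trans (leq_add pay (leqnn _)) _; rewrite addnAC leq_add2r.
    by apply: leq_trans lower _; rewrite leq_add2r.
  by lia.
case: (boolP [exists i in Fz', i \notin D]) => [/existsP[i /andP[iF iD]]|none].
  case: (boolP (j \in Fz')) => jF; first by left; exists j => //; exact: key.
  (* [j] is unfrozen, so [al' j = ga'] is maximal as well as minimal outside [D], whence
     [al' i = al' j]. *)
  left; exists i => //; apply: key => //; apply/eqP; rewrite eqn_leq (proj2 (mn i iD)) andbT.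
  by have /andP[lE lF] := ro_card r'; rewrite (ro_E r' (j := j)) ?(ro_le r') //; apply: contra jF => /(subsetP (ro_sub r')).
right=> i; have FD : Fz' \subset D.
  apply/subsetP => h hF; apply: contraR none => hD; apply/existsP; exists h; by rewrite hF hD.
case: (boolP (i \in D)) => iD; first exact: cD.
have nF h : h \notin D -> al' h = ga'.
  by move=> hD; apply: (ro_E r'); apply: contra hD => /(subsetP (ro_sub r'))/(subsetP FD).
have [le _] := mn i iD; rewrite (nF j jD) in le; rewrite /close (nF i iD).
(* [D] contains the at least [q] clients of [Fz'] while [E] has fewer than [q]. Such an [h] has
   value [ga] and, being close, ties [ga] to [ga']. *)
have [h hD hE] : exists2 h, h \in D & h \notin E.
  apply/subsetPn; apply: contraTN (subset_leq_card FD) => DE; rewrite -ltnNge.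
  have /andP[lE _] := ro_card r; have /andP[_ lF] := ro_card r'.
  exact: leq_ltn_trans (subset_leq_card DE) (leq_trans lE lF).
have /andP[c1 _] := cD h hD; rewrite (ro_E r hE) in c1.
apply/andP; split; last lia.
by have := ro_le r i; have := ro_le r' h; lia.
Qed.

Lemma closeC al al' d j : close al al' d j = close al' al d j.
Proof. exact: andbC. Qed.

Lemma close_le al al' d d' j : d <= d' -> close al al' d j -> close al al' d' j.
Proof. by rewrite /close => le /andP[? ?]; apply/andP; split; lia. Qed.

(** The set of clients known to be close grows by one at a time, always at the smallest remaining
    value; each extension costs one step of the recursion of [delta]. *)
Lemma runs_close lam lam' es es' al al' ga ga' Fz Fz' E E' :
  run_ok fs q lam es al ga Fz E -> run_ok fs q lam' es' al' ga' Fz' E' ->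
  lam <= lam'.+1 -> lam' <= lam.+1 -> forall j, close al al' (delta m) j.
Proof.
move=> r r' l1 l2.
suff H n : n <= m -> (exists2 D : {set 'I_m}, #|D| = n & forall i, i \in D -> close al al' (delta n) i)
    \/ (forall j, close al al' (delta m) j).
  case: (H m (leqnn m)) => // -[D cD H1] j; apply: H1.
  suff -> : D = setT by rewrite inE.
  by apply/eqP; rewrite eqEcard subsetT cardsT card_ord cD leqnn.
elim: n => [|n IH] lenm; first by left; exists set0 => [|i]; rewrite ?cards0 // inE.
case: (IH (ltnW lenm)) => [[D cD H1]|]; last by right.
have [j0 j0D] : exists j0, j0 \notin D.
  apply/existsP; rewrite -negb_forall; apply: contraL lenm => /forallP H.
  rewrite -leqNgt -cD -{1}(card_ord m); apply: subset_leq_card; by apply/subsetP.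
have step : (exists2 i, i \notin D & close al al' (m.+1 + m * delta n) i) \/ (forall i, close al al' (delta n) i).
  case: (arg_minnP (P := fun i => i \notin D) (fun i => minn (al i) (al' i)) j0D) => j jD mn.
  case: (leqP (al' j) (al j)) => cmp.
    by apply: (close_step r r' l1 H1 jD) => i iD; have := mn i iD; lia.
  have := close_step r' r l2 (fun i iD => etrans (closeC _ _ _ _) (H1 i iD)) jD.
  case=> [i iD|[i iD ci]|H2]; first by have := mn i iD; lia.
  - by left; exists i; rewrite // closeC.
  by right=> i; rewrite closeC.
case: step => [[i iD ci]|H2]; last by right=> i; apply: close_le (H2 i); apply/delta_mono/ltnW.
left; exists (i |: D); first by rewrite cardsU1 iD cD.
move=> h; rewrite !inE => /orP[/eqP->//|hD]; apply: close_le (H1 h hD); exact: delta_S.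
Qed.

End Close.

(** * Greedy families and links between them *)

Lemma greedy_sub es : {subset greedy es <= es}.
Proof.
elim: es => [//|e es IH] x /=; case: ifP => _; rewrite !inE; first by move/IH ->; rewrite orbT.
by case/orP => [->//|/IH->]; rewrite orbT.
Qed.

Lemma meetsP (N N' : seq bool) : size N = size N' ->
  reflect (exists j, nth false N j && nth false N' j) (meets N N').
Proof.
move=> es; apply: (iffP hasP) => [[[a b] /(nthP (false, false))[j]]|[j /andP[Nj N'j]]].
  by rewrite size_zip -es minnn => lj; rewrite nth_zip // => -[<- <-] /= H; exists j.
have lj : j < size N by rewrite ltnNge; apply: contraTN Nj => /(nth_default false)->.
exists (nth false N j, nth false N' j); last by rewrite /= Nj N'j.
by rewrite -nth_zip // mem_nth // size_zip -es minnn.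
Qed.

(** A facility is rejected only because of one that was tried before it, hence recorded no later. *)
Lemma greedy_dom (es : seq entry) : sorted (fun e e' : entry => e'.2.1 <= e.2.1) es ->
  forall e : entry, e \in es -> exists2 e' : entry, e' \in greedy es &
    e'.2.1 <= e.2.1 /\ (e' = e \/ meets e.2.2 e'.2.2).
Proof.
elim: es => [//|e0 es IH] /= so e; have tr : transitive (fun e e' : entry => e'.2.1 <= e.2.1).
  by move=> x y z h1 h2; exact: leq_trans h2 h1.
move: so; rewrite (path_sortedE tr) => /andP[/allP le so]; rewrite inE => /orP[/eqP->|ee].
  case: ifP => [/hasP[e' e'g mt]|_]; last by exists e0; rewrite ?mem_head //; split=> //; left.
  by exists e' => //; split; [apply: le; exact: greedy_sub | right].
have [e' e'g H] := IH so e ee; exists e' => //.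
by case: ifP => // _; rewrite inE e'g orbT.
Qed.

Lemma greedy_disj (es : seq entry) m (j : nat) : (forall e : entry, e \in es -> size e.2.2 = m) ->
  count (fun e : entry => nth false e.2.2 j) (greedy es) <= 1.
Proof.
elim: es => [//|e es IH] sz /=; have {}IH := IH (fun x xs => sz x (mem_behead (s := e :: es) xs)).
case: ifP => // /negbT /hasPn H /=; case ej: (nth false e.2.2 j) => //=.
rewrite (_ : count _ _ = 0) //; apply/eqP; rewrite -leqn0 leqNgt -has_count; apply/hasPn => x xg.
apply: contra (H x xg) => xj; apply/meetsP; last by exists j; rewrite ej.
by rewrite !sz ?mem_head // inE (greedy_sub xg) orbT.
Qed.

Lemma perm_kept_filler (F1 F2 : seq entry) : perm_eq (kept F1 F2 ++ filler F1 F2) F1.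
Proof.
rewrite /kept /filler -map_cat.
have e : F1 = [seq p.2 | p <- zip (indices F1) F1].
  by rewrite -[RHS]/(unzip2 _) unzip2_zip // size_iota.
rewrite [X in perm_eq _ X]e; apply: perm_map; apply: permEl.
exact: (perm_filterC (fun p : nat * entry => has (fun v => find (linked v) F1 == p.1) F2)).
Qed.

(** Distinct kept facilities have distinct electors in [F2], and electors are linked, hence not
    fresh. *)
Lemma kept_size (F1 F2 : seq entry) : size (kept F1 F2) + size (fresh F1 F2) <= size F2.
Proof.
rewrite /fresh size_filter -[X in _ <= X](count_predC (fun v => has (linked v) F1) F2) leq_add2r.
pose A := [seq p <- zip (indices F1) F1 | has (fun v => find (linked v) F1 == p.1) F2].
have -> : size (kept F1 F2) = size (unzip1 A) by rewrite !size_map.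
have -> : count (fun v => has (linked v) F1) F2 =
    size [seq find (linked v) F1 | v <- F2 & has (linked v) F1] by rewrite size_map size_filter.
apply: uniq_leq_size.
  apply: (subseq_uniq (s2 := unzip1 (zip (indices F1) F1))).
    by apply: map_subseq; exact: filter_subseq.
  by rewrite unzip1_zip ?size_iota // iota_uniq.
move=> i /mapP[[i' e]]; rewrite mem_filter /= => /andP[/hasP[v vF /eqP <-] ze] ->.
apply/mapP; exists v => //; rewrite mem_filter vF andbT has_find.
have : find (linked v) F1 \in unzip1 (zip (indices F1) F1) by apply/mapP; eexists; [exact: ze|].
by rewrite unzip1_zip ?size_iota // mem_iota.
Qed.

Lemma keptP (F1 F2 : seq entry) (v : entry) : v \in F2 -> has (linked v) F1 ->
  exists2 y : entry, y \in kept F1 F2 & linked v y.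
Proof.
move=> vF hv; pose i := find (linked v) F1; have li : i < size F1 by rewrite -has_find.
exists (nth v F1 i); last exact: nth_find.
apply/mapP; exists (i, nth v F1 i) => //; rewrite mem_filter /=; apply/andP; split.
  by apply/hasP; exists v.
have -> : (i, nth v F1 i) = nth (0, v) (zip (indices F1) F1) i.
  by rewrite nth_zip ?size_iota // nth_iota.
by rewrite mem_nth // size_zip size_iota minnn.
Qed.

(** * Merging two runs *)

Section Hybrid.
Variables (m : nat) (fs : seq site) (q k N fmax : nat).
Hypothesis rows : forall g : site, g \in fs -> size g.2.2 = m.
Hypothesis metric : forall (g h : site) (i j : 'I_m), g \in fs -> h \in fs ->
  dst g i <= dst g j + dst h j + dst h i.
Hypothesis divis : forall (g : site) (j : 'I_m), g \in fs -> N %| dst g j.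
Hypothesis fmaxP : forall g : site, g \in fs -> g.2.1 <= fmax.

(* The quality of a candidate set of facilities, measured against every solution of [fs]. *)
Definition good (err : nat) (cand : seq entry) : Prop :=
  forall (F : seq site) (S' : {set 'I_m}) (sg : 'I_m -> site),
  {subset F <= fs} -> size F <= k -> q <= #|S'| -> (forall j, j \in S' -> sg j \in F) ->
  exists (S : {set 'I_m}) (phi : 'I_m -> entry),
    [/\ #|S| = q, forall j, j \in S -> phi j \in cand &
     \sum_(j in S) dst (phi j).1 j + \sum_(e <- cand) e.1.2.1 <= 10 * sol_cost F S' sg + fmax + err].

Section Single.
Variables (lam : nat) (es : seq entry) (al : 'I_m -> nat) (ga : nat) (Fz E : {set 'I_m}).
Hypothesis r : run_ok fs q lam es al ga Fz E.

Lemma entry_dst (e : entry) (j : 'I_m) : e \in es -> nth false e.2.2 j -> dst e.1 j < al j /\ dst e.1 j < e.2.1.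
Proof. by move=> ee; rewrite (ro_mem r) //; lia. Qed.

(** Through a common contributor [i] the path from [v] to [i] to [u] to [j] has three legs, each of
    length at most [u.2.1]. *)
Lemma conflict_dst (u v : entry) (j : 'I_m) : u \in es -> v \in es -> v.2.1 <= u.2.1 ->
  v = u \/ meets u.2.2 v.2.2 -> dst u.1 j <= u.2.1 -> dst v.1 j <= 3 * u.2.1.
Proof.
move=> ue ve vu [->|mt] le; first lia.
have [i0 /andP[ui vi]] := meetsP (etrans (ro_size r ue) (esym (ro_size r ve))) mt.
have im : i0 < m by rewrite -(ro_size r ue) ltnNge; apply: contraTN ui => /(nth_default false)->.
pose i := Ordinal im; have [_ u1] := entry_dst (j := i) ue ui; have [_ v1] := entry_dst (j := i) ve vi.
have := metric j i (ro_fs r ve) (ro_fs r ue); lia.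
Qed.

Lemma behead_greedy : exists x : seq entry, greedy es = x ++ greedy (behead es) /\ size x <= 1.
Proof.
case: (es) => [|e s] /=; first by exists [::].
by case: ifP => _; [exists [::] | exists [:: e]].
Qed.

Lemma frozen_cover (j : 'I_m) : j \in Fz -> exists2 v : entry, v \in greedy es &
  v.2.1 <= al j /\ dst v.1 j <= 3 * al j.
Proof.
move=> jF; have [u ue [le Tu]] := ro_wit r jF.
have [v vg [vu H]] := greedy_dom (ro_sorted r) ue; exists v => //; rewrite -Tu.
by split=> //; apply: (conflict_dst ue (greedy_sub vg)) => //; rewrite Tu.
Qed.

Lemma greedy_size (s : seq entry) : size (greedy s) <= size s.
Proof. by elim: s => //= e s IH; case: ifP => _ //=; exact: leqW. Qed.

Lemma sorted_behead : sorted (fun e e' : entry => e'.2.1 <= e.2.1) (behead es).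
Proof. by have := ro_sorted r; case: (es) => //= e s; case: s => //= e' s /andP[]. Qed.

(** For [lam = 0] the Lagrangian terms vanish, so having fewer than [k] facilities is harmless. Only
    the latest facility, if selected, is not paid for by served clients; it costs at most [fmax]. *)
Lemma single_good : lam = 0 -> size (greedy es) <= k -> good (10 * (m * m)) (greedy es).
Proof.
move=> lam0 sk F S' sg sub sF qS sgF; have /andP[lE lF] := ro_card r.
have [S [ES SF cS]] := sub_card_between (ro_sub r) (introT andP (conj (ltnW lE) lF)).
pose P := greedy (behead es); have [x [gx sx]] := behead_greedy.
have Psub (e : entry) : e \in P -> e \in behead es by exact: greedy_sub.
have wit (j : 'I_m) : exists e : entry, j \in S -> e \in greedy es /\
     ([/\ e \in P, nth false e.2.2 j & dst e.1 j <= al j] \/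
     (forall e : entry, e \in P -> ~~ nth false e.2.2 j) /\ dst e.1 j <= 10 * (al j + 0)).
  case: (boolP (has (fun e : entry => nth false e.2.2 j) P)) => [/hasP[e eP ej]|/hasPn none].
    exists e => _; rewrite gx mem_cat eP orbT; split=> //; left; split=> //.
    by have [] := entry_dst (mem_behead (Psub e eP)) ej; lia.
  case: (boolP (j \in S)) => jS; last by exists ((0, (0, [::])), (0, [::])).
  have [v vg [_ le]] := frozen_cover (subsetP SF _ jS).
  by exists v => _; split=> //; right; split=> //; lia.
have [phi phiP] := fin_all_exists wit.
exists S, phi; split=> // [j jS|]; first by have [] := phiP j jS.
have := @primal_bound m fs q k lam al ga 0 0 S P (fun _ => al) phi F S' sg (ro_feas r) (ro_le r) cS.
have H1 j : j \notin S -> ga <= al j + 0.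
  by move=> jS; rewrite addn0 (ro_E r) //; apply: contra jS => /(subsetP ES).
have H2 (e : entry) : e \in P -> e.1.2.1 + lam <= \sum_(j : 'I_m | nth false e.2.2 j) (al j - dst e.1 j) + m.
  by move=> /Psub/mem_behead; exact: ro_pay r e.
have H3 (j : 'I_m) : count (fun e : entry => nth false e.2.2 j) P <= 1.
  by apply: (greedy_disj (m := m)) => e /mem_behead; exact: (ro_size r).
have H4 (e : entry) (j : 'I_m) : e \in P -> nth false e.2.2 j -> j \in S.
  by move=> /Psub eP ej; apply: (subsetP ES); exact: (ro_early r eP ej).
have H5 j : j \in S -> [/\ phi j \in P, nth false (phi j).2.2 j & dst (phi j).1 j <= al j] \/
     (forall e : entry, e \in P -> ~~ nth false e.2.2 j) /\ dst (phi j).1 j <= 10 * (al j + 0).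
  by move=> jS; have [] := phiP j jS.
move=> /(_ H1 H2 (fun e j _ => leq_addr 0 (al j)) H3 H4 H5).
rewrite lam0 !mul0n leqnn => /(_ isT sub sF qS sgF) main.
have sP : m * size P <= m * m.
  rewrite leq_mul2l; apply/orP; right; apply: leq_trans (ro_len r).
  by apply: leq_trans (greedy_size _) _; rewrite size_behead leq_pred.
have fx : \sum_(e <- x) e.1.2.1 <= fmax.
  case: (x) gx sx => [|e [|]] //; rewrite ?big_nil // big_seq1 => gx _.
  by apply/fmaxP/(ro_fs r)/(@greedy_sub es); rewrite gx mem_head.
rewrite gx big_cat /=; move: main sP fx; rewrite -/P add0n muln0 add0n.
move: (\sum_(j in S) _) (\sum_(e <- x) _) (\sum_(e <- P) _) => a b c; lia.
Qed.

End Single.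

Section Mix.
Variables (lam : nat) (es1 es2 : seq entry) (al1 al2 : 'I_m -> nat) (ga1 ga2 : nat) (Fz1 Fz2 E1 E2 : {set 'I_m}).
Hypothesis r1 : run_ok fs q lam es1 al1 ga1 Fz1 E1.
Hypothesis r2 : run_ok fs q lam.+1 es2 al2 ga2 Fz2 E2.
Notation D := (delta m m).
Hypothesis DN : 7 * D <= N.
Hypothesis N0 : 0 < N.
Hypothesis k0 : 0 < k.
Notation F1 := (greedy (behead es1)).
Notation F2 := (greedy es2).
Hypothesis kF1 : k <= size F1.
Hypothesis kF2 : size F2 <= k.

Lemma al_close j : al1 j <= al2 j + D /\ al2 j <= al1 j + D.
Proof. by have /andP[] := runs_close r1 r2 (leqW (leqnSn _)) (leqnn _) j. Qed.

Lemma ga_close : ga1 <= ga2 + D.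
Proof.
have [j jF jE] : exists2 j, j \in Fz1 & j \notin E1.
  by apply/subsetPn; have /andP[lE lF] := ro_card r1; apply: contraTN lE => /subset_leq_card; lia.
by have := ro_E r1 jE; have [] := al_close j; have := ro_le r2 j; lia.
Qed.

Lemma F1_es (e : entry) : e \in F1 -> e \in behead es1. Proof. exact: greedy_sub. Qed.
Lemma F1_es1 (e : entry) : e \in F1 -> e \in es1. Proof. by move/F1_es/mem_behead. Qed.
Lemma F2_es (e : entry) : e \in F2 -> e \in es2. Proof. exact: greedy_sub. Qed.

Lemma linkedI (v f : entry) (j : 'I_m) : v \in es2 -> f \in es1 ->
  dst v.1 j + dst f.1 j <= 7 * v.2.1 -> linked v f.
Proof.
move=> ve fe le; apply/hasP; exists (dst v.1 j, dst f.1 j) => //.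
have [sv sf] := (rows (ro_fs r2 ve), rows (ro_fs r1 fe)).
by rewrite /dst -nth_zip ?sv ?sf // mem_nth // size_zip sv sf minnn.
Qed.

Lemma linkedE (v f : entry) : v \in es2 -> f \in es1 -> linked v f ->
  exists j : 'I_m, dst v.1 j + dst f.1 j <= 7 * v.2.1.
Proof.
move=> ve fe /hasP[[a b] /(nthP (0, 0))[j]].
have [sv sf] := (rows (ro_fs r2 ve), rows (ro_fs r1 fe)).
by rewrite size_zip sv sf minnn => jm; rewrite nth_zip ?sv ?sf // => -[<- <-]; exists (Ordinal jm).
Qed.

(* Distances are multiples of [N], which absorbs the tolerance when the time of [v] is tiny. *)
Lemma absorb (v f : entry) (j : 'I_m) : v \in es2 -> f \in es1 ->
  dst v.1 j + dst f.1 j <= 4 * v.2.1 + 3 * D -> linked v f.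
Proof.
move=> ve fe le; apply: (linkedI (j := j)) => //.
case: (leqP D v.2.1) => cmp; first lia.
have : N %| dst v.1 j + dst f.1 j by rewrite dvdn_add // divis // ?(ro_fs r2 ve) // (ro_fs r1 fe).
rewrite dvdn_eq => /eqP e; have : (dst v.1 j + dst f.1 j) %/ N = 0 by apply: divn_small; lia.
by move=> z; rewrite z mul0n in e; lia.
Qed.

(** A client [j] that caused [v] has value at most [v.2.1 + D] in the first run, so it was frozen
    there before the last facility. It reaches a member of [F1] within three times that value: this
    is the bound of [absorb]. *)
Lemma early_linked (v : entry) : v \in F2 -> v.2.1 + D < ga1 -> has (linked v) F1.
Proof.
move=> vF lt; have ve := F2_es vF; have [j jF [le Tv]] := ro_src r2 ve.
have [c1 c2] := al_close j.
have jE : j \in E1 by apply: contraLR lt => /(ro_E r1) e; lia.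
have [u ue [leu Tu]] := ro_witE r1 jE.
have [f fF [fu H]] := greedy_dom (sorted_behead r1) ue.
apply/hasP; exists f => //; apply: (absorb (j := j)); rewrite ?F1_es1 //.
have := conflict_dst r1 (mem_behead ue) (F1_es1 fF) fu H (j := j); rewrite Tu => /(_ leu); lia.
Qed.

(** A common contributor would be within [v.2.1] of [v] and within [v.2.1 + D] of [f], which links
    them. *)
Lemma unlinked_disj (v f : entry) (j : 'I_m) : v \in F2 -> f \in F1 -> ~~ linked v f ->
  ~~ (nth false v.2.2 j && nth false f.2.2 j).
Proof.
move=> vF fF; apply: contra => /andP[vj fj]; have [ve fe] := (F2_es vF, F1_es1 fF).
apply: (absorb (j := j)) => //; have [v1 v2] := entry_dst r2 ve vj; have [f1 f2] := entry_dst r1 fe fj.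
by have [] := al_close j; have := ro_time r2 ve vj; lia.
Qed.

Notation X := (fresh F1 F2).
Notation Y := (kept F1 F2).
Notation Z := (filler F1 F2).

Lemma Y_F1 (e : entry) : e \in Y -> e \in F1.
Proof. by move=> eY; rewrite -(perm_mem (perm_kept_filler F1 F2)) mem_cat eY. Qed.
Lemma Z_F1 (e : entry) : e \in Z -> e \in F1.
Proof. by move=> eZ; rewrite -(perm_mem (perm_kept_filler F1 F2)) mem_cat eZ orbT. Qed.
Lemma X_F2 (e : entry) : e \in X -> e \in F2.
Proof. by rewrite mem_filter => /andP[]. Qed.

(** The path goes from [j] to [v], at most 3 times the value, and then along the link, at most 7
    times. *)
Lemma linked_cover (v : entry) (j : 'I_m) : v \in F2 -> has (linked v) F1 -> v.2.1 <= al2 j ->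
  dst v.1 j <= 3 * al2 j -> exists2 y : entry, y \in Y & dst y.1 j <= 10 * (al1 j + D).
Proof.
move=> vF lk Tv le; have [y yY ly] := keptP vF lk; exists y => //.
have [i li] := linkedE (F2_es vF) (F1_es1 (Y_F1 yY)) ly.
have := metric j i (ro_fs r1 (F1_es1 (Y_F1 yY))) (ro_fs r2 (F2_es vF)).
by have [] := al_close j; lia.
Qed.

Lemma late_cover (j : 'I_m) : j \in Fz2 -> exists2 y : entry, y \in Y ++ X & dst y.1 j <= 10 * (al1 j + D).
Proof.
move=> jF; have [v vF [Tv le]] := frozen_cover r2 jF.
case: (boolP (has (linked v) F1)) => lk.
  by have [y yY ly] := linked_cover vF lk Tv le; exists y; rewrite // mem_cat yY.
exists v; first by rewrite mem_cat mem_filter lk vF orbT.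
by have [] := al_close j; lia.
Qed.

(** The margin [2 * D] makes [j] frozen early in the second run too, and the facility [v] near it
    early enough for [early_linked]. *)
Lemma early_cover (j : 'I_m) : al1 j + 2 * D < ga1 -> exists2 y : entry, y \in Y & dst y.1 j <= 10 * (al1 j + D).
Proof.
move=> lt; have [c1 c2] := al_close j; have gc := ga_close.
have jE : j \in E2 by apply: contraLR lt => /(ro_E r2) e; lia.
have [v vF [Tv le]] := frozen_cover r2 (subsetP (ro_sub r2) _ jE).
by apply: linked_cover le => //; apply: early_linked => //; lia.
Qed.

Definition paid s := Y ++ take s X ++ take (k - size Y - s) Z.
(* The clients that any service analysed with the facilities [paid s] has to include. *)
Definition must s : {set 'I_m} :=
  [set j : 'I_m | (al1 j + 2 * D < ga1) || has (fun e : entry => nth false e.2.2 j) (paid s)].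

Lemma size_YX : size Y + size X <= k.
Proof. exact: leq_trans (kept_size _ _) kF2. Qed.

Lemma size_paid s : s <= size X -> size (paid s) = k.
Proof.
move=> sX; have := perm_size (perm_kept_filler F1 F2); rewrite size_cat => sYZ.
rewrite /paid !size_cat !size_take_min (minn_idPl sX); move: size_YX kF1 sX; rewrite -sYZ.
by move: (size X) (size Y) (size Z) => a b c; lia.
Qed.

Lemma paidP s (e : entry) : e \in paid s -> e \in F1 \/ e \in X.
Proof.
rewrite !mem_cat => /or3P[/Y_F1|/mem_take|/mem_take/Z_F1]; by [left | right].
Qed.

(* The dual value by which [e] was paid: that of the run it comes from. *)
Definition be (e : entry) (j : 'I_m) := if e \in F1 then al1 j else al2 j.

Lemma be_le e j : be e j <= al1 j + D.
Proof. by rewrite /be; case: ifP => _; [exact: leq_addr | have [] := al_close j]. Qed.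

Lemma paid_pay s (e : entry) : e \in paid s ->
  e.1.2.1 + lam <= \sum_(j : 'I_m | nth false e.2.2 j) (be e j - dst e.1 j) + m.
Proof.
rewrite /be => /paidP eP; case: (boolP (e \in F1)) eP => [eF1 _|_ [//|/X_F2/F2_es ee]].
  exact: (ro_pay r1 (F1_es1 eF1)).
by apply: leq_trans (ro_pay r2 ee); rewrite leq_add2l.
Qed.

Lemma cover_dst (e : entry) (j : 'I_m) : e \in F1 \/ e \in X -> nth false e.2.2 j -> dst e.1 j <= be e j.
Proof.
rewrite /be; case: (boolP (e \in F1)) => [eF1 _|_ [//|/X_F2/F2_es ee]] ej.
  by have [] := entry_dst r1 (F1_es1 eF1) ej; lia.
by have [] := entry_dst r2 ee ej; lia.
Qed.

(** Within each family greediness separates the contributors; across the families, the absence of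
    links does. *)
Lemma paid_disj s (j : 'I_m) : count (fun e : entry => nth false e.2.2 j) (paid s) <= 1.
Proof.
set p := fun e : entry => _.
have c1 : count p F1 <= 1.
  by apply: (greedy_disj (m := m)) => e /mem_behead; exact: (ro_size r1).
have c2 : count p X <= 1.
  apply: leq_trans (_ : count p F2 <= 1); first by rewrite count_filter; apply: sub_count => e /andP[].
  by apply: (greedy_disj (m := m)) => e; exact: (ro_size r2).
have tk n (s' : seq entry) : count p (take n s') <= count p s'.
  by rewrite -[X in _ <= count p X](cat_take_drop n) count_cat leq_addr.
have le : count p (paid s) <= count p F1 + count p X.
  rewrite /paid !count_cat -(seq.permP (perm_kept_filler F1 F2)) count_cat.
  rewrite -addnA leq_add2l addnC; exact: leq_add.
apply: leq_trans le _; case: (posnP (count p X)) => [->|]; first by rewrite addn0.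
rewrite -has_count => /hasP[v vX vj].
rewrite (_ : count p F1 = 0) //; apply/eqP; rewrite -leqn0 leqNgt -has_count; apply/hasPn => f fF.
have : ~~ linked v f by move: vX; rewrite mem_filter => /andP[/hasPn H _]; exact: H.
by move=> /(unlinked_disj j (X_F2 vX) fF); move: vj; rewrite /p => ->.
Qed.

(** For [s = 0] only facilities of the first run are paid for, the latest excluded, so all clients
    concerned lie in [E1]. *)
Lemma must0 : #|must 0| < q.
Proof.
have /andP[lE _] := ro_card r1; apply: leq_ltn_trans lE; apply: subset_leq_card; apply/subsetP => j.
rewrite inE => /orP[lt|/hasP[e]]; first by apply: contraLR lt => /(ro_E r1) ->; lia.
rewrite /paid take0 /= mem_cat => eP; apply: (ro_early r1).
by apply: F1_es; case/orP: eP => [/Y_F1|/mem_take/Z_F1].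
Qed.

(** The dual accounting covers the [k] facilities of [paid s]; what [cand] opens beyond them is
    charged to [fmax]. *)
Lemma finish s cand (S : {set 'I_m}) : s <= size X ->
  {subset paid s <= cand} -> (forall e : entry, e \in cand -> e \in F1 \/ e \in X) ->
  must s \subset S -> #|S| = q ->
  (forall j, j \in S -> exists2 e : entry, e \in cand & dst e.1 j <= 10 * (al1 j + D)) ->
  \sum_(e <- cand) e.1.2.1 <= \sum_(e <- paid s) e.1.2.1 + fmax ->
  good (10 * (m * (D + 2 * D) + m * m)) cand.
Proof.
move=> sX Pc candP AS cS cov fsum F S' sg sub sF qS sgF.
have wit (j : 'I_m) : exists e : entry, j \in S -> e \in cand /\
     ([/\ e \in paid s, nth false e.2.2 j & dst e.1 j <= be e j] \/
     (forall e : entry, e \in paid s -> ~~ nth false e.2.2 j) /\ dst e.1 j <= 10 * (al1 j + D)).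
  case: (boolP (has (fun e : entry => nth false e.2.2 j) (paid s))) => [/hasP[e eP ej]|/hasPn none].
    exists e => _; split; first exact: Pc; left; split=> //.
    by apply: cover_dst => //; exact: paidP eP.
  case: (boolP (j \in S)) => jS; last by exists ((0, (0, [::])), (0, [::])).
  by have [v vc le] := cov j jS; exists v => _; split=> //; right.
have [phi phiP] := fin_all_exists wit.
exists S, phi; split=> // [j jS|]; first by have [] := phiP j jS.
have := @primal_bound m fs q k lam al1 ga1 D (2 * D) S (paid s) be phi F S' sg (ro_feas r1) (ro_le r1) cS.
have H1 j : j \notin S -> ga1 <= al1 j + 2 * D.
  by move=> jS; rewrite leqNgt; apply: contra jS => lt; apply: (subsetP AS); rewrite inE lt.
have H4 (e : entry) (j : 'I_m) : e \in paid s -> nth false e.2.2 j -> j \in S.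
  by move=> eP ej; apply: (subsetP AS); rewrite inE; apply/orP; right; apply/hasP; exists e.
have H5 j : j \in S -> [/\ phi j \in paid s, nth false (phi j).2.2 j & dst (phi j).1 j <= be (phi j) j] \/
     (forall e : entry, e \in paid s -> ~~ nth false e.2.2 j) /\ dst (phi j).1 j <= 10 * (al1 j + D).
  by move=> jS; have [] := phiP j jS.
move=> /(_ H1 (@paid_pay s) (fun e j _ => be_le e j) (paid_disj s) H4 H5).
rewrite size_paid // leqnn => /(_ isT sub sF qS sgF) main.
have km : k <= m.
  apply: leq_trans kF1 _; apply: leq_trans (ro_len r1).
  by apply: leq_trans (greedy_size _) _; rewrite size_behead leq_pred.
have sP : m * k <= m * m by rewrite leq_mul2l km orbT.
move: main sP fsum; move: (\sum_(j in S) _) (\sum_(e <- cand) _) (\sum_(e <- paid s) _) => a b c; lia.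
Qed.

Lemma must_step : (#|must (size X)| <= q) \/ exists2 s, s < size X & #|must s| <= q < #|must s.+1|.
Proof.
suff H n : (#|must n| <= q) \/ exists2 s, s < n & #|must s| <= q < #|must s.+1| by exact: H.
elim: n => [|n [IH|[s sn H]]]; first by left; exact: ltnW must0.
  by case: (leqP #|must n.+1| q) => lt; [left | right; exists n; rewrite ?IH].
by right; exists s => //; exact: leqW.
Qed.

Lemma mix_good : exists2 cand : seq entry, cand \in mix k F1 F2 &
  [/\ cand != [::], size cand <= k.+1, (forall e : entry, e \in cand -> e.1 \in fs) &
    good (10 * (m * (D + 2 * D) + m * m)) cand].
Proof.
have nn s (c : seq entry) : s <= size X -> {subset paid s <= c} -> c != [::].
  move=> sX Pc; have := size_paid sX; case: (paid s) Pc => [|e t] Pc; first by move: k0; case: (k).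
  by have := Pc e (mem_head _ _); case: (c).
have bfs (c : seq entry) : (forall e : entry, e \in c -> e \in F1 \/ e \in X) -> forall e : entry, e \in c -> e.1 \in fs.
  by move=> H e /H[/F1_es1|/X_F2/F2_es]; [exact: ro_fs r1 e | exact: ro_fs r2 e].
have mixI s : s <= size X -> blend k Y X Z s \in mix k F1 F2.
  move=> sX; apply: map_f; rewrite inE mem_iota add0n /=; case: ltngtP sX => //.
have bP s (e : entry) : e \in blend k Y X Z s -> e \in F1 \/ e \in X.
  rewrite !mem_cat => /or3P[/Y_F1|/mem_take|/mem_take/Z_F1]; by [left | right].
have /andP[_ lF2] := ro_card r2.
case: must_step => [le|[s sX /andP[le lt]]].
  (* All fresh facilities are open. With [Y] they cover [Fz2], which provides enough further clients
     to serve exactly [q]. *)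
  have eb : blend k Y X Z (size X) = paid (size X) by rewrite /blend /paid take_oversize ?leqnSn // take_size.
  exists (paid (size X)); first by rewrite -eb; exact: mixI.
  have le2 : q <= #|must (size X) :|: Fz2| by apply: leq_trans lF2 (subset_leq_card (subsetUr _ _)).
  have [S [AS SB cS]] := sub_card_between (subsetUl _ _) (introT andP (conj le le2)).
  split; [exact: (nn (size X)) | by rewrite size_paid // leqnSn | |].
    by apply: bfs => e; exact: paidP.
  apply: (finish (s := size X) (S := S)) => //; first by move=> e; exact: paidP.
    move=> j /(subsetP SB); rewrite in_setU inE => /orP[/orP[/early_cover[y yY ly]|/hasP[e eP ej]]|/late_cover[y yX ly]].
    - by exists y; rewrite // mem_cat yY.
    - exists e => //; apply: leq_trans (cover_dst (paidP eP) ej) _.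
      by have := be_le e j; lia.
    by exists y => //; rewrite /paid take_size catA mem_cat yX.
  exact: leq_addr.
(* [must] passes [q] between [s] and [s.+1]. As the facilities paid for in both cases are open,
   clients of [must s.+1] can be added to [must s] until [q] are served. *)
exists (blend k Y X Z s); first exact/mixI/ltnW.
have sub1 : {subset paid s <= blend k Y X Z s}.
  move=> e; rewrite !mem_cat => /or3P[->//|eX|->]; rewrite ?orbT //.
  by rewrite (take_nth e sX) mem_rcons inE eX !orbT.
have sub2 : {subset paid s.+1 <= blend k Y X Z s}.
  move=> e; rewrite !mem_cat => /or3P[->//|->|eZ]; rewrite ?orbT //; apply/or3P/Or33.
  move: eZ; rewrite subnS -(@take_takel _ _ (k - size Y - s)) ?leq_pred //; exact: mem_take.
have le2 : q <= #|must s :|: must s.+1|.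
  by apply: leq_trans (ltnW lt) (subset_leq_card (subsetUr _ _)).
have [S [AS SB cS]] := sub_card_between (subsetUl _ _) (introT andP (conj le le2)).
split; [exact: (nn s) (ltnW sX) sub1 | | by apply: bfs => e; exact: bP |].
  rewrite !size_cat !size_take_min; have := size_YX; lia.
apply: (finish (s := s) (S := S)) => //; first exact: ltnW.
- by move=> e; exact: bP.
- have one s' (j : 'I_m) : {subset paid s' <= blend k Y X Z s} -> j \in must s' ->
      exists2 e : entry, e \in blend k Y X Z s & dst e.1 j <= 10 * (al1 j + D).
    move=> sb; rewrite inE => /orP[/early_cover[y yY ly]|/hasP[e eP ej]].
      by exists y; rewrite // mem_cat yY.
    exists e; first exact: sb; apply: leq_trans (cover_dst (paidP eP) ej) _.
    by have := be_le e j; lia.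
  by move=> j /(subsetP SB); rewrite in_setU => /orP[]; [exact: one | exact: one].
have xX : nth ((0, (0, [::])), (0, [::])) X s \in X by exact: mem_nth.
rewrite /blend /paid (take_nth ((0, (0, [::])), (0, [::])) sX) -cats1 !big_cat /= big_seq1.
have := fmaxP (ro_fs r2 (F2_es (X_F2 xX))).
move: (\sum_(e <- Y) _) (\sum_(e <- take s X) _) (\sum_(e <- take _ Z) _) => a b c; lia.
Qed.

End Mix.
End Hybrid.

(** * The best candidate *)

Lemma near_spec (O : seq site) j : O != [::] ->
  (exists2 g : site, g \in O & near O j = (dst g j, g.1)) /\ (forall g : site, g \in O -> (near O j).1 <= dst g j).
Proof.
case: O => // h O _; rewrite /near [head _ _]/=.
have H s : {subset s <= h :: O} ->
    (exists2 g : site, g \in h :: O & foldr (fun g acc => if acc.1 <= nth 0 g.2.2 j then acc else (nth 0 g.2.2 j, g.1)) (nth 0 h.2.2 j, h.1) s = (dst g j, g.1)) /\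
    (forall g : site, g \in s -> (foldr (fun (g : site) acc => if acc.1 <= nth 0 g.2.2 j then acc else (nth 0 g.2.2 j, g.1)) (nth 0 h.2.2 j, h.1) s).1 <= dst g j).
  elim: s => [_|g s IH sub] /=; first by split=> //; exists h; rewrite ?mem_head.
  have [[g' g'O e] le] := IH (fun x xs => sub x (mem_behead (s := g :: s) xs)).
  case: ifP => [cmp|/negbT]; rewrite -?ltnNge.
    split=> [|g0]; first by exists g'.
    by rewrite inE => /orP[/eqP->|/le].
  move=> lt; split=> [|g0]; first by exists g => //; apply: sub; exact: mem_head.
  by rewrite inE => /orP[/eqP->|/le le0] //=; apply: leq_trans (ltnW lt) le0.
exact: H.
Qed.

(** * Serving the [q] nearest clients *)

Section Rank.
Variables (m q : nat) (d : 'I_m -> nat).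
Hypothesis qm : q <= m.
Definition key (j : 'I_m) := d j * m + j.
Definition first_q : {set 'I_m} := [set j | #|[set i | key i < key j]| < q].

Lemma key_inj : injective key.
Proof.
move=> i j e; apply: ord_inj; have m0 : 0 < m by apply: leq_trans (ltn_ord i).
have := congr1 (modn^~ m) e; rewrite /key !modnMDl !modn_small //.
Qed.

Lemma key_leq i j : key i <= key j -> d i <= d j.
Proof. rewrite /key => le; have := ltn_ord i; have := ltn_ord j; nia. Qed.

Lemma first_q_lt i j : i \in first_q -> j \notin first_q -> key i < key j.
Proof.
rewrite !inE -leqNgt => li; rewrite ltnNge; apply: contraL => le; rewrite -ltnNge.
by apply: leq_ltn_trans li; apply/subset_leq_card/subsetP => x; rewrite !inE => /leq_trans; apply.
Qed.

Lemma card_first_q : #|first_q| = q.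
Proof.
apply/eqP; rewrite eqn_leq; apply/andP; split.
  have [->|[j0 j0F]] := set_0Vmem first_q; first by rewrite cards0.
  have [j jF jmax] := arg_maxnP (P := mem first_q) key j0F.
  apply: leq_trans (_ : #|j |: [set i | key i < key j]| <= q).
    apply/subset_leq_card/subsetP => i iF; have := jmax i iF; rewrite /geq /= => le.
    by rewrite !inE ltn_neqAle le andbT (inj_eq key_inj); case: eqP.
  by rewrite cardsU1 !inE ltnn /=; move: (jF : j \in first_q); rewrite inE.
case: (boolP [exists j, j \notin first_q]) => [/existsP[j0 j0F]|].
  have [j jF jmin] := arg_minnP (P := [pred j | j \notin first_q]) key j0F.
  move: (jF); rewrite inE [j \in _]inE -leqNgt => /leq_trans; apply.
  apply/subset_leq_card/subsetP => i; rewrite [i \in [set _ | _]]inE ltnNge; apply: contraR => iF.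
  exact: jmin.
rewrite negb_exists => /forallP all; rewrite (_ : first_q = setT) ?cardsT ?card_ord //.
by apply/setP => j; rewrite in_setT; have := all j; rewrite negbK.
Qed.

(** Exchange: the clients only in [first_q] and those only in [S] are equally many, and each of the
    former is at most as far as each of the latter. *)
Lemma first_q_min (S : {set 'I_m}) : #|S| = q -> \sum_(j in first_q) d j <= \sum_(j in S) d j.
Proof.
move=> cS; rewrite (big_setID S) [X in _ <= X](big_setID first_q) /= setIC leq_add2l.
have eqc : #|first_q :\: S| = #|S :\: first_q|.
  by apply/eqP; rewrite -(eqn_add2l #|first_q :&: S|) cardsID setIC cardsID card_first_q cS.
have [->|[j0 j0F]] := set_0Vmem (first_q :\: S); first by rewrite big_set0.
have [j jF jmax] := arg_maxnP (P := mem (first_q :\: S)) d j0F.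
apply: leq_trans (_ : #|first_q :\: S| * d j <= _).
  by rewrite -sum_nat_const; apply: leq_sum => i /jmax.
rewrite eqc -sum_nat_const; apply: leq_sum => i; move: (jF : j \in _ :\: _); rewrite !in_setD.
by case/andP=> _ j1 /andP[i1 _]; apply/key_leq/ltnW/first_q_lt.
Qed.

End Rank.

Section Serve.
Variables (m q : nat) (O : seq site).
Hypothesis qm : q <= m.
Notation cls := (iota 0 m).

Lemma iota_index : cls = index_iota 0 m.
Proof. by rewrite /index_iota subn0. Qed.

Lemma servesE (j : 'I_m) : serves cls O q j = (j \in first_q q (fun j : 'I_m => (near O j).1)).
Proof.
rewrite /serves /keys inE count_map size_iota -sum1_count iota_index.
rewrite (big_mkord (fun i => (near O i).1 * m + i < (near O j).1 * m + j) (fun=> 1)) -sum1_card.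
by congr (_ < _); apply: eq_bigl => i; rewrite inE.
Qed.

Lemma cost_of_le (S : {set 'I_m}) (phi : 'I_m -> site) : O != [::] -> #|S| = q ->
  (forall j, j \in S -> phi j \in O) ->
  cost_of cls q O <= \sum_(g <- O) g.2.1 + \sum_(j in S) dst (phi j) j.
Proof.
move=> O0 cS phiO; rewrite /cost_of sumnE big_map leq_add2l sumnE big_map.
have -> : \sum_(j <- cls) (if serves cls O q j then (near O j).1 else 0) =
    \sum_(j in first_q q (fun j : 'I_m => (near O j).1)) (near O j).1.
  rewrite [RHS]big_mkcond /= {1}iota_index big_mkord.
  by apply: eq_bigr => j _; rewrite servesE.
apply: leq_trans (first_q_min (fun j : 'I_m => (near O j).1) qm cS) _; apply: leq_sum => j jS.
by have [_] := near_spec j O0; apply; exact: phiO.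
Qed.

End Serve.

Lemma behead_greedy_size (s : seq entry) : size (greedy s) <= (size (greedy (behead s))).+1.
Proof. by have [x [-> sx]] := behead_greedy s; rewrite size_cat -addn1 addnC leq_add2l. Qed.

Lemma leq_sum_seq (T : eqType) (s t : seq T) (F : T -> nat) : uniq s -> {subset s <= t} ->
  \sum_(x <- s) F x <= \sum_(x <- t) F x.
Proof.
elim: s t => [|x s IH] t /=; first by rewrite big_nil.
move=> /andP[xs us] sub; rewrite big_cons [X in _ <= X](big_rem x) ?sub ?mem_head //= leq_add2l.
apply: IH => // y ys; have := sub y (mem_behead (s := x :: s) ys).
by rewrite (perm_mem (perm_to_rem (sub x (mem_head _ _)))) inE => /orP[/eqP e|//]; rewrite -e ys in xs.
Qed.

(** * The critical multiplier *)

Section Guess.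
Variables (m : nat) (fs : seq site) (q k fmax : nat) (cls : seq nat) (N : nat) (lb tb : seq bool).
Hypothesis rows : forall g : site, g \in fs -> size g.2.2 = m.
Hypothesis metric : forall (g h : site) (i j : 'I_m), g \in fs -> h \in fs ->
  dst g i <= dst g j + dst h j + dst h i.
Hypothesis divis : forall (g : site) (j : 'I_m), g \in fs -> N %| dst g j.
Hypothesis fmaxP : forall g : site, g \in fs -> g.2.1 <= fmax.
Hypothesis DN : 7 * delta m m <= N.
Hypothesis N0 : 0 < N.
Hypothesis k0 : 0 < k.
Hypothesis fs0 : fs != [::].
Hypothesis q0 : 0 < q.
Hypothesis qm : q <= m.
Hypothesis scls : size cls = m.
Hypothesis small : forall g : site, g \in fs -> m.+1 * (g.2.1 + \sum_(j < m) dst g j).+1 <= 2 ^ (size lb).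
Hypothesis large : 3 * 2 ^ (size lb).+1 <= 2 ^ (size tb).+1.

Lemma cand_good : exists2 cand : seq entry, cand \in cand_sets fs (powers tb) q cls k (powers lb) &
  [/\ cand != [::], size cand <= k.+1, (forall e : entry, e \in cand -> e.1 \in fs) &
    good m fs q k fmax (10 * (m * (3 * delta m m) + m * m)) cand].
Proof.
have run lam : lam <= 2 ^ (size lb).+1 -> exists al ga Fz E,
    @run_ok m fs q lam (run_entries fs (powers tb) q cls lam) al ga Fz E.
  move=> le; apply: run_entriesP => // g gf; have := small gf; move: (\sum_(j < m) _) le large => S.
  by rewrite (expnS 2 (size lb)); nia.
have leq_good err err' c : err <= err' -> good m fs q k fmax err c -> good m fs q k fmax err' c.
  move=> le H F S' sg s1 s2 s3 s4; have [S [phi [h1 h2 h3]]] := H F S' sg s1 s2 s3 s4.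
  by exists S, phi; split=> //; apply: leq_trans h3 _; rewrite leq_add2l.
(* If [many] fails already at 0, the run for [lam = 0] selects at most [k] facilities. *)
rewrite /cand_sets; case: (boolP (many _ _ _ _ _ 0)) => mn0; last first.
  have [al [ga [Fz [E r]]]] := run 0 isT; eexists; first exact: mem_head.
  have sk : size (greedy (run_entries fs (powers tb) q cls 0)) <= k.
    by apply: leq_trans (behead_greedy_size _) _; rewrite ltnNge.
  split; last 1 first.
  - apply: leq_good (single_good metric fmaxP r _ sk) => //; rewrite leq_mul2l /=; lia.
  - have /andP[_ qF] := ro_card r; have [j jF] : exists j, j \in Fz by apply/card_gt0P; exact: leq_trans qF.
    have [v vg _] := frozen_cover metric r jF.
    by move: vg; case: (greedy _).
  - exact: leqW.
  by move=> e /greedy_sub; exact: (ro_fs r).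
(* For so large a [lam], a facility recorded before the last is paid for only if some contributor's
   value exceeds all distances to it. Then a client outside [E] would contribute to it as well,
   against [ro_early]. *)
have top : ~~ many fs (powers tb) q cls k (2 ^ (size lb).+1).
  have [al [ga [Fz [E r]]]] := run _ (leqnn _).
  rewrite /many; case eb: (behead _) => [|e t] /=; first by rewrite leqNgt k0.
  have eb' : e \in behead (run_entries fs (powers tb) q cls (2 ^ (size lb).+1)) by rewrite eb mem_head.
  have ee := mem_behead eb'; have sm := small (ro_fs r ee); have pay := ro_pay r ee.
  have le_sum (j : 'I_m) : dst e.1 j <= \sum_(j < m) dst e.1 j by rewrite (bigD1 j) //= leq_addr.
  have [j ej big] : exists2 j : 'I_m, nth false e.2.2 j & \sum_(j < m) dst e.1 j < al j.
    apply/exists_inP; apply: contraLR pay; rewrite negb_exists_in => /forall_inP H; rewrite -ltnNge.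
    apply: (@leq_ltn_trans (m * \sum_(j < m) dst e.1 j + m)); last first.
      by move: sm; rewrite expnS; move: (\sum_(j < m) _) => S; nia.
    rewrite leq_add2r -[X in X * _]card_ord -sum_nat_const [X in _ <= X](bigID (fun j : 'I_m => nth false e.2.2 j)) /=.
    apply: leq_trans (leq_addr _ _); apply: leq_sum => j /H; rewrite -leqNgt; exact: leq_trans (leq_subr _ _).
  have [i iE] : exists i, i \notin E.
    apply/existsP; rewrite -negb_forall; apply/negP => /forallP all.
    have /andP[+ _] := ro_card r; rewrite (_ : E = setT) ?cardsT ?card_ord; first lia.
    by apply/setP => i; rewrite in_setT all.
  suff : i \in E by rewrite (negbTE iE).
  apply: (ro_early r eb'); rewrite (ro_mem r) // (ro_E r iE).
  have := le_sum i; have := ro_time r ee ej; have [x _ [_ ->]] := ro_src r ee; have := ro_le r x; lia.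
have [P1 P2] := search_spec mn0 top.
rewrite -/(crit fs (powers tb) q cls k (powers lb)) in P1 P2 *.
set lam := crit _ _ _ _ _ _ in P1 P2 *.
have lam_lt : lam < 2 ^ (size lb).+1.
  by have := search_le (many fs (powers tb) q cls k) (powers lb) 0; rewrite -sumn_powers ltnS add0n.
have [al1 [ga1 [Fz1 [E1 r1]]]] := run _ (ltnW lam_lt).
have [al2 [ga2 [Fz2 [E2 r2]]]] := run _ lam_lt.
(* [many] ignores the latest facility: fewer than [k] without it means at most [k] with it. *)
have kF2 : size (greedy (run_entries fs (powers tb) q cls lam.+1)) <= k.
  by apply: leq_trans (behead_greedy_size _) _; rewrite ltnNge.
have [cand cm [c1 c2 c3 c4]] := mix_good rows metric divis fmaxP r1 r2 DN N0 k0 P1 kF2.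
exists cand => //; split=> //; apply: leq_good c4; rewrite leq_mul2l /=; lia.
Qed.

End Guess.

Lemma factorE cls : factor cls = (size cls + 64) ^ (size cls).+3.
Proof.
rewrite /factor; move: (size cls + 64) => b; rewrite /= !expnS; do 3!congr (_ * _).
by elim: cls => [//|c s IH] /=; rewrite IH expnS.
Qed.

(** [delta m m] is below [(m + 2) ^ m]; the three further factors [m + 64] absorb the polynomial
    coefficients. *)
Lemma factor_bounds cls (m := size cls) : 7 * delta m m <= factor cls /\
  10 * (m * (3 * delta m m) + m * m) < factor cls.
Proof.
rewrite factorE -/m; have le : (delta m m).+1 <= (m + 64) ^ m.
  by apply: leq_trans (delta_le m m) _; apply: leq_exp2rW; lia.
rewrite !expnS; move: (delta m m) ((m + 64) ^ m) le => d P le; move: m => m.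
have h : (m + 64) * 64 * P <= (m + 64) * ((m + 64) * P) by nia.
have h2 : (m + 64) * ((m + 64) * 64 * P) <= (m + 64) * ((m + 64) * ((m + 64) * P)) by rewrite leq_mul2l h orbT.
have h3 : 0 < (m + 64) * ((m + 64) * P) by rewrite !muln_gt0; lia.
split; first by nia.
apply: leq_trans h2; nia.
Qed.

Lemma bestP cls q (L : seq (seq site)) O0 : (forall O, O \in L -> O != [::]) -> O0 \in L ->
  best cls q L \in L /\ cost_of cls q (best cls q L) <= cost_of cls q O0.
Proof.
move=> nn; suff H : (L = [::] -> best cls q L = [::]) /\ (L != [::] -> best cls q L \in L /\
    forall O, O \in L -> cost_of cls q (best cls q L) <= cost_of cls q O).
  by move=> O0L; have [|-> le] := H.2; [case: (L) O0L | split=> //; exact: le].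
elim: L nn => [|O L IH] nn //=; split=> // _.
have [|H1 H2] := IH; first by move=> O' OL; apply: nn; rewrite inE OL orbT.
case: (eqVneq L [::]) => [L0|L0].
  by rewrite L0 /= mem_head; split=> // O'; rewrite inE => /eqP->.
have [bL le] := H2 L0; rewrite (negbTE (_ : ~~ nilp (best cls q L))) /=; last first.
  by rewrite /nilp size_eq0; apply: nn; rewrite inE bL orbT.
case: ifP => [cmp|/negbT]; rewrite -?ltnNge.
  by rewrite mem_head; split=> // O'; rewrite inE => /orP[/eqP->//|/le]; exact: leq_trans.
move=> lt; rewrite inE bL orbT; split=> // O'; rewrite inE => /orP[/eqP->|/le//].
exact: ltnW.
Qed.

Lemma uniq_map_inj (T1 T2 : eqType) (f : T1 -> T2) s : uniq (map f s) -> {in s &, injective f}.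
Proof.
elim: s => [//|x s IH] /= /andP[xs us] a b; rewrite !inE => /orP[/eqP->|ai] /orP[/eqP->|bi] // e.
- by rewrite e map_f in xs.
- by rewrite -e map_f in xs.
exact: IH.
Qed.

Lemma max_fac (F : seq site) : F != [::] ->
  exists2 g : site, g \in F & forall h : site, h \in F -> h.2.1 <= g.2.1.
Proof.
elim: F => // h t IH _; case: t IH => [_|h' t IH].
  by exists h; rewrite ?mem_head // => h'; rewrite inE => /eqP->.
have [g gt gm] := IH isT; case: (leqP h.2.1 g.2.1) => cmp.
  by exists g; [rewrite inE gt orbT | move=> x; rewrite inE => /orP[/eqP->//|/gm]].
by exists h; rewrite ?mem_head // => x; rewrite inE => /orP[/eqP->//|/gm/leq_trans]; apply; exact: ltnW.
Qed.

(** * Guessing the dearest facility and undoing the scaling *)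

Section Solve.
Variables (m : nat) (fs : seq site) (q k : nat).
Hypothesis rows : forall g : site, g \in fs -> size g.2.2 = m.
Hypothesis metric : forall (g h : site) (i j : 'I_m), g \in fs -> h \in fs ->
  dst g i <= dst g j + dst h j + dst h i.
Hypothesis ids : uniq [seq g.1 | g <- fs].
Hypothesis q0 : 0 < q.
Hypothesis qm : q <= m.
Hypothesis k0 : 0 < k.
Notation cls := (iota 0 m).
Notation N := (factor cls).
Definition scale1 (g : site) : site := (g.1, (N * g.2.1, [seq N * d | d <- g.2.2])).

Lemma dst_scale g j : dst (scale1 g) j = N * dst g j.
Proof.
rewrite /dst /=; case: (ltnP j (size g.2.2)) => lj; first by rewrite (nth_map 0).
by rewrite !nth_default ?size_map // muln0.
Qed.

Lemma bin_gt0 n : 0 < n -> 2 ^ size (bin n) <= 2 * n < 2 ^ (size (bin n)).+1.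
Proof.
move=> n0; have lt : n < 2 ^ size (bin n) by rewrite -size_bin_ltn.
rewrite expnS ltn_mul2l lt /= andbT.
case es : (size (bin n)) lt => [|s] _; first by rewrite expn0; lia.
by rewrite expnS leq_mul2l /= leqNgt -size_bin_ltn es ltnn.
Qed.

Section Guess1.
Variables (F : seq site) (S' : {set 'I_m}) (sg : 'I_m -> site).
Hypothesis subF : {subset F <= fs}.
Hypothesis sizeF : size F <= k.
Hypothesis qS : q <= #|S'|.
Hypothesis sgF : forall j, j \in S' -> sg j \in F.

Lemma opened_candidate : exists O, [/\ O \in candidates fs N (time_powers fs cls) q cls k (lam_powers fs cls),
  O != [::], size O <= k.+1 & cost_of cls q O <= 11 * sol_cost F S' sg].
Proof.
have [j0 j0S] : exists j, j \in S' by apply/card_gt0P; exact: leq_trans qS.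
(* [F] is nonempty as some client is served; the bound is obtained from the guess equal to its
   dearest facility. *)
have [g gF gmax] : exists2 g : site, g \in F & forall h : site, h \in F -> h.2.1 <= g.2.1.
  by apply: max_fac; case: (F) (sgF j0S).
have N0 : 0 < N by rewrite factorE expn_gt0 addn_gt0 orbT.
have [DN errN] := factor_bounds cls; rewrite size_iota in DN errN.
have memE (h : site) : h \in scale N (cheap fs g) -> exists2 h' : site, h' \in fs & h = scale1 h' /\ h'.2.1 <= g.2.1.
  by case/mapP => h'; rewrite mem_filter => /andP[le hf] ->; exists h'.
have memI (h : site) : h \in fs -> h.2.1 <= g.2.1 -> scale1 h \in scale N (cheap fs g).
  by move=> hf le; apply: (map_f scale1); rewrite mem_filter le.
have FI (h : site) : h \in F -> scale1 h \in scale N (cheap fs g).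
  by move=> hF; apply: memI; [exact: subF | exact: gmax].
have H1 (h : site) : h \in scale N (cheap fs g) -> size h.2.2 = m.
  by case/memE => h' hf [-> _]; rewrite size_map rows.
have H2 (h h' : site) (i j : 'I_m) : h \in scale N (cheap fs g) -> h' \in scale N (cheap fs g) ->
    dst h i <= dst h j + dst h' j + dst h' i.
  move=> /memE[x xf [-> _]] /memE[y yf [-> _]]; rewrite !dst_scale -!mulnDr leq_mul2l.
  by rewrite (metric _ _ xf yf) orbT.
have H3 (h : site) (j : 'I_m) : h \in scale N (cheap fs g) -> N %| dst h j.
  by case/memE => x _ [-> _]; rewrite dst_scale dvdn_mulr.
have H4 (h : site) : h \in scale N (cheap fs g) -> h.2.1 <= N * g.2.1.
  by case/memE => x _ [-> le] /=; rewrite leq_mul2l le orbT.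
have H5 : scale N (cheap fs g) != [::] by have := FI _ gF; case: (scale _ _).
have lb0 : 0 < lam_bound fs cls by rewrite /lam_bound.
have /andP[b1 b2] := bin_gt0 lb0.
have H6 (h : site) : h \in scale N (cheap fs g) ->
    m.+1 * (h.2.1 + \sum_(j < m) dst h j).+1 <= 2 ^ size (bin (lam_bound fs cls)).
  case/memE => x xf [-> _]; apply: leq_trans (_ : lam_bound fs cls <= _); last by apply: ltnW; rewrite -size_bin_ltn.
  rewrite /lam_bound size_iota leq_mul2l /= ltnS (eq_bigr (fun j : 'I_m => N * dst x j)); last first.
    by move=> j _; rewrite dst_scale.
  rewrite -big_distrr -mulnDr leq_mul2l; apply/orP; right.
  rewrite /total sumnE big_map (big_rem x) //= sumnE (big_nth 0) rows // big_mkord.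
  exact: leq_addr.
(* With [L] the bound for [lam], the left side is at most [12 L] and the right side exceeds
   [16 L]. *)
have H7 : 3 * 2 ^ (size (bin (lam_bound fs cls))).+1 <= 2 ^ (size (bin (8 * lam_bound fs cls))).+1.
  have l8 : 0 < 8 * lam_bound fs cls by rewrite muln_gt0.
  have /andP[_ b3] := bin_gt0 l8; move: b1 b3; rewrite [2 ^ (size (bin (lam_bound fs cls))).+1]expnS.
  by move: (lam_bound fs cls) (2 ^ _) (2 ^ _) => L x y; lia.
have scls : size cls = m by rewrite size_iota.
have [cand cm [c0 ck cf cg]] := cand_good H1 H2 H3 H4 DN N0 k0 H5 q0 qm scls H6 H7.
exists (opened_of fs cand).
have sameE (h h' : site) : h \in fs -> h' \in fs -> h.1 = h'.1 -> h = h'.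
  by move=> hf hf' e; exact: (uniq_map_inj ids).
have openE (e : entry) : e \in cand -> exists2 h : site, h \in opened_of fs cand & e.1 = scale1 h.
  move=> ec; have [h hf [e1 _]] := memE _ (cf _ ec); exists h => //.
  by rewrite mem_filter hf andbT; apply/hasP; exists e; rewrite // e1 /=.
have scale1_inj (h h' : site) : h \in fs -> h' \in fs -> scale1 h = scale1 h' -> h = h'.
  by move=> hf hf' [e _ _]; exact: sameE.
(* Opening costs are compared after removing repetitions: the opened facilities are distinct and all
   occur in [cand]. *)
have uO : uniq [seq scale1 h | h <- opened_of fs cand].
  rewrite map_inj_in_uniq ?filter_uniq ?(map_uniq ids) // => h h'.
  by rewrite !mem_filter => /andP[_ hf] /andP[_ hf']; exact: scale1_inj.
have subO : {subset [seq scale1 h | h <- opened_of fs cand] <= [seq e.1 | e <- cand]}.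
  move=> x /mapP[h]; rewrite mem_filter => /andP[/hasP[e ec /eqP eh] hf] ->.
  have [h' + e1] := openE e ec; rewrite mem_filter => /andP[_ hf'].
  by rewrite (sameE h h') // -?e1; [exact: map_f | rewrite -eh e1].
have sO : size (opened_of fs cand) <= size cand.
  by have := uniq_leq_size uO subO; rewrite !size_map.
have O0 : opened_of fs cand != [::].
  by case: (cand) c0 openE => // e t _ /(_ e (mem_head _ _))[h]; case: (opened_of _ _).
have [] := cg [seq scale1 h | h <- F] S' (fun j => scale1 (sg j)).
- by move=> x /mapP[h hF ->]; exact: FI.
- by rewrite size_map.
- exact: qS.
- by move=> j /sgF; exact: map_f.
move=> S [phi [cS phiP main]].
have wit (j : 'I_m) : exists h : site, j \in S -> h \in opened_of fs cand /\ (phi j).1 = scale1 h.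
  case: (boolP (j \in S)) => jS; last by exists g.
  by have [h h1 h2] := openE _ (phiP j jS); exists h.
have [psi psiP] := fin_all_exists wit.
split=> //; last 1 first.
- have := @cost_of_le m q (opened_of fs cand) qm S psi O0 cS (fun j jS => (psiP j jS).1).
  have sc : sol_cost [seq scale1 h | h <- F] S' (fun j => scale1 (sg j)) = N * sol_cost F S' sg.
    rewrite /sol_cost big_map mulnDr -!big_distrr; congr (_ + _).
    by rewrite big_distrr; apply: eq_bigr => j _; rewrite dst_scale.
  have s1 : \sum_(j in S) dst (phi j).1 j = N * \sum_(j in S) dst (psi j) j.
    by rewrite big_distrr; apply: eq_bigr => j /psiP[_ ->]; rewrite dst_scale.
  have s2 : N * \sum_(h <- opened_of fs cand) h.2.1 <= \sum_(e <- cand) e.1.2.1.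
    by have := leq_sum_seq (fun x : site => x.2.1) uO subO; rewrite !big_map big_distrr.
  have s3 : g.2.1 <= sol_cost F S' sg by rewrite /sol_cost (big_rem g) //= -addnA leq_addr.
  move: main s2 s3; rewrite sc s1.
  move: (sol_cost _ _ _) (\sum_(j in S) _) (\sum_(h <- opened_of _ _) _) (\sum_(e <- cand) _) (cost_of _ _ _) => o d f e c.
  move: (10 * (m * _ + _)) errN => err errN main s2 s3 le; apply: leq_trans le _.
  (* The error is below [N], so [N * c < N * (11 * o + 1)], and integrality gives [c <= 11 * o]. *)
  rewrite -ltnS -(ltn_pmul2l N0) mulnDr mulnS; move: N errN main s2 => n errN main s2.
  have := leq_mul (leqnn n) s3; nia.
- apply: map_f; apply/flattenP; exists (cand_sets (scale N (cheap fs g)) (time_powers fs cls) q cls k (lam_powers fs cls)) => //.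
  exact: (map_f (fun g => cand_sets (scale N (cheap fs g)) (time_powers fs cls) q cls k (lam_powers fs cls))) (subF gF).
- exact: leq_trans sO ck.
Qed.

Lemma solve_correct : let O := solve fs q cls k in
  [/\ O != [::], subseq O fs, size O <= k.+1 & cost_of cls q O <= 11 * sol_cost F S' sg].
Proof.
have [O0 [Oc On Ok le]] := opened_candidate; rewrite /= /solve eqn0Ngt q0 /=.
set L := [seq O <- _ | _].
have OL : O0 \in L by rewrite mem_filter Oc Ok !andbT /nilp size_eq0.
have [|bL ble] := @bestP cls q L O0 _ OL.
  by move=> O; rewrite mem_filter /nilp size_eq0 => /andP[/andP[]].
move: (bL); rewrite mem_filter /nilp size_eq0 => /andP[/andP[b1 b2] b3]; split=> //.
  by case/mapP: b3 => c _ ->; exact: filter_subseq.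
exact: leq_trans ble le.
Qed.

End Guess1.
End Solve.

(** * Reading the instance and writing the solution *)

Lemma tok_bits cur ts l : foldl tok_step (false, ([::], (cur, ts))) (flatten [seq [:: b; b] | b <- l])
  = (false, ([::], (rev l ++ cur, ts))).
Proof.
have step b c : tok_step (tok_step (false, ([::], (c, ts))) b) b = (false, ([::], (b :: c, ts))) by case: b.
elim: l cur => [//|b l IH] cur; rewrite /= step IH.
by rewrite rev_cons cat_rcons.
Qed.

Lemma tok_enc_nat ts n : foldl tok_step (false, ([::], ([::], ts))) (enc_nat n)
  = (4 <= (size ts).+1, ([::], ([::], n :: ts))).
Proof.
by rewrite /enc_nat foldl_cat tok_bits /= /tok_step /= cats0 revK bval_bin.
Qed.

Definition num_den (r : rat) : seq nat := [:: absz (numq r); absz (denq r)].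

Lemma tok_rats ts (rs : seq rat) : 4 <= size ts -> (forall r, r \in rs -> 0 <= r)%R ->
  foldl tok_step (true, ([::], ([::], ts))) (flatten [seq enc_rat r | r <- rs])
  = (true, ([::], ([::], rev (flatten [seq num_den r | r <- rs]) ++ ts))).
Proof.
elim: rs ts => [//|r rs IH] ts lt nn /=.
have r0 : (0 <= numq r)%R by rewrite numq_ge0 nn // mem_head.
have d0 : (0 <= denq r)%R by exact: Order.POrderTheory.ltW (denq_gt0 r).
rewrite foldl_cat /enc_rat /num_den; case: (numq r) r0 => // a _; case: (denq r) d0 => // b _ /=.
rewrite foldl_cat tok_enc_nat /= (_ : 4 <= _) ?leqW //= tok_enc_nat /= (_ : 4 <= _) ?leqW //.
rewrite IH ?leqW //=; last by move=> x xs; apply: nn; rewrite inE xs orbT.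
by rewrite !rev_cons !cat_rcons.
Qed.

Lemma pair_up_flatten T (a b : T -> nat) (s : seq T) : pair_up (flatten [seq [:: a x; b x] | x <- s]) = [seq (a x, b x) | x <- s].
Proof.
rewrite /pair_up; set F := fun x st => _.
suff -> : foldr F (Nil nat, Nil (nat * nat)) (flatten [seq [:: a x; b x] | x <- s]) = ([::], [seq (a x, b x) | x <- s]) by [].
by elim: s => [//|x s IH] /=; rewrite IH.
Qed.

Lemma nth_indices (T : Type) (x : T) (s : seq T) i : i < size s -> nth (0, x) (zip (indices s) s) i = (i, nth x s i).
Proof. by move=> lt; rewrite nth_zip ?size_iota // nth_iota. Qed.

Lemma size_unscale ps : size (unscale ps) = size ps.
Proof. by rewrite size_map size_zip size_iota minnn. Qed.

Lemma nth_unscale ps i : i < size ps ->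
  nth 0 (unscale ps) i * (nth (0, 0) ps i).2 = (nth (0, 0) ps i).1 * \prod_(p <- ps) p.2.
Proof.
move=> lt; rewrite /unscale (nth_map (0, (0, 0))) ?size_zip ?size_iota ?minnn // nth_indices //= -mulnA.
congr (_ * _); rewrite foldrE big_map (big_nth (0, (0, 0))) size_zip size_iota minnn.
rewrite (big_nth (0, 0)) !big_mkord (bigD1 (Ordinal lt)) //= nth_indices //= eqxx mul1n mulnC.
rewrite [RHS](bigD1 (Ordinal lt)) //=; congr (_ * _); apply: eq_bigr => j ne.
by rewrite nth_indices //= -[_ == i :> nat]/(j == Ordinal lt) (negbTE ne).
Qed.

Lemma nth_allpairs_ord (T1 T2 T3 : Type) (f : T1 -> T2 -> T3) (s1 : seq T1) (s2 : seq T2) x1 x2 x3 i j :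
  i < size s1 -> j < size s2 ->
  nth x3 [seq f x y | x <- s1, y <- s2] (i * size s2 + j) = f (nth x1 s1 i) (nth x2 s2 j).
Proof.
move=> + js; elim: s1 i => [//|x s1 IH] [|i] /= lt; rewrite nth_cat size_map.
  by rewrite mul0n add0n js (nth_map x2).
by rewrite mulSn -addnA ltnNge leq_addr /= addKn IH.
Qed.

Lemma enum_pairs (A B : finType) : enum [set: A * B] = [seq (x, y) | x <- enum A, y <- enum B].
Proof. by rewrite enum_setT unlock. Qed.

(** * The decoded integer instance *)

Section Instance.
Variable I : inst.
Hypothesis valid : valid_inst I.
Notation n := (nf I + nc I).

Definition rats : seq rat := [seq fcost I i | i <- enum 'I_(nf I)] ++
  [seq dist I p | p <- enum [set: 'I_n * 'I_n]].

Lemma rats_ge0 r : r \in rats -> (0 <= r)%R.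
Proof.
case: valid => _ [f0 [d0 _]]; rewrite mem_cat => /orP[]/mapP[] => [i _ ->|[x y] _ ->]; by [exact: f0 | exact: d0].
Qed.

Lemma size_rats : size rats = nf I + n * n.
Proof.
rewrite size_cat 2!size_map; congr (_ + _); first exact: size_enum_ord.
by rewrite -cardE cardsT card_prod !card_ord.
Qed.

Lemma tokens_inst : tokens (enc_inst I) =
  [:: nf I; nc I; outl I; kk I] ++ flatten [seq num_den r | r <- rats].
Proof.
rewrite /tokens /enc_inst; do 4!rewrite (foldl_cat _ _ (enc_nat _)) tok_enc_nat /=; rewrite -flatten_cat.
have -> : [seq enc_rat (fcost I i) | i <- enum 'I_(nf I)] ++ [seq enc_rat (dist I p) | p <- enum [set: 'I_n * 'I_n]]
   = [seq enc_rat r | r <- rats] by rewrite map_cat -!map_comp.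
rewrite tok_rats //=; last exact: rats_ge0.
by rewrite rev_cat revK.
Qed.

Definition scaled := tok_vals (tokens (enc_inst I)).
(* [scaled] lists [r * denom] for [r] in [rats], see [nth_scaled]. *)
Definition denom := \prod_(r <- rats) absz (denq r).

Lemma scaledE : scaled = unscale [seq (absz (numq r), absz (denq r)) | r <- rats].
Proof. by rewrite /scaled tokens_inst /tok_vals /= drop0 -pair_up_flatten. Qed.

Lemma size_scaled : size scaled = nf I + n * n.
Proof. by rewrite scaledE size_unscale size_map size_rats. Qed.

Lemma denom_gt0 : 0 < denom.
Proof. by rewrite /denom; apply: prodn_cond_gt0 => r _; rewrite absz_gt0 denq_neq0. Qed.

Lemma nth_scaled i : i < size rats -> ((nth 0 scaled i)%:R = nth 0 rats i * denom%:R :> rat)%R.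
Proof.
move=> lt; set r := nth _ rats i.
have r0 : (0 <= r)%R by apply: rats_ge0; exact: mem_nth.
have d0 : ((absz (denq r))%:R != 0 :> rat)%R by rewrite Num.Theory.pnatr_eq0 absz_eq0 denq_neq0.
have := @nth_unscale [seq (absz (numq r), absz (denq r)) | r <- rats] i.
rewrite size_map => /(_ lt); rewrite -scaledE [X in _ = _ * X -> _]big_map -/denom !(nth_map 0%R (0, 0)) // -/r [_.2]/= [_.1]/= => /(congr1 (fun x : nat => x%:R : rat)%R).
rewrite !GRing.natrM -/r => e; apply: (GRing.mulIf d0); rewrite e.
have rE : (r * (absz (denq r))%:R = (absz (numq r))%:R)%R.
  rewrite -{1}[r]divq_num_den.
  have h1 : numq r = Posz (absz (numq r)) by rewrite gez0_abs // numq_ge0.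
  have h2 : denq r = Posz (absz (denq r)) by rewrite gez0_abs // Order.POrderTheory.ltW // denq_gt0.
  by rewrite {1}h1 {1}h2 -!pmulrn GRing.mulfVK.
by rewrite GRing.mulrAC rE.
Qed.

Definition facility (i : nat) : Datatypes.prod nat (nat * seq nat) :=
  (i, (nth 0 scaled i, take (nc I) (drop (i * n + nf I) (drop (nf I) scaled)))).

Lemma tok_facsE : tok_facs (tokens (enc_inst I)) = [seq facility i | i <- iota 0 (nf I)].
Proof.
rewrite /tok_facs /read_facs -/scaled tokens_inst /= /indices size_takel ?size_scaled ?leq_addr //.
Qed.

Lemma tok_clientsE : tok_clients (tokens (enc_inst I)) = iota 0 (nc I).
Proof.
rewrite /tok_clients -/scaled {1 2}tokens_inst /= /indices size_takel // size_drop size_scaled addKn.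
nia.
Qed.

Lemma facility_cost (i : 'I_(nf I)) : ((facility i).2.1%:R = fcost I i * denom%:R :> rat)%R.
Proof.
have lt : i < size rats by rewrite size_rats; have := ltn_ord i; lia.
rewrite /= nth_scaled //; congr (_ * _)%R; rewrite nth_cat size_map size_enum_ord ltn_ord.
by rewrite (nth_map i) ?size_enum_ord // nth_ord_enum.
Qed.

Lemma facility_size (i : 'I_(nf I)) : size (facility i).2.2 = nc I.
Proof.
rewrite /= size_takel // !size_drop size_scaled addKn; have := ltn_ord i; nia.
Qed.

Lemma facility_dst (i : 'I_(nf I)) (j : 'I_(nc I)) :
  ((dst (facility i) j)%:R = dist I (fac i, cli j) * denom%:R :> rat)%R.
Proof.
have il := ltn_ord i; have jl := ltn_ord j.
(* The [nf I] opening costs come first; row [i] of the matrix starts after [i * n] further entries,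
   and its first [nf I] entries are distances to facilities. *)
have e : dst (facility i) j = nth 0 scaled (nf I + (i * n + (nf I + j))).
  by rewrite /dst /= nth_take // !nth_drop addnA; congr nth; lia.
rewrite e nth_scaled; last by rewrite size_rats ltn_add2l; nia.
congr (_ * _)%R; rewrite nth_cat size_map size_enum_ord ltnNge leq_addr /= addKn.
have nE : n = size (enum 'I_n) by rewrite size_enum_ord.
rewrite enum_pairs (nth_map (fac i, cli j)); last first.
  by rewrite size_allpairs -!nE; nia.
have -> : i * n + (nf I + j) = i * size (enum 'I_n) + (nf I + j) by rewrite -nE.
rewrite (nth_allpairs_ord _ (fac i) (cli j)) -?nE; [|lia|lia].
congr (dist I (_, _)); first by apply: val_inj; rewrite /= nth_enum_ord //; lia.
by apply: val_inj; rewrite /= nth_enum_ord //; lia.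
Qed.

Lemma facility_metric (i i' : 'I_(nf I)) (j j' : 'I_(nc I)) :
  dst (facility i) j <= dst (facility i) j' + dst (facility i') j' + dst (facility i') j.
Proof.
case: valid => _ [_ [_ [sym tri]]].
rewrite -(Num.Theory.ler_nat rat) !GRing.natrD !facility_dst -!GRing.mulrDl.
rewrite Num.Theory.ler_pM2r ?Num.Theory.ltr0n ?denom_gt0 //.
apply: Order.POrderTheory.le_trans (tri _ (cli j') _) _; rewrite -GRing.addrA Num.Theory.lerD2l.
by rewrite [X in (_ <= X + _)%R]sym; exact: tri.
Qed.

Notation facs := [seq facility (i : 'I_(nf I)) | i <- enum 'I_(nf I)].

Lemma tok_facs_enum : tok_facs (tokens (enc_inst I)) = facs.
Proof. by rewrite tok_facsE -val_enum_ord -map_comp. Qed.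

Lemma facility_mem (g : nat * (nat * seq nat)) : g \in facs -> exists i : 'I_(nf I), g = facility i.
Proof. by case/mapP => i _ ->; exists i. Qed.

Lemma mem_facility (i : 'I_(nf I)) : facility i \in facs.
Proof. by apply: map_f; rewrite mem_enum. Qed.

Lemma facility_inj : injective (fun i : 'I_(nf I) => facility i).
Proof. by move=> i i' [e _ _]; exact: val_inj. Qed.

Section Output.
Variables (O : seq (nat * (nat * seq nat))) (q : nat).
Hypothesis subO : subseq O facs.
Hypothesis O0 : O != [::].
Hypothesis qm : q <= nc I.
Notation cls := (iota 0 (nc I)).

Definition out_sol : sol I := {|
  opened := [set i : 'I_(nf I) | facility i \in O];
  assign := [ffun j : 'I_(nc I) => if serves cls O q j then insub (near O j).2 else None] |}.

Lemma O_enum : O = [seq facility (i : 'I_(nf I)) | i <- enum (opened out_sol)].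
Proof.
have uf : uniq facs by rewrite map_inj_uniq ?enum_uniq //; exact: facility_inj.
have e := subO; move/(subseq_uniqP uf): e => e; rewrite {1}e filter_map; congr map.
rewrite [RHS]/enum_mem -enumT; by apply: eq_filter => i; rewrite /= in_set.
Qed.

Lemma assign_near (j : 'I_(nc I)) : exists2 i : 'I_(nf I), facility i \in O /\ near O j = (dst (facility i) j, val i) &
  assign out_sol j = if serves cls O q j then Some i else None.
Proof.
have [[g gO e] _] := near_spec j O0; have [i gi] := facility_mem (mem_subseq subO gO).
subst g; exists i => //.
by rewrite ffunE e /= valK.
Qed.

Lemma size_opened : #|opened out_sol| = size O.
Proof. by rewrite [in RHS]O_enum size_map -cardE. Qed.

Lemma write_solE : write_sol cls O q = enc_sol out_sol.
Proof.
rewrite /write_sol /enc_sol size_opened; congr (_ ++ (flatten _ ++ flatten _)).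
  by rewrite {1}O_enum -map_comp.
rewrite /assigned -{2}val_enum_ord -!map_comp; apply: eq_map => j.
rewrite [LHS]/= [in RHS]/=; have [i [_ ->] ->] := assign_near j.
by case: ifP.
Qed.

Lemma out_feasible K : size O <= K -> nc I - outl I = q -> feasible K out_sol.
Proof.
move=> sK eq; split; first by rewrite size_opened.
split=> [j i|].
  by have [i' [iO _] ->] := assign_near j; case: ifP => // _ [<-]; rewrite inE.
rewrite eq -(@card_first_q (nc I) q (fun j : 'I_(nc I) => (near O j).1) qm).
apply/subset_leq_card/subsetP => j; rewrite -servesE inE => sj.
by have [i _ ->] := assign_near j; rewrite sj.
Qed.

Lemma out_cost : ((cost_of cls q O)%:R = cost out_sol * denom%:R :> rat)%R.
Proof.
case: valid => _ [_ [_ [sym _]]].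
rewrite /cost_of /cost GRing.natrD GRing.mulrDl; congr (_ + _)%R.
  rewrite sumnE big_map {1}O_enum big_map GRing.natr_sum big_enum GRing.mulr_suml.
  by apply: eq_bigr => i _; rewrite facility_cost.
rewrite sumnE big_map {1}iota_index big_mkord GRing.natr_sum GRing.mulr_suml.
apply: eq_bigr => j _; have [i [_ e] ->] := assign_near j; rewrite e /=.
by case: ifP => _; rewrite ?GRing.mul0r // facility_dst sym.
Qed.

End Output.

Section Optimum.
Variable S : sol I.
Hypothesis feas : feasible (kk I) S.
Definition opt_facs := [seq facility (i : 'I_(nf I)) | i <- enum (opened S)].
Definition opt_served : {set 'I_(nc I)} := [set j | assign S j != None].
Definition opt_near (j : 'I_(nc I)) := if assign S j is Some i then facility i else (0, (0, [::])).

Lemma opt_sub : {subset opt_facs <= facs}.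
Proof. by move=> x /mapP[i _ ->]; exact: mem_facility. Qed.

Lemma opt_size : size opt_facs <= kk I.
Proof. by case: feas => h _; rewrite size_map -cardE. Qed.

Lemma opt_nearP j : j \in opt_served -> opt_near j \in opt_facs.
Proof.
case: feas => _ [h _]; rewrite inE /opt_near; case e: (assign S j) => [i|//] _.
by apply: map_f; rewrite mem_enum (h _ _ e).
Qed.

Lemma opt_cost : ((sol_cost opt_facs opt_served opt_near)%:R = cost S * denom%:R :> rat)%R.
Proof.
case: valid => _ [_ [_ [sym _]]].
rewrite /sol_cost /cost GRing.natrD GRing.mulrDl; congr (_ + _)%R.
  rewrite big_map GRing.natr_sum big_enum GRing.mulr_suml.
  by apply: eq_bigr => i _; rewrite facility_cost.
rewrite big_mkcond GRing.natr_sum GRing.mulr_suml.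
apply: eq_bigr => j _; rewrite inE /opt_near; case: (assign S j) => [i|] /=; last by rewrite GRing.mul0r.
by rewrite facility_dst sym.
Qed.

End Optimum.

Lemma algorithm_correct : (exists S0 : sol I, feasible (kk I) S0) ->
  exists S : sol I, [/\ algorithm (enc_inst I) = enc_sol S, feasible (kk I).+1 S &
    forall S' : sol I, feasible (kk I) S' -> (cost S <= 11%:R * cost S')%R].
Proof.
move=> [S0 feas0]; have [k0 [f0 [d0 _]]] := valid.
have e1 : nth 0 (tokens (enc_inst I)) 1 - nth 0 (tokens (enc_inst I)) 2 = nc I - outl I by rewrite tokens_inst.
have e3 : nth 0 (tokens (enc_inst I)) 3 = kk I by rewrite tokens_inst.
rewrite /algorithm /tok_solve e1 e3 tok_clientsE tok_facs_enum.
set q := nc I - outl I; have qm : q <= nc I by exact: leq_subr.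
(* For [q = 0] no client has to be served, and the output encodes the solution that opens
   nothing. *)
have [q0|q0] := posnP q.
  exists {| opened := set0 : {set 'I_(nf I)}; assign := [ffun=> None] |}; split.
  - rewrite /solve q0 eqxx /write_sol /enc_sol cards0 enum_set0; congr (_ ++ (_ ++ flatten _)).
    rewrite /assigned -val_enum_ord -!map_comp; apply: eq_map => j /=.
    by rewrite /serves /= ffunE.
  - by split; [rewrite /= cards0 | split=> [j i|]; rewrite ?ffunE // -/q q0].
  move=> S' _; rewrite /cost big_set0 GRing.add0r big1 => [|j _]; last by rewrite ffunE.
  apply: Num.Theory.mulr_ge0 => //; apply: Num.Theory.addr_ge0; apply: Num.Theory.sumr_ge0 => // j _.
  by case: (assign S' j).
(* The output of [solve] does not depend on [S'], so a single solution is compared with all feasible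
   ones; [S0] yields its properties that mention no other solution. *)
have main S' (fS : feasible (kk I) S') : let O := solve facs q (iota 0 (nc I)) (kk I) in
    [/\ O != [::], subseq O facs, size O <= (kk I).+1 &
      cost_of (iota 0 (nc I)) q O <= 11 * sol_cost (opt_facs S') (opt_served S') (opt_near S')].
  apply: solve_correct => //.
  - by move=> g /facility_mem[i ->]; exact: facility_size.
  - by move=> g h i j /facility_mem[x ->] /facility_mem[y ->]; exact: facility_metric.
  - rewrite -map_comp map_inj_uniq ?enum_uniq // => i i'; exact: val_inj.
  - exact: opt_sub.
  - exact: opt_size.
  - by case: fS => _ [].
  exact: opt_nearP.
have [On sub sO _] := main _ feas0; set O := solve _ _ _ _ in main On sub sO *.
exists (out_sol O q); split.
- exact: write_solE.
- exact: out_feasible.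
move=> S' fS'; have [_ _ _ le] := main _ fS'.
rewrite -(Num.Theory.ler_pM2r (_ : 0 < denom%:R)%R) ?Num.Theory.ltr0n ?denom_gt0 //.
by rewrite -GRing.mulrA -out_cost // -opt_cost -GRing.natrM Num.Theory.ler_nat.
Qed.

End Instance.

Import Order.TTheory GRing.Theory Num.Theory.

Theorem theorem1 :
  exists (M : TM) (c : nat),
    forall I : inst, valid_inst I ->
      (exists S0 : sol I, feasible (kk I) S0) ->
      exists fin : config M,
        @exec M ((size (enc_inst I)).+2 ^ c) (@init M (enc_inst I)) = Some fin /\
        exists S : sol I,
          @output M fin = enc_sol S /\
          feasible (kk I).+1 S /\
          (forall S' : sol I, feasible (kk I) S' ->
             (cost S <= 11%:R * cost S')%R).
Proof.
have [M [c run]] := PT_TM PT_algorithm.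
exists M, c => I valid feas; have [fin e out] := run (enc_inst I); exists fin; split=> //.
by have [S [eS fS best]] := algorithm_correct valid feas; exists S; rewrite out eS.
Qed.
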